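(* Let $\mathsf X:=\mathbb R^2\times\mathbb S^1\subset\mathbb R^4$, with points $x=[p,o]$, let $\Omega>0$, $\alpha,c>0$, $\varpi\in\mathbb N$, and let $\psi\colon\mathbb R^2\to\mathbb R$ be smooth. For $a>0$ consider the averaged unicycle system $\dot{\bar x}=\bar\Sigma^a_{\mathsf X}(\bar x,\bar w)$ on $\mathsf X$ with scalar input $\bar w\in L^1_\infty$, where $\bar\Sigma^a_{\mathsf X}([p,o],w):=\Big(\big(\tfrac{\alpha c}{2}\langle\nabla\psi(p),o\rangle+a\,\phi^a([p,o])+w\big)\,o,\ \Omega\,o_\perp\Big)$, $\phi^a([p,o]):=\frac1{2\pi}\int_0^{2\pi}\int_0^1(1-s)\,U(\tau)^2v(\tau)\,\langle\nabla^2\psi(p+asU(\tau)o)o,o\rangle\,\mathrm ds\,\mathrm d\tau$, $U(\tau):=\alpha\sin(\varpi\tau)$, $v(\tau):=c\sin(\varpi\tau)$. Let $p_\ast\in\mathbb R^2$. (a) If $\psi$ satisfies conditions 1–7 below with $N=2$ and this $p_\ast$, then there exists $a_0>0$ such that $\bar\Sigma^a_{\mathsf X}$ is 0-GAS with respect to $\{p_\ast\}\times\mathbb S^1$ for every $a\in(0,a_0)$. (b) If $\psi$ satisfies conditions 1–4 below with $N=2$ and this $p_\ast$, and there exist $\chi_1,\chi_2,\chi_3\in\mathcal K_\infty$ with $-\chi_1(|p-p_\ast|)\ge\psi(p)-y_\ast\ge-\chi_2(|p-p_\ast|)$ and $|\nabla\psi(p)|\ge\chi_3(|p-p_\ast|)$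 for every $p\in\mathbb R^2$, then there exists $a_0>0$ such that $\bar\Sigma^a_{\mathsf X}$ is ISS with respect to $\{p_\ast\}\times\mathbb S^1$ for every $a\in(0,a_0)$.
   Context: $\mathbb S^1$ is the unit circle in $\mathbb R^2$; for $o\in\mathbb S^1$, $o_\perp\in\mathbb S^1$ is the unique element such that $(o,o_\perp)$ is a positively oriented orthonormal basis of $\mathbb R^2$ (rotation of $o$ by $+\pi/2$). In the angle chart $o=(\cos\theta,\sin\theta)$, the vector field above is $\Omega\partial_\theta+(\ldots)(\cos\theta\,\partial_{p^1}+\sin\theta\,\partial_{p^2})$. Conditions on smooth $\psi\colon\mathbb R^N\to\mathbb R$ and $p_\ast$ (with $y_\ast:=\psi(p_\ast)$, $|\nabla^2\psi(p)|$ the operator norm, $\psi^{-1}(\ge y):=\{p:\psi(p)\ge y\}$): (1) $\psi(p)<y_\ast$ for all $p\ne p_\ast$; (2) $\nabla^2\psi(p_\ast)$ negative definite; (3) there is $r_1>0$ with $\psi(p_\ast+v)=\psi(p_\ast-v)$ for $|v|\le r_1$; (4) there is $c_1>0$ with $|\nabla^2\psi(p)|\le c_1$ for all $p$; (5) $\nabla\psi(p)\ne0$ for $p\ne p_\ast$; (6) for every $y\in(\underline y,y_\ast)$, $\psi^{-1}(\ge y)$ is compact, where $\underline y:=\inf\psi\in\mathbb R\cup\{-\infty\}$; (7) there are $c_2,r_2,r_3>0$ with $|\nabla^2\psi(p+v)|\le c_2|\nabla\psi(p)|$ for all $|p-p_\ast|\ge r_2$, $|v|\le r_3$. $L^1_\infty$: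 measurable locally essentially bounded $\mathbb R\to\mathbb R$, $\|\cdot\|$ essential sup norm. $\mathcal K,\mathcal K_\infty,\mathcal{KL}$ are the usual comparison classes. With $|x|_K$ the Euclidean distance in $\mathbb R^4$ to $K:=\{p_\ast\}\times\mathbb S^1$: 0-GAS w.r.t. $K$ means there is $\bar\beta\in\mathcal{KL}$ with $|\bar x(t)|_K\le\bar\beta(|\bar x(0)|_K,t)$ for all $t\ge0$ for every maximal solution with $\bar w\equiv0$; ISS w.r.t. $K$ means there are $\bar\beta\in\mathcal{KL}$, $\bar\gamma\in\mathcal K$ with $|\bar x(t)|_K\le\bar\beta(|\bar x(0)|_K,t)+\bar\gamma(\|\bar w\|)$ for all $t\ge0$, all inputs and initial states. *)

(* Defs.v *)
From HB Require Import structures.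
From mathcomp Require Import all_boot all_order all_algebra.
From mathcomp Require Import all_classical all_reals all_analysis.
From mathcomp Require Import Rstruct Rstruct_topology ess_sup_inf.
Set Implicit Arguments. Unset Strict Implicit. Unset Printing Implicit Defensive.
Import Order.TTheory GRing.Theory Num.Theory.
Import numFieldNormedType.Exports.
Local Open Scope classical_set_scope.
Local Open Scope ring_scope.

Section Unicycle.
Context {R : realType}.

Definition pt := (R * R)%type.
Definition st := (pt * pt)%type.

Definition dot (u v : pt) : R := u.1 * v.1 + u.2 * v.2.
Definition nrm (u : pt) : R := Num.sqrt (dot u u).
Definition padd (u v : pt) : pt := (u.1 + v.1, u.2 + v.2).
Definition psub (u v : pt) : pt := (u.1 - v.1, u.2 - v.2).
Definition pscal (k : R) (u : pt) : pt := (k * u.1, k * u.2).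
Definition perp (o : pt) : pt := (- o.2, o.1).

Definition S1 : set pt := [set o | nrm o = 1].
Definition inX (x : st) : Prop := S1 x.2.

Definition pd (i : bool) (f : R -> R -> R) : R -> R -> R :=
  fun x y => if i then derive1 (fun t => f x t) y else derive1 (fun t => f t y) x.
Definition pd_ex (i : bool) (f : R -> R -> R) (x y : R) : Prop :=
  if i then derivable (fun t => f x t) y 1 else derivable (fun t => f t y) x 1.

Fixpoint dpar (s : seq bool) (f : R -> R -> R) : R -> R -> R :=
  if s is i :: s' then pd i (dpar s' f) else f.

Definition curry2 (psi : pt -> R) : R -> R -> R := fun x y => psi (x, y).

Definition smooth2 (psi : pt -> R) : Prop :=
  forall s : seq bool,
    (forall (i : bool) (p : pt), pd_ex i (dpar s (curry2 psi)) p.1 p.2) /\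
    continuous (fun p : pt => dpar s (curry2 psi) p.1 p.2).

Definition grad (psi : pt -> R) (p : pt) : pt :=
  (pd false (curry2 psi) p.1 p.2, pd true (curry2 psi) p.1 p.2).
Definition hessE (psi : pt -> R) (i j : bool) (p : pt) : R :=
  dpar [:: i; j] (curry2 psi) p.1 p.2.
Definition hessv (psi : pt -> R) (p v : pt) : pt :=
  (hessE psi false false p * v.1 + hessE psi false true p * v.2,
   hessE psi true false p * v.1 + hessE psi true true p * v.2).
Definition opnorm_hess (psi : pt -> R) (p : pt) : R :=
  sup [set nrm (hessv psi p v) | v in S1].

(** Conditions 1-7 on psi (N = 2), with y_* = psi p_* *)
Definition cond1 (psi : pt -> R) (ps : pt) : Prop :=
  forall p, p <> ps -> psi p < psi ps.
Definition cond2 (psi : pt -> R) (ps : pt) : Prop :=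
  forall v : pt, v <> (0, 0) -> dot (hessv psi ps v) v < 0.
Definition cond3 (psi : pt -> R) (ps : pt) : Prop :=
  exists r1 : R, 0 < r1 /\
    forall v : pt, nrm v <= r1 -> psi (padd ps v) = psi (psub ps v).
Definition cond4 (psi : pt -> R) : Prop :=
  exists c1 : R, 0 < c1 /\ forall p, opnorm_hess psi p <= c1.
Definition cond5 (psi : pt -> R) (ps : pt) : Prop :=
  forall p, p <> ps -> grad psi p <> (0, 0).
Definition inf_psi (psi : pt -> R) : \bar R :=
  ereal_inf [set (psi p)%:E | p in setT].
Definition cond6 (psi : pt -> R) (ps : pt) : Prop :=
  forall y : R, (inf_psi psi < y%:E)%E -> y < psi ps ->
    compact [set p : pt | y <= psi p].
Definition cond7 (psi : pt -> R) (ps : pt) : Prop :=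
  exists c2 r2 r3 : R, [/\ 0 < c2, 0 < r2 & 0 < r3] /\
    forall p v : pt, r2 <= nrm (psub p ps) -> nrm v <= r3 ->
      opnorm_hess psi (padd p v) <= c2 * nrm (grad psi p).

Definition Uf (alpha : R) (varpi : nat) (tau : R) : R := alpha * sin (varpi%:R * tau).
Definition vf (c : R) (varpi : nat) (tau : R) : R := c * sin (varpi%:R * tau).

Definition phi_a (psi : pt -> R) (alpha c : R) (varpi : nat) (a : R) (x : st) : R :=
  let p := x.1 in let o := x.2 in
  (2 * pi)^-1 *
  \int[lebesgue_measure]_(tau in `[0, 2 * pi]%classic)
    \int[lebesgue_measure]_(s in `[0, 1]%classic)
      ((1 - s) * (Uf alpha varpi tau) ^+ 2 * vf c varpi tau *
       dot (hessv psi (padd p (pscal (a * s * Uf alpha varpi tau) o)) o) o).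

Definition field (psi : pt -> R) (Om alpha c : R) (varpi : nat) (a : R)
    (x : st) (w : R) : st :=
  let p := x.1 in let o := x.2 in
  (pscal (alpha * c / 2 * dot (grad psi p) o + a * phi_a psi alpha c varpi a x + w) o,
   pscal Om (perp o)).

(** Solutions (in the Caratheodory sense, written in integral form) *)
Definition ieq (u g : R -> R) (t : R) : Prop :=
  (lebesgue_measure).-integrable `[0, t]%classic (EFin \o g) /\
  u t = u 0 + \int[lebesgue_measure]_(s in `[0, t]%classic) g s.

Definition is_sol (F : st -> R -> st) (w : R -> R) (T : \bar R) (x : R -> st) : Prop :=
  inX (x 0) /\
  forall t : R, 0 <= t -> (t%:E < T)%E ->
    [/\ ieq (fun s => (x s).1.1) (fun s => (F (x s) (w s)).1.1) t,
        ieq (fun s => (x s).1.2) (fun s => (F (x s) (w s)).1.2) t,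
        ieq (fun s => (x s).2.1) (fun s => (F (x s) (w s)).2.1) t &
        ieq (fun s => (x s).2.2) (fun s => (F (x s) (w s)).2.2) t].

Definition maximal_sol (F : st -> R -> st) (w : R -> R) (T : \bar R) (x : R -> st) : Prop :=
  (0 < T)%E /\ is_sol F w T x /\
  forall (T' : \bar R) (y : R -> st), (T < T')%E -> is_sol F w T' y ->
    ~ (forall t : R, 0 <= t -> (t%:E < T)%E -> y t = x t).

Definition Linf_loc (w : R -> R) : Prop :=
  measurable_fun setT w /\
  forall b : R, exists M : R,
    \forall t \ae (@lebesgue_measure R), `[- b, b]%classic t -> `|w t| <= M.

Definition esnorm (w : R -> R) : \bar R :=
  ess_sup (@lebesgue_measure R) (fun t => (`|w t|)%:E).

Definition dist4 (x y : st) : R :=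
  Num.sqrt (dot (psub x.1 y.1) (psub x.1 y.1) + dot (psub x.2 y.2) (psub x.2 y.2)).
Definition distK (ps : pt) (x : st) : R :=
  inf [set dist4 x (ps, o) | o in S1].

Definition classK (g : R -> R) : Prop :=
  [/\ g 0 = 0, {within `[0, +oo[%classic, continuous g} &
      forall r s, 0 <= r -> r < s -> g r < g s].
Definition classKinf (g : R -> R) : Prop :=
  classK g /\ forall M : R, exists r : R, 0 <= r /\ M <= g r.
Definition classKL (b : R -> R -> R) : Prop :=
  (forall t, 0 <= t -> classK (fun r => b r t)) /\
  (forall r, 0 <= r ->
     (forall t1 t2, 0 <= t1 -> t1 <= t2 -> b r t2 <= b r t1) /\
     (b r t @[t --> +oo] --> 0)).

(** 0-GAS and ISS with respect to K = {p_*} x S^1.  "for all t >= 0" for a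
    maximal solution includes that it is defined on all of [0, +oo). *)
Definition zeroGAS (F : st -> R -> st) (ps : pt) : Prop :=
  exists b, classKL b /\
    forall (T : \bar R) (x : R -> st), maximal_sol F (fun _ => 0) T x ->
      T = +oo%E /\
      forall t, 0 <= t -> distK ps (x t) <= b (distK ps (x 0)) t.

Definition ISS (F : st -> R -> st) (ps : pt) : Prop :=
  exists b g, classKL b /\ classK g /\
    forall (w : R -> R) (T : \bar R) (x : R -> st), Linf_loc w ->
      maximal_sol F w T x ->
      T = +oo%E /\
      forall t, 0 <= t ->
        ((distK ps (x t))%:E <= (b (distK ps (x 0)) t)%:E +
           (match esnorm w with
            | EFin m => (g m)%:E
            | _ => +oo end))%E.

End Unicycle.

(* Main.v *)
Require Import Defs.
From mathcomp Require Import all_boot all_order all_algebra.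
From mathcomp Require Import all_classical all_reals all_analysis.
From mathcomp Require Import Rstruct Rstruct_topology.
From mathcomp Require Import measurable_realfun ess_sup_inf exp trigo ring lra.
Set Implicit Arguments. Unset Strict Implicit. Unset Printing Implicit Defensive.
Import Order.TTheory GRing.Theory Num.Theory.
Import numFieldNormedType.Exports.
Local Open Scope classical_set_scope.
Local Open Scope ring_scope.

(** With [n = |grad psi(p)|], [G = <grad psi(p), o>] and [V = psi(ps) - psi(p)], the motion only
    yields dV/dt = -(alpha c / 2) G^2 up to errors, which is degenerate when [o] is orthogonal to
    the gradient.  Since the orientation rotates, the correction
    [lyap = V + eps <M(o) grad psi, grad psi>] with Om dM/dtheta = o o^T - I/2 has derivative at most
    - (eps/4) n^2 + 2 |w| n, provided [a |phi^a| <= (eps/16) n].  Taylor's formula for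
    [psi(p + b o)] bounds [phi^a] by the Hessian; near [ps] the symmetry of [psi] makes [phi^a]
    vanish at [ps], so that [|phi^a| <= C n] everywhere.  Bounded Hessian gives
    n^2 <= 8 c1 V, so that [lyap] and [V] are comparable; on each sublevel set the decay is
    exponential, with a rate depending only on the initial distance, which directly gives a KL bound
    of the form r A/kap(r) exp(- B kap(r)^2 t).  The input is only locally bounded, hence the
    decrease of [lyap] is obtained from one-sided difference quotients. *)

(** * Calculus on lines and one-sided estimates *)

(** The correction comes from averaging over one turn: [G^2] has angular mean [n^2 / 2], and [M] is
    a periodic primitive of the deviation from that mean. Adding [eps] times its form trades part of
    the decay in [G^2] for decay in all of [n^2]. The price is a cross term caused by the motion of
    the gradient itself, hence the smallness of [eps] against [alpha c / 2] and against the Hessian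
    bound. Parts (a) and (b) share one argument, fed by two facts: sublevel sets of [lyap] are
    bounded ([traps]), and far from [ps] the Hessian is dominated by the gradient ([far]). Its
    outcome is a dichotomy: either the decaying bound holds, or the state lies in a residual
    sublevel set determined by the input bound. For zero input that set is [ps] alone; for (b) its
    radius becomes the gain. Solutions are not assumed global. The orientation is an explicit
    rotation and the bounded Hessian makes the planar speed globally Lipschitz, so each maximal
    solution coincides with a Picard solution on the half-line. *)

Section Calculus.
Context {R : realType}.
Implicit Types (x y h k t : R).

Lemma cont2_eps (q : R * R -> R) (p : R * R) : {for p, continuous q} ->
  forall e, 0 < e -> exists2 d : R, 0 < d & forall x y,
    `|x - p.1| < d -> `|y - p.2| < d -> `|q (x, y) - q p| < e.
Proof.
move=> /cvgrPdist_lt qc e e0.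
have : nbhs p (fun z => `|q p - q z| < e) by exact: qc.
move=> /nbhs_ballP[r /= r0 rq]; exists r => // x y xr yr.
rewrite distrC; apply: rq; split => /=; rewrite /ball/= distrC//.
Qed.

Lemma eps_is_derive (f : R -> R) x l :
  (forall e, 0 < e -> exists2 d, 0 < d & forall h, `|h| < d ->
     `|f (x + h) - f x - l * h| <= e * `|h|) -> is_derive x 1 f l.
Proof.
move=> H.
have C : h^-1 *: (f (h *: 1 + x) - f x) @[h --> 0^'] --> l.
  apply/cvgrPdist_le => /= e e0; have [d d0 dH] := H e e0.
  near=> h.
  have h0 : h != 0 by near: h; exact: nbhs_dnbhs_neq.
  have hd : `|h| < d by near: h; apply: dnbhs0_lt.
  have := dH h hd; rewrite /GRing.scale/= mulr1 (addrC h).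
  rewrite -(ler_pdivrMr _ _ (_ : 0 < `|h|)) ?normr_gt0// -normfV -normrM.
  by rewrite distrC mulrBl mulfK// (mulrC h^-1).
apply: DeriveDef; first by apply/cvg_ex; exists l.
exact/cvg_lim.
Unshelve. all: by end_near. Qed.

(** No order between [a] and [b] is imposed, since increments along lines come with either sign. Of
    the position of [c] only its distance to [a] is kept, which is what the later estimates
    consume. *)
Lemma mvt_between (f df : R -> R) a b : (forall t, is_derive t 1 f (df t)) ->
  exists2 c, `|c - a| <= `|b - a| & f b - f a = df c * (b - a).
Proof.
move=> fd; have cf : continuous f.
  by move=> t; apply: differentiable_continuous; apply/derivable1_diffP; case: (fd t).
have [ab|/ltW ba] := leP a b.
  have [c cab E] := MVT_segment ab (fun t _ => fd t) (continuous_subspaceT cf).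
  exists c => //; move: cab; rewrite in_itv/= => /andP[ac cb].
  by rewrite !ger0_norm ?subr_ge0// lerD2r.
have [c cab E] := MVT_segment ba (fun t _ => fd t) (continuous_subspaceT cf).
exists c; last by rewrite -opprB E; ring.
move: cab; rewrite in_itv/= => /andP[bc ca].
by rewrite !ler0_norm ?subr_le0// lerN2 lerD2r.
Qed.

Definition C1 (g gx gy : R -> R -> R) :=
  [/\ forall x y, is_derive x 1 (g^~ y) (gx x y),
      forall x y, is_derive y 1 (g x) (gy x y),
      continuous (fun p : R * R => gx p.1 p.2) &
      continuous (fun p : R * R => gy p.1 p.2)].

(** Continuous partial derivatives give a full expansion by walking along the axes: one mean value
    in [x] at height [y + k], then one in [y] at abscissa [x]. *)
Lemma C1_expand g gx gy : C1 g gx gy -> forall x y e, 0 < e ->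
  exists2 d, 0 < d & forall h k, `|h| < d -> `|k| < d ->
  `|g (x + h) (y + k) - g x y - gx x y * h - gy x y * k| <= e * (`|h| + `|k|).
Proof.
move=> [dx dy cx cy] x y e e0.
have [d1 d10 H1] := cont2_eps (cx (x, y)) e0.
have [d2 d20 H2] := cont2_eps (cy (x, y)) e0.
exists (Num.min d1 d2) => [|h k]; first by rewrite lt_min d10.
rewrite !lt_min => /andP[h1 h2] /andP[k1 k2].
have [c1 c1h E1] := mvt_between x (x + h) (fun t => dx t (y + k)).
have [c2 c2k E2] := mvt_between y (y + k) (dy x).
rewrite !(addrC x, addrC y) !addrK in c1h c2k E1 E2 *.
have := H1 c1 (k + y) (le_lt_trans c1h h1); rewrite /= addrK => /(_ k1) G1.
have := H2 x c2; rewrite /= subrr normr0 => /(_ d20 (le_lt_trans c2k k2)) G2.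
rewrite (_ : _ - _ = (gx c1 (k + y) - gx x y) * h + (gy x c2 - gy x y) * k); last first.
  by rewrite !mulrBl -E1 -E2; ring.
rewrite (le_trans (ler_normD _ _))// !normrM mulrDr lerD// ler_wpM2r// ltW//.
Qed.

Lemma C1_line g gx gy : C1 g gx gy -> forall (x y a b s : R),
  is_derive s 1 (fun s => g (x + s * a) (y + s * b))
    (gx (x + s * a) (y + s * b) * a + gy (x + s * a) (y + s * b) * b).
Proof.
move=> gC x y a b s; apply: eps_is_derive => e e0.
pose m := `|a| + `|b| + 1.
have m0 : 0 < m by rewrite /m ltr_wpDl// addr_ge0.
have [d d0 H] := C1_expand gC (x + s * a) (y + s * b) (divr_gt0 e0 m0).
exists (d / m) => [|h hd]; first exact: divr_gt0.
have ha : `|h * a| < d.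
  rewrite normrM (le_lt_trans (_ : _ <= `|h| * m))// -?ltr_pdivlMr//.
  by rewrite ler_wpM2l// /m -addrA lerDl addr_ge0.
have hb : `|h * b| < d.
  rewrite normrM (le_lt_trans (_ : _ <= `|h| * m))// -?ltr_pdivlMr//.
  by rewrite ler_wpM2l// /m addrAC lerDr addr_ge0.
have -> : g (x + (s + h) * a) (y + (s + h) * b) - g (x + s * a) (y + s * b) -
    (gx (x + s * a) (y + s * b) * a + gy (x + s * a) (y + s * b) * b) * h =
  g (x + s * a + h * a) (y + s * b + h * b) - g (x + s * a) (y + s * b) -
    gx (x + s * a) (y + s * b) * (h * a) - gy (x + s * a) (y + s * b) * (h * b).
  by rewrite !mulrDl !addrA; ring.
apply: le_trans (H _ _ ha hb) _.
rewrite !normrM -mulrDr mulrAC ler_pdivrMr// -mulrA ler_wpM2l ?(ltW e0)//.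
by rewrite ler_wpM2l// lerDl.
Qed.

End Calculus.

(** * Differential inequalities for one-sided difference quotients *)

Section Dini.
Context {R : realType}.
Implicit Types (a b h s t : R).

Lemma is_derive_eps (f : R -> R) (x l : R) : is_derive x 1 f l ->
  forall e, 0 < e -> exists2 d, 0 < d & forall h, `|h| < d ->
     `|f (x + h) - f x - l * h| <= e * `|h|.
Proof.
move=> [fd fl] e e0.
have C : h^-1 *: (f (h *: 1 + x) - f x) @[h --> 0^'] --> l by rewrite -fl; exact: fd.
move/cvgrPdist_le : C => /(_ e e0) /nbhs_ballP [d /= d0 H].
exists d => // h hd; have [->|h0] := eqVneq h 0.
  by rewrite addr0 subrr mulr0 subrr normr0 mulr0.
have /= := H h; rewrite /ball/= sub0r normrN => /(_ hd h0).
rewrite /GRing.scale/= mulr1 (addrC h).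
rewrite -(ler_pM2r (_ : 0 < `|h|)) ?normr_gt0// -normrM.
by rewrite mulrBl mulrAC mulVf// mul1r distrC.
Qed.

(** Relative to [[a, b]] because a local solution is controlled only on its interval of existence,
    so continuity on the whole line cannot be asked of it. *)
Definition cont_on (a b : R) (z : R -> R) := forall s, a <= s <= b ->
  forall e, 0 < e -> exists2 d, 0 < d & forall t, a <= t <= b -> `|t - s| < d ->
    `|z t - z s| < e.

Lemma cont_on_continuous a b z : continuous z -> cont_on a b z.
Proof.
move=> zc s _ e e0; have /cvgrPdist_lt/(_ e e0)/nbhs_ballP[d /= d0 H] := zc s.
by exists d => // t _ ts; rewrite distrC; apply: H; rewrite /ball/= distrC.
Qed.

(** Continuous induction: the last time at which the inequality tilted by slope [e] holds is reached
    by continuity, and the one-sided hypothesis pushes it further right unless it is [b]. *)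
Lemma dini_le (z : R -> R) a b : a <= b -> cont_on a b z ->
  (forall s, a <= s < b -> forall e, 0 < e ->
     exists2 d, 0 < d & forall h, 0 < h < d -> z (s + h) <= z s + e * h) ->
  z b <= z a.
Proof.
move=> ab zc zD; apply/ler_addgt0Pr => _/posnumP[e'].
pose e := e'%:num / (b - a + 1).
have e0 : 0 < e by rewrite divr_gt0// ltr_wpDl// subr_ge0.
have eb : e * (b - a) <= e'%:num.
  rewrite /e mulrAC ler_pdivrMr ?ltr_wpDl ?subr_ge0//.
  by rewrite ler_wpM2l// lerDl.
suff H : z b - e * (b - a) <= z a by lra.
rewrite leNgt; apply/negP => gb.
pose A := [set t | a <= t <= b /\ z t - e * (t - a) <= z a].
have Aa : A a by split; [rewrite lexx|rewrite subrr mulr0 subr0].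
have supA : has_sup A.
  by split; [exists a|exists b => t [/andP[]]].
pose s := sup A.
have as_ : a <= s by apply: sup_upper_bound.
have sb : s <= b by apply: ge_sup; [exists a|move=> t [/andP[]]].
have sab : a <= s <= b by rewrite as_ sb.
have gs : z s - e * (s - a) <= z a.
  rewrite leNgt; apply/negP => gs.
  pose eta := (z s - e * (s - a) - z a) / 2.
  have eta0 : 0 < eta by rewrite divr_gt0// subr_gt0.
  have [d d0 H] := zc s sab eta eta0.
  have [t [tab At] st] := sup_adherent d0 supA.
  have ts : t <= s by apply: sup_upper_bound.
  move: st; rewrite -/s ltrBlDr -ltrBlDl => std.
  have := H t tab; rewrite ler0_norm ?subr_le0// opprB => /(_ std).
  rewrite ltr_norml => /andP[H1 _].
  have : 0 <= e * (s - t) by rewrite mulr_ge0 ?subr_ge0 ?(ltW e0).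
  have : eta * 2 = z s - e * (s - a) - z a by rewrite /eta divfK.
  by move: At H1; lra.
have {}sb : s < b.
  rewrite lt_neqAle sb andbT; apply/eqP => E; move: gs; rewrite E.
  by rewrite leNgt gb.
have [d d0 H] := zD s (introT andP (conj as_ sb)) e e0.
pose h := Num.min (d / 2) (b - s).
have h0 : 0 < h by rewrite lt_min divr_gt0// subr_gt0.
have hd : h < d by rewrite gt_min ltr_pdivrMr// ltr_pMr// ltr1n.
have hb : s + h <= b by rewrite -lerBrDl ge_min lexx orbT.
have := H h; rewrite h0 hd => /(_ isT) zh.
have : A (s + h) by split; [apply/andP; split=> //; lra|move: gs; lra].
move=> /(sup_upper_bound supA); rewrite -/s; lra.
Qed.

(** Reduces to [dini_le] for [y t * expR (- l * t)]: a positive factor can be multiplied through a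
    one-sided inequality, so [y] needs no derivative. *)
Lemma dini_exp (y : R -> R) (l a b : R) : a <= b -> cont_on a b y ->
  (forall s, a <= s < b -> forall e, 0 < e ->
     exists2 d, 0 < d & forall h, 0 < h < d -> y (s + h) <= y s + h * (l * y s + e)) ->
  y b <= y a * expR (l * (b - a)).
Proof.
move=> ab yc yD.
pose E t := expR (- l * t).
have E0 t : 0 < E t by exact: expR_gt0.
have Ed t : is_derive t 1 E (- l * E t).
  have H1 : is_derive t 1 (fun t => - l * t) (- l).
    by apply: is_derive_eq; rewrite /GRing.scale/= mulr1.
  by have := is_derive1_comp (is_derive_expR (- l * t)) H1; rewrite mulrC.
have Ec : continuous E.
  by move=> t; apply: differentiable_continuous; apply/derivable1_diffP; case: (Ed t).
suff H : y b * E b <= y a * E a.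
  have -> : l * (b - a) = - l * a - (- l * b) by ring.
  rewrite expRD expRN mulrA -/(E a) -/(E b) ler_pdivlMr//.
apply: (@dini_le (fun t => y t * E t)) => // [s sab e e0|s sab e e0].
  pose M := `|y s| + 1.
  have M0 : 0 < M by rewrite ltr_wpDl.
  pose N := E s + M.
  have N0 : 0 < N by rewrite addr_gt0.
  pose e1 := Num.min 1 (e / (N * 2)).
  have e10 : 0 < e1 by rewrite lt_min ltr01/= divr_gt0// mulr_gt0.
  have e11 : e1 <= 1 by rewrite ge_min lexx.
  have e12 : e1 * (N * 2) <= e by rewrite -ler_pdivlMr ?mulr_gt0// ge_min lexx orbT.
  have [d1 d10 H1] := yc s sab e1 e10.
  have [d2 d20 H2] := @cont_on_continuous a b E Ec s sab e1 e10.
  exists (Num.min d1 d2) => [|t tab]; first by rewrite lt_min d10.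
  rewrite lt_min => /andP[t1 t2].
  have {}H1 := H1 t tab t1; have {}H2 := H2 t tab t2.
  have -> : y t * E t - y s * E s = (y t - y s) * E s + y t * (E t - E s) by ring.
  rewrite (le_lt_trans (ler_normD _ _))// !normrM (gtr0_norm (E0 s)).
  have yt : `|y t| <= M.
    rewrite -(subrK (y s) (y t)) (le_trans (ler_normD _ _))// addrC lerD2l.
    exact: le_trans (ltW H1) e11.
  have A1 : `|y t - y s| * E s <= e1 * E s by rewrite ler_wpM2r// ltW.
  have A2 : `|y t| * `|E t - E s| <= M * e1 by rewrite ler_pM// ltW.
  have : e1 * N = e1 * E s + M * e1 by rewrite /N; ring.
  by have : 0 < e1 * N by [exact: mulr_gt0]; move: e12 A1 A2; nra.
have y0 : 0 <= `|y s| by [].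
(* Three errors receive [e / 4] each: the slack [e1] in the hypothesis, the remainder [r] of the
   exponential (through [e2]), and the product of the two first-order terms, of order [h ^+ 2]
   (through [d3]). *)
pose e1 := e / (4 * E s).
have e10 : 0 < e1 by rewrite divr_gt0// mulr_gt0.
have e1E : e1 * E s = e / 4 by rewrite /e1 invfM mulrA divfK ?gt_eqF.
have [d1 d10 H1] := yD s sab e1 e10.
pose L := `|l * y s| + e1.
have L0 : 0 < L by rewrite ltr_wpDl.
pose e2 := e / (4 * (`|y s| + L)).
have yL : 0 < `|y s| + L by rewrite ltr_wpDl.
have e20 : 0 < e2 by rewrite divr_gt0// mulr_gt0.
have e2E : e2 * (`|y s| + L) = e / 4 by rewrite /e2 invfM mulrA divfK ?gt_eqF.
have [d2 d20 H2] := is_derive_eps (Ed s) e20.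
pose K := `|l| * E s * L + 1.
have K0 : 0 < K by rewrite ltr_wpDl// !mulr_ge0// ltW.
pose d3 := e / (4 * K).
have d30 : 0 < d3 by rewrite divr_gt0// mulr_gt0.
have d3E : d3 * K = e / 4 by rewrite /d3 invfM mulrA divfK ?gt_eqF.
exists (Num.min (Num.min d1 d2) (Num.min d3 1)) => [|h].
  by rewrite !lt_min d10 d20 d30 ltr01.
rewrite !lt_min => /andP[h0 /andP[/andP[h1 h2] /andP[h3 h4]]].
have {}H1 := H1 h; rewrite h0 h1 in H1; have {}H1 := H1 isT.
have {}H2 := H2 h; rewrite gtr0_norm// in H2; have {}H2 := H2 h2.
set r := (E (s + h) - _ - _) in H2.
have Er : E (s + h) = E s - l * E s * h + r by rewrite /r; ring.
apply: (le_trans (_ : _ <= (y s + h * (l * y s + e1)) * E (s + h))).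
  by rewrite ler_wpM2r// ltW.
have lb : `|l * y s + e1| <= L by rewrite (le_trans (ler_normD _ _))// (gtr0_norm e10).
rewrite Er.
have -> : (y s + h * (l * y s + e1)) * (E s - l * E s * h + r) =
  y s * E s + h * (e1 * E s) + y s * r + (l * y s + e1) * r * h
   - h * (h * (l * E s * (l * y s + e1))) by ring.
have B1 : y s * r <= `|y s| * (e2 * h).
  by rewrite (le_trans (ler_norm _))// normrM ler_wpM2l.
have B2 : (l * y s + e1) * r * h <= L * (e2 * h).
  rewrite (le_trans (ler_norm _))// normrM (gtr0_norm h0) normrM.
  rewrite -[leRHS]mulr1 ler_pM ?mulr_ge0 ?(ltW h0) ?(ltW h4)//.
  by rewrite ler_pM.
have B3 : - (h * (h * (l * E s * (l * y s + e1)))) <= h * (d3 * K).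
  rewrite (le_trans (ler_norm _))// normrN normrM (gtr0_norm h0) ler_wpM2l ?(ltW h0)//.
  rewrite normrM (gtr0_norm h0) ler_pM// ?(ltW h0) ?(ltW h3)//.
  rewrite !normrM (gtr0_norm (E0 s)) /K (le_trans (_ : _ <= `|l| * E s * L))//.
    by rewrite ler_wpM2l// mulr_ge0// ltW.
  by rewrite lerDl.
rewrite e1E; rewrite d3E in B3.
have B4 : `|y s| * (e2 * h) + L * (e2 * h) = h * (e / 4) by rewrite -e2E; ring.
have eh : 0 < e * h by exact: mulr_gt0.
move: B1 B2 B3 B4 eh; lra.
Qed.

Section DiniAbove.
Variables (z G : R -> R) (c : R).
Hypothesis zc : continuous z.
Hypothesis zD : forall t, 0 <= t -> c < z t -> forall e : R, 0 < e -> exists2 d : R, 0 < d &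
  forall h, 0 < h < d -> z (t + h) <= z t + h * (G t + e).
Hypothesis G_le0 : forall t, G t <= 0.

(** Decrease is known only above [c]; truncating from below at [c'] makes it global. The strict
    [c < c'] keeps the hypothesis available at times where [z] equals [c']. *)
Lemma dini_max_nincr c' s t : c < c' -> 0 <= s -> s <= t -> Num.max (z t) c' <= Num.max (z s) c'.
Proof.
move=> cc' s0 st; apply: (@dini_le (fun t => Num.max (z t) c')) => //.
  apply: cont_on_continuous => r.
  by apply: continuous_max; [exact: zc|exact: cvg_cst].
move=> r /andP[sr rt] e e0; have r0 := le_trans s0 sr.
have [zr|zr] := ltP (z r) c'.
  have cz : 0 < c' - z r by rewrite subr_gt0.
  have /cvgrPdist_lt/(_ _ cz)/nbhs_ballP[d /= d0 H] := @zc r; exists d => // h /andP[h0 hd].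
  have : ball r d (r + h) by rewrite /ball/= opprD addrA subrr sub0r normrN gtr0_norm.
  move=> /H /=; rewrite distrC => /ltr_normlW zh.
  have zh' : z (r + h) <= c' by lra.
  by rewrite (max_idPr zh') lerDl mulr_ge0// ltW.
have [d d0 H] := zD r0 (lt_le_trans cc' zr) e0.
exists d => // h hd; have h0 : 0 < h by case/andP: hd.
rewrite ge_max; apply/andP; split.
  apply: le_trans (H h hd) _; rewrite lerD2l mulrC ler_wpM2r ?(ltW h0)//.
  by have := G_le0 r; lra.
by rewrite (le_trans zr)// lerDl mulr_ge0// ltW.
Qed.

(** Read contrapositively, this is forward invariance of the level set [z <= c]. It lets a single
    late observation [c < z t] activate the decrease on all of [[0, t]]. *)
Lemma dini_stay_above t : c < z t -> forall s, 0 <= s -> s <= t -> c < z s.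
Proof.
move=> zt s s0 st; rewrite ltNge; apply/negP => zs.
pose c' := (c + z t) / 2.
have cc' : c < c' by rewrite /c'; lra.
have c't : c' < z t by rewrite /c'; lra.
have := dini_max_nincr cc' s0 st.
rewrite (max_idPl (ltW c't)) (max_idPr (le_trans zs (ltW cc'))).
by rewrite leNgt c't.
Qed.

Lemma dini_le_start t : c < z 0 -> 0 <= t -> z t <= z 0.
Proof.
move=> z0 t0; have := dini_max_nincr z0 (lexx 0) t0.
by rewrite maxxx ge_max => /andP[].
Qed.

End DiniAbove.

End Dini.

(** * First-order expansions in the presence of a bounded input *)

Section Expansion.
Context {R : realType}.
Variables (D : R -> R) (m h0 : R).
Hypotheses (h0_gt0 : 0 < h0) (m_ge0 : 0 <= m).
Hypothesis D_le : forall h, 0 < h < h0 -> `|D h| <= m * h.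

(* [D] stands for the integral of a merely bounded input over [t, t + h]: it is O(h) but has no
   first-order expansion, so it is carried along as a second infinitesimal besides [h]. *)
Definition expn (y : R -> R) (y0 A B : R) := forall e, 0 < e ->
  exists2 d, 0 < d & forall h, 0 < h < d -> `|y h - y0 - A * h - B * D h| <= e * h.

Lemma expn_eq y y0 A B A' B' : expn y y0 A B -> A = A' -> B = B' -> expn y y0 A' B'.
Proof. by move=> ? <- <-. Qed.

Lemma expn_cst c : expn (fun=> c) c 0 0.
Proof.
move=> e e0; exists 1 => // h /andP[h1 _].
by rewrite !mul0r subrr !subr0 normr0 mulr_ge0// ltW.
Qed.

Lemma expnD y1 a1 A1 B1 y2 a2 A2 B2 : expn y1 a1 A1 B1 -> expn y2 a2 A2 B2 ->
  expn (fun h => y1 h + y2 h) (a1 + a2) (A1 + A2) (B1 + B2).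
Proof.
move=> E1 E2 e e0; have e2 : 0 < e / 2 by exact: divr_gt0.
have [d1 d10 H1] := E1 _ e2; have [d2 d20 H2] := E2 _ e2.
exists (Num.min d1 d2) => [|h]; first by rewrite lt_min d10.
rewrite lt_min => /andP[h1 /andP[hd1 hd2]].
have {}H1 := H1 h (introT andP (conj h1 hd1)).
have {}H2 := H2 h (introT andP (conj h1 hd2)).
rewrite (_ : _ - _ = (y1 h - a1 - A1 * h - B1 * D h) + (y2 h - a2 - A2 * h - B2 * D h)); last ring.
by rewrite (le_trans (ler_normD _ _))//; move: H1 H2; lra.
Qed.

Lemma expn_lip y y0 A B : expn y y0 A B -> exists2 L, 0 < L &
  exists2 d, 0 < d & forall h, 0 < h < d -> `|y h - y0| <= L * h.
Proof.
move=> E; have [d d0 H] := E 1 ltr01.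
exists (1 + `|A| + `|B| * m); first by rewrite ltr_pwDl// ?mulr_ge0// ltr_pwDl.
exists (Num.min d h0) => [|h]; first by rewrite lt_min d0.
rewrite lt_min => /andP[h1 /andP[hd hh0]].
have {}H := H h (introT andP (conj h1 hd)).
have Dh := D_le (introT andP (conj h1 hh0)).
rewrite (_ : _ - _ = (y h - y0 - A * h - B * D h) + A * h + B * D h); last ring.
rewrite (le_trans (ler_normD _ _))// !mulrDl lerD ?(le_trans (ler_normD _ _)) ?lerD//.
  by rewrite normrM (gtr0_norm h1).
by rewrite normrM -mulrA ler_wpM2l.
Qed.

(** Both increments are [O(h)] by [expn_lip], so the error of [C1_expand] remains [o(h)] even though
    [D] has no expansion of its own. *)
Lemma expn_C1 g gx gy y1 a1 A1 B1 y2 a2 A2 B2 : C1 g gx gy ->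
  expn y1 a1 A1 B1 -> expn y2 a2 A2 B2 ->
  expn (fun h => g (y1 h) (y2 h)) (g a1 a2)
    (gx a1 a2 * A1 + gy a1 a2 * A2) (gx a1 a2 * B1 + gy a1 a2 * B2).
Proof.
move=> gC E1 E2 e e0.
have [L1 L10 [d1 d10 K1]] := expn_lip E1; have [L2 L20 [d2 d20 K2]] := expn_lip E2.
set p := gx a1 a2; set q := gy a1 a2.
pose c := `|p| + `|q| + (L1 + L2).
have c0 : 0 < c by rewrite ltr_wpDl ?addr_ge0 ?addr_gt0.
pose e' := e / (2 * c).
have e'0 : 0 < e' by rewrite divr_gt0 ?mulr_gt0.
have e'c : e' * c = e / 2 by rewrite /e' invfM mulrA divfK ?gt_eqF.
have [d3 d30 K3] := C1_expand gC a1 a2 e'0.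
have [d4 d40 H1] := E1 _ e'0; have [d5 d50 H2] := E2 _ e'0.
exists (Num.min (Num.min (Num.min d1 d2) (Num.min d4 d5)) (Num.min (d3 / L1) (d3 / L2))).
  by rewrite !lt_min d10 d20 d40 d50 !divr_gt0.
move=> h; rewrite !lt_min => /andP[h1 /andP[/andP[/andP[hd1 hd2] /andP[hd4 hd5]] /andP[hd6 hd7]]].
have {}K1 := K1 h (introT andP (conj h1 hd1)).
have {}K2 := K2 h (introT andP (conj h1 hd2)).
have {}H1 := H1 h (introT andP (conj h1 hd4)).
have {}H2 := H2 h (introT andP (conj h1 hd5)).
have {}K3 := K3 (y1 h - a1) (y2 h - a2) .
rewrite !subrKC in K3.
have {}K3 : `|g (y1 h) (y2 h) - g a1 a2 - p * (y1 h - a1) - q * (y2 h - a2)|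
     <= e' * ((L1 + L2) * h).
  apply: (le_trans (K3 _ _)).
  - by apply: le_lt_trans K1 _; rewrite mulrC -ltr_pdivlMr.
  - by apply: le_lt_trans K2 _; rewrite mulrC -ltr_pdivlMr.
  - by rewrite ler_wpM2l ?(ltW e'0)// mulrDl lerD.
rewrite (_ : _ - _ = (g (y1 h) (y2 h) - g a1 a2 - p * (y1 h - a1) - q * (y2 h - a2))
  + p * (y1 h - a1 - A1 * h - B1 * D h) + q * (y2 h - a2 - A2 * h - B2 * D h)); last ring.
rewrite (le_trans (ler_normD _ _))// (le_trans (lerD (ler_normD _ _) (lexx _)))//.
rewrite !normrM.
have P1 : `|p| * `|y1 h - a1 - A1 * h - B1 * D h| <= `|p| * (e' * h) by rewrite ler_wpM2l.
have P2 : `|q| * `|y2 h - a2 - A2 * h - B2 * D h| <= `|q| * (e' * h) by rewrite ler_wpM2l.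
have : e * h = 2 * ((e' * c) * h) by rewrite e'c; field.
have : 0 < e' * c * h by apply: mulr_gt0 => //; exact: mulr_gt0.
rewrite /c; move: K3 P1 P2; lra.
Qed.

Lemma C1_mul : C1 (fun x y : R => x * y) (fun _ y => y) (fun x _ => x).
Proof.
split => [x y|x y|p|p].
- by apply: is_derive_eq; rewrite /GRing.scale/=; ring.
- by apply: is_derive_eq; rewrite /GRing.scale/=; ring.
- exact: cvg_snd.
- exact: cvg_fst.
Qed.

Lemma expnM y1 a1 A1 B1 y2 a2 A2 B2 : expn y1 a1 A1 B1 -> expn y2 a2 A2 B2 ->
  expn (fun h => y1 h * y2 h) (a1 * a2) (a2 * A1 + a1 * A2) (a2 * B1 + a1 * B2).
Proof. exact: expn_C1 C1_mul. Qed.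

Lemma expnZ k y a A B : expn y a A B -> expn (fun h => k * y h) (k * a) (k * A) (k * B).
Proof. by move=> /(expnM (expn_cst k)) /expn_eq; apply; rewrite mulr0 add0r. Qed.

(** Here the unknown input disappears: the part driven by [D] is replaced by its worst case, which
    adds [|B| * m] to the slope. Only an upper one-sided bound survives, hence the form of the Dini
    lemmas. *)
Lemma expn_dini y a A B e : expn y a A B -> 0 < e ->
  exists2 d, 0 < d & forall h, 0 < h < d -> y h <= a + h * (A + `|B| * m + e).
Proof.
move=> E e0; have [d d0 H] := E e e0; exists (Num.min d h0) => [|h].
  by rewrite lt_min d0.
rewrite lt_min => /andP[h1 /andP[hd hh0]].
have {}H := H h (introT andP (conj h1 hd)).
have Dh := D_le (introT andP (conj h1 hh0)).
have : B * D h <= `|B| * (m * h).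
  by rewrite (le_trans (ler_norm _))// normrM ler_wpM2l.
move/ler_normlW : H; lra.
Qed.

End Expansion.

(** * Bounds on the potential *)

Section Plane.
Context {R : realType}.
Implicit Types (u v p q : @pt R) (k : R).

Lemma dot_ge0 u : 0 <= dot u u.
Proof. by rewrite /dot -!expr2 addr_ge0 ?sqr_ge0. Qed.

Lemma nrm_ge0 u : 0 <= nrm u. Proof. exact: sqrtr_ge0. Qed.

Lemma sqr_nrm u : nrm u ^+ 2 = dot u u.
Proof. by rewrite sqr_sqrtr// dot_ge0. Qed.

Lemma nrm_sumsq u : nrm u ^+ 2 = u.1 ^+ 2 + u.2 ^+ 2.
Proof. by rewrite sqr_nrm /dot -!expr2. Qed.

Lemma nrm_le u k : 0 <= k -> u.1 ^+ 2 + u.2 ^+ 2 <= k ^+ 2 -> nrm u <= k.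
Proof. by move=> k0; rewrite -nrm_sumsq ler_sqr// nnegrE nrm_ge0. Qed.

Lemma nrm1_le u : `|u.1| <= nrm u.
Proof. by rewrite -ler_sqr ?nnegrE ?nrm_ge0// nrm_sumsq real_normK ?num_real// lerDl sqr_ge0. Qed.

Lemma nrm2_le u : `|u.2| <= nrm u.
Proof. by rewrite -ler_sqr ?nnegrE ?nrm_ge0// nrm_sumsq real_normK ?num_real// lerDr sqr_ge0. Qed.

Lemma nrm_le_add u : nrm u <= `|u.1| + `|u.2|.
Proof.
apply: nrm_le; first exact: addr_ge0.
rewrite sqrrD !real_normK ?num_real// addrAC lerDl mulrn_wge0// mulr_ge0//.
Qed.

Lemma normr_dot u v : `|dot u v| <= nrm u * nrm v.
Proof.
rewrite -ler_sqr ?nnegrE ?mulr_ge0 ?nrm_ge0// real_normK ?num_real// exprMn !nrm_sumsq /dot.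
by have := sqr_ge0 (u.1 * v.2 - u.2 * v.1); lra.
Qed.

Lemma normrM_le_sumsq (y z : R) : `|y * z| <= (y ^+ 2 + z ^+ 2) / 2.
Proof.
have := sqr_ge0 (y - z); have := sqr_ge0 (y + z); rewrite sqrrB sqrrD => H1 H2.
by rewrite ler_norml; apply/andP; split; lra.
Qed.

Lemma nrm_scal k u : nrm (pscal k u) = `|k| * nrm u.
Proof.
by rewrite /nrm /dot /= -sqrtr_sqr -sqrtrM ?sqr_ge0//; congr Num.sqrt; ring.
Qed.

Lemma nrmD u v : nrm (padd u v) <= nrm u + nrm v.
Proof.
apply: nrm_le; first by rewrite addr_ge0 ?nrm_ge0.
have := normr_dot u v => /ler_normlW; rewrite (sqrrD (nrm u)) !nrm_sumsq /dot /=; lra.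
Qed.

Lemma dot_scal k u v : dot u (pscal k v) = k * dot u v.
Proof. by rewrite /dot /=; ring. Qed.

Lemma nrm_eq0 u : nrm u = 0 -> u = (0, 0).
Proof.
move=> u0; have := nrm1_le u; have := nrm2_le u; rewrite u0 !normr_le0.
by move=> /eqP e2 /eqP e1; rewrite [u]surjective_pairing e1 e2.
Qed.

Lemma nrm0 : nrm ((0, 0) : @pt R) = 0.
Proof. by rewrite /nrm /dot /= mulr0 addr0 sqrtr0. Qed.

Lemma padd_psub p q : padd q (psub p q) = p.
Proof. by rewrite /padd /psub /= !subrKC -surjective_pairing. Qed.

Lemma psub_eq0 p q : psub p q = (0, 0) -> p = q.
Proof.
case=> /eqP; rewrite subr_eq0 => /eqP e1 /eqP; rewrite subr_eq0 => /eqP e2.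
by rewrite [p]surjective_pairing e1 e2 -surjective_pairing.
Qed.

Lemma psubpp p : psub p p = (0, 0). Proof. by rewrite /psub !subrr. Qed.

Lemma nrm_psub_gt0 p q : p <> q -> 0 < nrm (psub p q).
Proof.
move=> pq; rewrite lt_neqAle nrm_ge0 andbT eq_sym; apply/eqP => /nrm_eq0.
by move/psub_eq0.
Qed.

Lemma S1E o : S1 o -> o.1 ^+ 2 + o.2 ^+ 2 = 1 :> R.
Proof. by move=> o1; rewrite -nrm_sumsq o1 expr1n. Qed.

Lemma S1_le o : S1 o -> `|o.1| <= 1 :> R /\ `|o.2| <= 1 :> R.
Proof. by move=> o1; rewrite -o1; split; [exact: nrm1_le|exact: nrm2_le]. Qed.

(** The nearest point of [K] carries the orientation of [x] itself, which [inX] places on the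
    circle; only the position then contributes. *)
Lemma distKE (ps : @pt R) (x : @st R) : inX x -> distK ps x = nrm (psub x.1 ps).
Proof.
move=> xX; apply/eqP; rewrite eq_le; apply/andP; split.
  apply: ge_inf.
    by exists 0; move=> _ [ o _ <-]; exact: sqrtr_ge0.
  by exists x.2 => //; rewrite /dist4 /= psubpp /nrm /dot /= mulr0 !addr0.
apply: lb_le_inf; first by exists (dist4 x (ps, x.2)); exists x.2.
move=> _ [ o _ <-]; rewrite /nrm /dist4 ler_sqrt; first by rewrite lerDl dot_ge0.
by apply: addr_ge0; exact: dot_ge0.
Qed.

End Plane.

(** * Hessian entries and derivatives along lines *)

Section Hessian.
Context {R : realType}.
Variable psi : @pt R -> R.
Implicit Types (p q u v : @pt R) (s : seq bool) (i j : bool).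

Definition pt_coord (i : bool) (v : @pt R) := if i then v.2 else v.1.

Lemma smooth2_C1 s : smooth2 psi ->
  C1 (dpar s (curry2 psi)) (dpar (false :: s) (curry2 psi)) (dpar (true :: s) (curry2 psi)).
Proof.
move=> sm; have [ex _] := sm s.
have [_ cx] := sm (false :: s); have [_ cy] := sm (true :: s).
split; [move=> x y|move=> x y|exact: cx|exact: cy].
  by have /= := ex false (x, y); rewrite /pd_ex /= => /derivableP; rewrite -derive1E.
by have /= := ex true (x, y); rewrite /pd_ex /= => /derivableP; rewrite -derive1E.
Qed.

Lemma hessv_bound p v : S1 v -> nrm (hessv psi p v) <=
  `|hessE psi false false p| + `|hessE psi false true p| +
  (`|hessE psi true false p| + `|hessE psi true true p|).
Proof.
move=> /S1_le[v1 v2]; apply: le_trans (nrm_le_add _) _ => /=.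
by rewrite lerD// (le_trans (ler_normD _ _))// !normrM lerD// ler_piMr.
Qed.

(** The entry is a coordinate of the Hessian applied to a basis vector. [hessv_bound] ensures that
    [sup] is a true supremum and not its default value. *)
Lemma hessE_le i j p : `|hessE psi i j p| <= opnorm_hess psi p.
Proof.
pose e : @pt R := if j then (0, 1) else (1, 0).
have e1 : S1 e by rewrite /S1 /= /nrm /dot /e; case: (j) => /=; rewrite ?mulr0 ?mulr1 ?addr0 ?add0r sqrtr1.
have E : pt_coord i (hessv psi p e) = hessE psi i j p.
  have H (a b : R) : a * e.1 + b * e.2 = if j then b else a.
    by rewrite /e; case: (j) => /=; ring.
  by rewrite /comp /hessv; case: i; rewrite /= H; case: (j).
have L (v : @pt R) : `|pt_coord i v| <= nrm v by case: i {E}; [exact: nrm2_le|exact: nrm1_le].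
rewrite -E (le_trans (L _))//.
apply: sup_upper_bound; last by exists e.
split; first by exists (nrm (hessv psi p e)); exists e.
by eexists; move=> _ [v vS <-]; exact: hessv_bound.
Qed.

Lemma dot_hessv_le p w v K : (forall i j, `|hessE psi i j p| <= K) ->
  `|dot (hessv psi p w) v| <= 2 * K * (nrm w * nrm v).
Proof.
move=> HK; have K0 : 0 <= K by exact: le_trans (HK true true).
(* Passing from the Euclidean norm to the sum norm costs [sqrt 2] for each of the two vectors,
   whence the factor 2. *)
have S (z : @pt R) : `|z.1| + `|z.2| <= Num.sqrt 2 * nrm z.
  rewrite -ler_sqr ?nnegrE ?addr_ge0 ?mulr_ge0 ?nrm_ge0 ?sqrtr_ge0//.
  rewrite exprMn sqr_sqrtr// nrm_sumsq sqrrD !real_normK ?num_real//.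
  have := sqr_ge0 (`|z.1| - `|z.2|); rewrite sqrrB !real_normK ?num_real//; lra.
apply: (le_trans (_ : _ <= K * ((`|w.1| + `|w.2|) * (`|v.1| + `|v.2|)))).
  rewrite /dot /hessv /= mulrDr (mulrDr K) (le_trans (ler_normD _ _))// lerD// normrM mulrA ler_wpM2r//;
  by rewrite mulrDr (le_trans (ler_normD _ _))// lerD// normrM ler_wpM2r//; exact: HK.
rewrite [2 * K]mulrC -mulrA ler_wpM2l//.
apply: (le_trans (ler_pM _ _ (S w) (S v))); rewrite ?addr_ge0//.
by rewrite mulrACA -expr2 sqr_sqrtr.
Qed.

Definition hq p v := dot (hessv psi p v) v.

Lemma hqE p v : hq p v = hessE psi false false p * v.1 ^+ 2 +
  (hessE psi false true p + hessE psi true false p) * v.1 * v.2 +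
  hessE psi true true p * v.2 ^+ 2.
Proof.
rewrite /hq /dot /hessv /=.
by move: (hessE _ _ _ _) (hessE _ _ _ _) (hessE _ _ _ _) (hessE _ _ _ _) => a b c d; ring.
Qed.

Hypothesis sm : smooth2 psi.

Lemma psi_C1 : C1 (curry2 psi) (pd false (curry2 psi)) (pd true (curry2 psi)).
Proof. exact: (smooth2_C1 [::]). Qed.

Lemma pd_C1 j : C1 (pd j (curry2 psi)) (dpar [:: false; j] (curry2 psi))
   (dpar [:: true; j] (curry2 psi)).
Proof. exact: (smooth2_C1 [:: j]). Qed.

Lemma is_derive_line p v (t : R) :
  is_derive t 1 (fun t : R => psi (padd p (pscal t v))) (dot (grad psi (padd p (pscal t v))) v).
Proof. exact: (C1_line psi_C1). Qed.

(** As [hessE i j] differentiates first in [j], the test vector [w] goes inside [hessv] and the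
    direction [v] outside; in this order the formula holds without symmetry of mixed derivatives. *)
Lemma is_derive_grad_line p v w (t : R) :
  is_derive t 1 (fun t : R => dot (grad psi (padd p (pscal t v))) w)
     (dot (hessv psi (padd p (pscal t v)) w) v).
Proof.
have H1 := C1_line (pd_C1 false) p.1 p.2 v.1 v.2 t.
have H2 := C1_line (pd_C1 true) p.1 p.2 v.1 v.2 t.
have H : is_derive t 1
    (w.1 \*: (fun t => pd false (curry2 psi) (p.1 + t * v.1) (p.2 + t * v.2)) +
     w.2 \*: (fun t => pd true (curry2 psi) (p.1 + t * v.1) (p.2 + t * v.2))) _ :=
  is_deriveD (is_deriveZ w.1 H1) (is_deriveZ w.2 H2).
move: H; rewrite /dot /hessv /hessE /padd /pscal [X in is_derive _ _ X _ -> _]/=.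
have -> : (w.1 \*: (fun t => pd false (curry2 psi) (p.1 + t * v.1) (p.2 + t * v.2)) +
     w.2 \*: (fun t => pd true (curry2 psi) (p.1 + t * v.1) (p.2 + t * v.2)))
   = (fun t : R => (grad psi (p.1 + t * v.1, p.2 + t * v.2)).1 * w.1 +
                 (grad psi (p.1 + t * v.1, p.2 + t * v.2)).2 * w.2).
  apply/funext => r; rewrite [RHS]/=.
  rewrite [RHS](_ : _ = w.1 * pd false (curry2 psi) (p.1 + r * v.1) (p.2 + r * v.2) +
    w.2 * pd true (curry2 psi) (p.1 + r * v.1) (p.2 + r * v.2)) //.
  by congr (_ + _); rewrite mulrC.
move=> H; apply: (is_derive_eq H).
rewrite /GRing.scale.
move: (dpar _ _ _ _) (dpar _ _ _ _) (dpar _ _ _ _) (dpar _ _ _ _) => a b c d /=.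
ring.
Qed.

End Hessian.

(** * Gradient and growth bounds for the potential *)

Section Potential.
Context {R : realType}.
Implicit Types (p q u v w c : @pt R).

Lemma continuous_nrm_psub c : continuous (fun p => nrm (psub p c)).
Proof.
move=> p; apply: (@continuous_comp _ _ _ (fun p => dot (psub p c) (psub p c)) Num.sqrt); last exact: sqrt_continuous.
have c1 : (fun p : @pt R => p.1 - c.1) @ p --> p.1 - c.1 by apply: cvgB; [exact: cvg_fst|exact: cvg_cst].
have c2 : (fun p : @pt R => p.2 - c.2) @ p --> p.2 - c.2 by apply: cvgB; [exact: cvg_snd|exact: cvg_cst].
by apply: cvgD; apply: cvgM.
Qed.

Lemma compact_annulus c (r s : R) : compact [set p | r <= nrm (psub p c) <= s].
Proof.
apply: (@subclosed_compact _ _ (`[c.1 - s, c.1 + s] `*` `[c.2 - s, c.2 + s])).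
- have -> : [set p | r <= nrm (psub p c) <= s] =
    (fun p => nrm (psub p c)) @^-1` `[r, s]%classic.
    by apply/seteqP; split => p /=; rewrite in_itv.
  apply: closed_comp; last exact: itv_closed.
  by move=> p _; exact: continuous_nrm_psub.
- by apply: compact_setX; exact: segment_compact.
- move=> p /= /andP[_ H]; split; rewrite /= in_itv /=.
    by have := le_trans (nrm1_le _) H; rewrite ler_norml /=; lra.
  by have := le_trans (nrm2_le _) H; rewrite ler_norml /=; lra.
Qed.

Lemma annulus_pos (f : @pt R -> R) c r s : continuous f ->
  (forall p, r <= nrm (psub p c) <= s -> 0 < f p) ->
  exists2 k, 0 < k & forall p, r <= nrm (psub p c) <= s -> k <= f p.
Proof.
move=> fc fp; have [ne|ne] := pselect ([set p | r <= nrm (psub p c) <= s] !=set0); last first.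
  by exists 1 => // p pA; exfalso; apply: ne; exists p.
have [p0 /set_mem p0A H] := compact_EVT_min ne (@compact_annulus c r s) (continuous_subspaceT fc).
by exists (f p0) => [|p pA]; [exact: fp|apply: H; exact/mem_set].
Qed.

Variables (psi : @pt R -> R) (sm : smooth2 psi).
Let g := grad psi.

Lemma continuous_pd i : continuous (fun p : @pt R => pd i (curry2 psi) p.1 p.2).
Proof. by have [_] := sm [:: i]. Qed.

Lemma continuous_hessE i j : continuous (hessE psi i j).
Proof. by have [_] := sm [:: i; j]. Qed.

Lemma continuous_psi : continuous psi.
Proof.
have [_ /(_ _)] := sm [::]; rewrite (_ : (fun _ => _) = psi)//.
by apply/funext => p; rewrite /= /curry2 -surjective_pairing.
Qed.

Lemma continuous_nrm_grad : continuous (fun p => nrm (g p)).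
Proof.
move=> p; apply: (@continuous_comp _ _ _ (fun p => dot (g p) (g p)) Num.sqrt); last exact: sqrt_continuous.
by apply: cvgD; apply: cvgM; exact: continuous_pd.
Qed.

Lemma pscal0 v : pscal 0 v = (0, 0). Proof. by rewrite /pscal !mul0r. Qed.
Lemma pscal1 v : pscal 1 v = v. Proof. by rewrite /pscal !mul1r -surjective_pairing. Qed.
Lemma padd0 p : padd p (0, 0) = p.
Proof. by rewrite /padd !addr0 -surjective_pairing. Qed.

Variables (c1 : R) (c1_gt0 : 0 < c1).
Hypothesis hessb : forall i j p, `|hessE psi i j p| <= c1.

Lemma grad_lip p v w : `|dot (g (padd p v)) w - dot (g p) w| <= 2 * c1 * (nrm w * nrm v).
Proof.
have [c _] := mvt_between 0 1 (is_derive_grad_line sm p v w).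
rewrite pscal0 pscal1 padd0 !subr0 mulr1 => ->.
by apply: dot_hessv_le => i j; exact: hessb.
Qed.

Lemma taylor1 p v : `|psi (padd p v) - psi p - dot (g p) v| <= 2 * c1 * nrm v ^+ 2.
Proof.
have [c] := mvt_between 0 1 (is_derive_line sm p v).
rewrite pscal0 pscal1 padd0 !subr0 mulr1 normr1 => cb ->.
apply: le_trans (grad_lip _ _ _) _; rewrite nrm_scal ler_wpM2l ?mulr_ge0 ?(ltW c1_gt0)//.
by rewrite expr2 ler_wpM2l ?nrm_ge0// ler_piMl// nrm_ge0.
Qed.

(** Moving by [s] times the gradient raises [psi] by at least [s / 2] times the squared gradient,
    and no rise can exceed [M - psi p]. The choice [s = 1 / (4 c1)] maximizes
    [s - 2 * c1 * s ^+ 2]. *)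
Lemma grad_sq_le_max (M : R) : (forall q, psi q <= M) ->
  forall p, nrm (g p) ^+ 2 <= 8 * c1 * (M - psi p).
Proof.
move=> HM p; pose s := (4 * c1)^-1; have s0 : 0 < s by rewrite invr_gt0 mulr_gt0.
have := taylor1 p (pscal s (g p)); rewrite nrm_scal => /ler_normlP[+ _].
have := HM (padd p (pscal s (g p))).
have -> : dot (g p) (pscal s (g p)) = s * nrm (g p) ^+ 2 by rewrite dot_scal sqr_nrm ?mulNr.
rewrite exprMn (gtr0_norm s0) => H1 H2.
have E1 : 2 * c1 * (s ^+ 2 * nrm (g p) ^+ 2) = s / 2 * nrm (g p) ^+ 2.
  by rewrite /s; field; rewrite gt_eqF.
have E2 : nrm (g p) ^+ 2 = 8 * c1 * (s / 2 * nrm (g p) ^+ 2).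
  by rewrite /s; field; rewrite gt_eqF.
by rewrite [leLHS]E2 ler_pM2l ?mulr_gt0//; rewrite E1 in H2; lra.
Qed.

(** The mirrored descent step. It controls the gradient by the height above a finite infimum, where
    superlevel sets may cease to be compact. *)
Lemma grad_sq_le_min (l : R) : (forall q, l <= psi q) ->
  forall p, nrm (g p) ^+ 2 <= 8 * c1 * (psi p - l).
Proof.
move=> HM p; pose s := (4 * c1)^-1; have s0 : 0 < s by rewrite invr_gt0 mulr_gt0.
have := taylor1 p (pscal (- s) (g p)); rewrite nrm_scal normrN => /ler_normlP[_].
have := HM (padd p (pscal (- s) (g p))).
have -> : dot (g p) (pscal (- s) (g p)) = - (s * nrm (g p) ^+ 2) by rewrite dot_scal sqr_nrm ?mulNr.
rewrite exprMn (gtr0_norm s0) => H1 H2.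
have E1 : 2 * c1 * (s ^+ 2 * nrm (g p) ^+ 2) = s / 2 * nrm (g p) ^+ 2.
  by rewrite /s; field; rewrite gt_eqF.
have E2 : nrm (g p) ^+ 2 = 8 * c1 * (s / 2 * nrm (g p) ^+ 2).
  by rewrite /s; field; rewrite gt_eqF.
by rewrite [leLHS]E2 ler_pM2l ?mulr_gt0//; rewrite E1 in H2; lra.
Qed.

Variable ps : @pt R.
Hypothesis psmax : cond1 psi ps.

Lemma psi_le q : psi q <= psi ps.
Proof. by have [->//|/eqP/psmax/ltW] := eqVneq q ps. Qed.

Lemma grad_ps : g ps = (0, 0).
Proof.
apply: nrm_eq0; apply/eqP; rewrite -sqrf_eq0 eq_le sqr_ge0 andbT.
by have := grad_sq_le_max psi_le ps; rewrite subrr mulr0.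
Qed.

Lemma V_le p : psi ps - psi p <= 2 * c1 * nrm (psub p ps) ^+ 2.
Proof.
have := taylor1 ps (psub p ps); rewrite padd_psub grad_ps => /ler_normlP[+ _].
by rewrite /dot /= !mul0r addr0; lra.
Qed.

Hypothesis negdef : cond2 psi ps.

Lemma hq_negdef : exists2 mu : R, 0 < mu & forall v, hq psi ps v <= - mu * nrm v ^+ 2.
Proof.
pose A := hessE psi false false ps; pose B := hessE psi false true ps + hessE psi true false ps.
pose D := hessE psi true true ps.
have qE v : hq psi ps v = A * v.1 ^+ 2 + B * v.1 * v.2 + D * v.2 ^+ 2 by exact: hqE.
move: A B D qE => A B D qE.
have q0 (x y : R) : (x, y) <> (0, 0) -> A * x ^+ 2 + B * x * y + D * y ^+ 2 < 0.
  by move=> xy; have := negdef xy; rewrite -[dot _ _]/(hq psi ps (x, y)) qE.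
have A0 : A < 0.
  have /q0 : (1 : R, 0 : R) <> (0, 0) by case=> /eqP; rewrite oner_eq0.
  by lra.
have D0 : D < 0.
  have /q0 : (0 : R, 1 : R) <> (0, 0) by case=> /eqP; rewrite oner_eq0.
  by lra.
have disc : 0 < 4 * A * D - B ^+ 2.
  have /q0 : (B, - 2 * A) <> (0, 0) by case=> _ /eqP; rewrite mulf_eq0 oppr_eq0 pnatr_eq0 /= (lt_eqF A0).
  have -> : A * B ^+ 2 + B * B * (-2 * A) + D * (-2 * A) ^+ 2 = A * (4 * A * D - B ^+ 2) by ring.
  by rewrite nmulr_rlt0.
(* Determinant over minus trace of the symmetric part: with two negative eigenvalues this lies below
   the smaller modulus, and it is rational in the entries. *)
pose mu := (4 * A * D - B ^+ 2) / (4 * (- A - D)).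
have s0 : 0 < - A - D by lra.
have mu0 : 0 < mu by rewrite divr_gt0// mulr_gt0.
have muE : mu * (- A - D) = A * D - B ^+ 2 / 4 by rewrite /mu; field; rewrite gt_eqF.
exists mu => // v; rewrite nrm_sumsq qE.
set x := v.1; set y := v.2.
have am : 0 < - A - mu.
  rewrite subr_gt0 /mu ltr_pdivrMr ?mulr_gt0//.
  by have := sqr_ge0 B; nra.
rewrite -subr_ge0; set t := (X in 0 <= X).
(* Completing the square; [muE] turns the leftover coefficient of [y ^+ 2] into exactly
   [mu ^+ 2]. *)
have : (- A - mu) * t = ((- A - mu) * x - B / 2 * y) ^+ 2 + mu ^+ 2 * y ^+ 2.
  rewrite /t; have -> : mu ^+ 2 = mu ^+ 2 + (mu * (- A - D) - (A * D - B ^+ 2 / 4)) * -1 by rewrite muE subrr mul0r addr0.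
  by field.
move=> tE; rewrite -(pmulr_rge0 _ am) tE; apply: addr_ge0; first exact: sqr_ge0.
by apply: mulr_ge0; exact: sqr_ge0.
Qed.

(** On a small ball the Hessian form stays below [- mu / 2]. Integrated once along the ray from the
    critical point [ps] it bounds the gradient, integrated twice it bounds the drop of [psi]. *)
Lemma local_bounds : exists mu d : R, [/\ 0 < mu, 0 < d & forall p, nrm (psub p ps) <= d ->
  mu * nrm (psub p ps) <= nrm (g p) /\ mu * nrm (psub p ps) ^+ 2 <= psi ps - psi p].
Proof.
have [mu mu0 H] := hq_negdef.
(* Entrywise errors [e] change the quadratic form by at most [2 * e * nrm v ^+ 2], so half of [mu]
   is left. *)
pose e := mu / 4; have e0 : 0 < e by rewrite divr_gt0.
have [d d0 Hd] : exists2 d, 0 < d & forall p, nrm (psub p ps) <= d ->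
    forall i j, `|hessE psi i j p - hessE psi i j ps| <= e.
  have C i j := cont2_eps (@continuous_hessE i j ps) e0.
  have [d1 d10 H1] := C true true; have [d2 d20 H2] := C true false.
  have [d3 d30 H3] := C false true; have [d4 d40 H4] := C false false.
  pose d := Num.min (Num.min d1 d2) (Num.min d3 d4).
  have d0 : 0 < d by rewrite !lt_min d10 d20 d30 d40.
  exists (d / 2) => [|p pd]; first exact: divr_gt0.
  have {}pd : nrm (psub p ps) < d by apply: le_lt_trans pd _; rewrite ltr_pdivrMr// ltr_pMr// ltr1n.
  move: pd; rewrite !lt_min => /andP[/andP[pd1 pd2] /andP[pd3 pd4]].
  move: (nrm1_le (psub p ps)) (nrm2_le (psub p ps)) => /= n1 n2.
  rewrite [p]surjective_pairing; case; case; apply: ltW;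
   [apply: H1|apply: H2|apply: H3|apply: H4]; by [exact: le_lt_trans n1 _|exact: le_lt_trans n2 _].
have hqd p v : nrm (psub p ps) <= d -> hq psi p v <= - (mu / 2) * nrm v ^+ 2.
  move=> pd; have := H v; have {}Hd := Hd p pd.
  rewrite !hqE; move: (Hd false false) (Hd false true) (Hd true false) (Hd true true) => {Hd H}.
  move: (hessE _ _ _ p) (hessE _ _ _ p) (hessE _ _ _ p) (hessE _ _ _ p) => a b c dd.
  move: (hessE _ _ _ ps) (hessE _ _ _ ps) (hessE _ _ _ ps) (hessE _ _ _ ps) => a' b' c' d'.
  move=> Ha Hb Hc Hdd; have M (x y z : R) : `|x| <= e -> x * y * z <= e * (y ^+ 2 + z ^+ 2) / 2.
    move=> xK; rewrite (le_trans (ler_norm _))// -mulrA normrM -mulrA ler_pM//.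
    exact: normrM_le_sumsq.
  move: (M _ v.1 v.1 Ha) (M _ v.1 v.2 Hb) (M _ v.1 v.2 Hc) (M _ v.2 v.2 Hdd).
  rewrite nrm_sumsq /e; lra.
have line p : nrm (psub p ps) <= d -> forall t, `|t| <= 1 ->
   hq psi (padd ps (pscal t (psub p ps))) (psub p ps) <= - (mu / 2) * nrm (psub p ps) ^+ 2.
  move=> pd t t1; apply: hqd.
  rewrite (_ : psub _ _ = pscal t (psub p ps)); last first.
    by rewrite /psub /padd /pscal /=; congr pair; ring.
  by rewrite nrm_scal (le_trans _ pd)// ler_piMl// nrm_ge0.
have rad p : nrm (psub p ps) <= d -> forall t, 0 <= t <= 1 ->
  dot (g (padd ps (pscal t (psub p ps)))) (psub p ps) <= - (mu / 2) * nrm (psub p ps) ^+ 2 * t.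
  move=> pd t /andP[t0 t1]; have [c] := mvt_between 0 t (is_derive_grad_line sm ps (psub p ps) (psub p ps)).
  rewrite pscal0 padd0 -/g grad_ps !subr0 {2}/dot /= !mul0r addr0 subr0 => ct ->.
  by rewrite ler_wpM2r// line// (le_trans ct)// ger0_norm.
exists e, d; split => // p pd; set u := nrm _; have u0 : 0 <= u by exact: nrm_ge0.
split.
  have := rad p pd 1; rewrite lexx ler01 pscal1 padd_psub -/u mulr1 => /(_ isT) G.
  have := normr_dot (g p) (psub p ps); rewrite -/u => /ler_normlP[+ _] => G2.
  have {G2}G : mu / 2 * u ^+ 2 <= nrm (g p) * u by lra.
  have [->|un0] := eqVneq u 0; first by rewrite mulr0 nrm_ge0.
  have {}u0 : 0 < u by rewrite lt_neqAle eq_sym un0.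
  by move: G; rewrite expr2 mulrA ler_pM2r// /e; nra.
(* Adding the expected parabola to [psi] along the ray gives a function with nonpositive derivative
   by [rad]; its values at 0 and 1 are compared. *)
rewrite /e; pose f (t : R) := psi (padd ps (pscal t (psub p ps))) + mu / 4 * u ^+ 2 * t ^+ 2.
have fd (t : R) : is_derive t 1 f (dot (g (padd ps (pscal t (psub p ps)))) (psub p ps) + mu / 2 * u ^+ 2 * t).
  have D1 := is_derive_line sm ps (psub p ps) t.
  have D2 : is_derive t 1 (fun t : R => mu / 4 * u ^+ 2 * t ^+ 2) (mu / 2 * u ^+ 2 * t).
    by apply: is_derive_eq; rewrite /GRing.scale/=; field.
  exact: is_deriveD.
have fc : continuous f.
  by move=> t; apply: differentiable_continuous; apply/derivable1_diffP; case: (fd t).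
have [t tI] := MVT_segment (@ler01 R) (fun t _ => fd t) (continuous_subspaceT fc).
rewrite subr0 mulr1 /f pscal0 pscal1 padd0 padd_psub expr0n expr1n /= mulr0 addr0 mulr1.
move: tI; rewrite in_itv /= => tI; have := rad p pd t tI; rewrite -/u; lra.
Qed.

Hypothesis gradn0 : cond5 psi ps.

(** Near [ps] this is [local_bounds]; on the remaining annulus both quantities are positive and
    compactness applies. The constant depends on [r], as the gradient may fade at infinity. *)
Lemma ball_bounds (r : R) : exists2 k : R, 0 < k & forall p, nrm (psub p ps) <= r ->
  k * nrm (psub p ps) <= nrm (g p) /\ k * nrm (psub p ps) ^+ 2 <= psi ps - psi p.
Proof.
have [mu [d [mu0 d0 H]]] := local_bounds.
have neq p : d <= nrm (psub p ps) -> p <> ps.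
  by move=> dp pE; move: dp; rewrite pE psubpp nrm0 leNgt d0.
have [k1 k10 H1] : exists2 k, 0 < k & forall p, d <= nrm (psub p ps) <= r -> k <= nrm (g p).
  apply: annulus_pos; first exact: continuous_nrm_grad.
  move=> p /andP[dp _]; rewrite lt_neqAle nrm_ge0 andbT eq_sym; apply/eqP => /nrm_eq0.
  by apply: gradn0; exact: neq.
have [k2 k20 H2] : exists2 k, 0 < k & forall p, d <= nrm (psub p ps) <= r -> k <= psi ps - psi p.
  apply: annulus_pos.
    by move=> p; apply: cvgB; [exact: cvg_cst|exact: continuous_psi].
  by move=> p /andP[dp _]; rewrite subr_gt0; apply: psmax; exact: neq.
pose r' := Num.max r 1; have r'0 : 0 < r' by rewrite lt_max ltr01 orbT.
exists (Num.min mu (Num.min (k1 / r') (k2 / r' ^+ 2))).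
  by rewrite !lt_min mu0 !divr_gt0// exprn_gt0.
move=> p pr; set u := nrm _ in pr *; have u0 : 0 <= u by exact: nrm_ge0.
have [ud|/ltW ud] := leP u d.
  have [G1 G2] := H p ud.
  by split; [apply: le_trans G1|apply: le_trans G2];
    rewrite ler_wpM2r ?sqr_ge0// ge_min lexx.
have ur' : u <= r' by rewrite le_max pr.
split.
  apply: le_trans (H1 p _); last by rewrite ud.
  apply: (le_trans (_ : _ <= k1 / r' * u)); first by rewrite ler_wpM2r// !ge_min lexx orbT.
  by rewrite mulrAC ler_pdivrMr// ler_wpM2l// ltW.
apply: le_trans (H2 p _); last by rewrite ud.
apply: (le_trans (_ : _ <= k2 / r' ^+ 2 * u ^+ 2)).
  by rewrite ler_wpM2r ?sqr_ge0// !ge_min lexx !orbT.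
rewrite mulrAC ler_pdivrMr ?exprn_gt0// ler_wpM2l ?(ltW k20)//.
by rewrite ler_sqr ?nnegrE ?(ltW r'0).
Qed.

End Potential.

(** * The averaged remainder *)

Section Integration.
Context {R : realType}.
Notation mu := (@lebesgue_measure R).
Implicit Types (a b M t h : R) (f g w : R -> R).

Lemma continuous_integrable f a b : continuous f -> mu.-integrable `[a, b] (EFin \o f).
Proof.
move=> fc; apply: continuous_compact_integrable; first exact: segment_compact.
exact: continuous_subspaceT.
Qed.

Lemma normr_Rint_le f a b M : a <= b -> mu.-integrable `[a, b] (EFin \o f) ->
  (forall x, a <= x <= b -> `|f x| <= M) -> `|\int[mu]_(x in `[a, b]) f x| <= M * (b - a).
Proof.
move=> ab fi fM; apply: le_trans (le_normr_Rintegral _ fi) _ => //.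
apply: (le_trans (_ : _ <= \int[mu]_(x in `[a, b]) M)).
  apply: le_Rintegral => //.
  - exact: (integrable_abse fi).
  - exact/continuous_integrable/cst_continuous.
rewrite Rintegral_cst//= lebesgue_measure_itv/= lte_fin; case: ltP => ba /=; first by [].
by have -> : a = b; [apply/eqP; rewrite eq_le ab|rewrite subrr].
Qed.

Lemma normr_Rint_ae_le f a b M : a <= b -> mu.-integrable `[a, b] (EFin \o f) ->
  {ae mu, forall x, a <= x <= b -> `|f x| <= M} ->
  `|\int[mu]_(x in `[a, b]) f x| <= M * (b - a).
Proof.
move=> ab fi fM.
have mM : (0 <= b - a) by rewrite subr_ge0.
have fi' := fi; move/integrableP: fi' => [mf _].
have H : (`|\int[mu]_(x in `[a, b]) (f x)%:E| <= (M * (b - a))%:E)%E.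
  apply: le_trans (le_abse_integral mu _ mf) _ => //.
  (* The maximum makes the comparison integrand nonnegative. If [a < b], the almost-everywhere bound
     itself forces [0 <= M], since otherwise [[a, b]] would be a null set. *)
  apply: (le_trans (_ : _ <= \int[mu]_(x in `[a, b]) (Num.max M 0)%:E)%E); last first.
    rewrite integral_cst//= lebesgue_measure_itv/= lte_fin.
    case: ltP => [ab'|ba]; last first.
      by rewrite mule0; have -> : a = b; [apply/eqP; rewrite eq_le ab|rewrite subrr mulr0].
    rewrite -EFinD -EFinM lee_fin ler_wpM2r//.
    rewrite ge_max lexx /= leNgt; apply/negP => M0.
    have : mu `[a, b]%classic = 0%E.
      case: fM => N [mN N0 sub]; apply/eqP; rewrite eq_le measure_ge0 andbT -N0.
      apply: le_measure; rewrite ?inE//.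
      move=> x /=; rewrite in_itv /= => xab; apply: sub => /= /(_ xab).
      by move/(le_trans (normr_ge0 _)); rewrite leNgt M0.
    by rewrite lebesgue_measure_itv/= lte_fin ab' -EFinD => -[]/eqP; rewrite subr_eq0 gt_eqF.
  apply: ae_ge0_le_integral => //.
  - exact: (measurable_int mu (integrable_abse fi)).
  - by move=> x _; rewrite lee_fin le_max lexx orbT.
  - case: fM => N [mN N0 sub]; exists N; split => //.
    apply: subset_trans sub => x /= /not_implyP[xab xM] H; apply: xM.
    by move: xab; rewrite /= in_itv /= lee_fin le_max => /H ->.
by rewrite -lee_fin -[X in (X <= _)%E]/(`|\int[mu]_(x in `[a, b]) f x|%:E) EFin_normr_Rintegral.
Qed.

Lemma Rint_FTC2 F f a b : a < b -> continuous f -> (forall x : R, is_derive x 1 F (f x)) ->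
  \int[mu]_(x in `[a, b]) f x = F b - F a.
Proof.
move=> ab fc Fd; have Fc : continuous F.
  by move=> x; apply: differentiable_continuous; apply/derivable1_diffP; case: (Fd x).
rewrite /Rintegral (@continuous_FTC2 _ f F)//.
- exact: continuous_subspaceT.
- by split; [move=> x _; case: (Fd x)|apply: cvg_at_right_filter; exact: Fc|
    apply: cvg_at_left_filter; exact: Fc].
- by move=> x _; rewrite derive1E; case: (Fd x).
Qed.

Lemma Rint_split f a t b : a <= t -> t <= b -> mu.-integrable `[a, b] (EFin \o f) ->
  \int[mu]_(x in `[a, b]) f x = \int[mu]_(x in `[a, t]) f x + \int[mu]_(x in `[t, b]) f x.
Proof.
move=> at_ tb fi; apply/eqP; rewrite addrC -subr_eq; apply/eqP.
rewrite Rintegral_itvB ?bnd_simp//; apply: Rintegral_itv_obnd_cbnd.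
by apply: integrableS fi => //; apply: subset_itvr; rewrite bnd_simp.
Qed.

Lemma Rint_rev f (r : R) : 0 <= r -> continuous f ->
  \int[mu]_(x in `[0, r]) f (r - x) = \int[mu]_(x in `[0, r]) f x.
Proof.
move=> r0 fc; rewrite /Rintegral; congr fine.
have Fd (x : R) : is_derive x 1 (fun x => r - x) (-1).
  by apply: is_derive_eq; ring.
have FE : derive1 (fun x : R => r - x) = cst (-1).
  by apply/funext => x; rewrite derive1E; case: (Fd x).
have Fc : continuous (fun x : R => r - x).
  by move=> x; apply: differentiable_continuous; apply/derivable1_diffP; case: (Fd x).
have := @integration_by_substitution_decreasing R (fun x => r - x) f 0 r r0.
rewrite subrr subr0 => ->.
- by apply: eq_integral => x _; rewrite FE !fctE opprK mulr1.
- by move=> x y _ _; rewrite ltrD2l ltrN2.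
- by rewrite FE => x _; exact: cvg_cst.
- by rewrite FE; exact: is_cvg_cst.
- by rewrite FE; exact: is_cvg_cst.
- by split; [move=> x _; case: (Fd x)|apply: cvg_at_right_filter; exact: Fc|
    apply: cvg_at_left_filter; exact: Fc].
- exact: continuous_subspaceT.
Qed.

End Integration.

(** * The remainder as a mean of Taylor remainders *)

Section Remainder.
Context {R : realType}.
Notation mu := (@lebesgue_measure R).
Variables (psi : @pt R -> R) (sm : smooth2 psi).
Implicit Types (p q u v w o : @pt R) (t b tau : R).
Let g := grad psi.

Definition taylor_rem p o b : R := psi (padd p (pscal b o)) - psi p - b * dot (g p) o.

Lemma continuous_line p v : continuous (fun t : R => padd p (pscal t v)).
Proof.
move=> t; apply: (@cvg_pair _ _ _ _ (nbhs (p.1 + t * v.1)) (nbhs (p.2 + t * v.2))).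
  by apply: cvgD; [exact: cvg_cst|apply: cvgMl; exact: cvg_id].
by apply: cvgD; [exact: cvg_cst|apply: cvgMl; exact: cvg_id].
Qed.

Lemma continuous_hess_line p v w w' :
  continuous (fun t : R => dot (hessv psi (padd p (pscal t v)) w) w').
Proof.
have C i j : continuous (fun t : R => hessE psi i j (padd p (pscal t v))).
  move=> t; apply: (@continuous_comp _ _ _ (fun t => padd p (pscal t v)) (hessE psi i j)).
    exact: continuous_line.
  exact: continuous_hessE.
by move=> t; apply: cvgD; apply: cvgMl; apply: cvgD; apply: cvgMl; exact: C.
Qed.

Lemma continuous_hess_lineM p o b w w' :
  continuous (fun t : R => dot (hessv psi (padd p (pscal (t * b) o)) w) w').
Proof.
rewrite (_ : (fun _ => _) = (fun s => dot (hessv psi (padd p (pscal s (pscal b o))) w) w')).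
  exact: continuous_hess_line.
by apply/funext => r; rewrite /pscal /= !mulrA.
Qed.

(** Taylor's formula with integral remainder. [F] is the primitive that integration by parts
    produces. *)
Lemma taylor_remE p o b :
  \int[mu]_(s in `[0, 1]) ((1 - s) * (b ^+ 2 * dot (hessv psi (padd p (pscal (s * b) o)) o) o))
  = taylor_rem p o b.
Proof.
have psE s : padd p (pscal (s * b) o) = padd p (pscal s (pscal b o)).
  by rewrite /padd /pscal /= !mulrA.
pose h s := dot (hessv psi (padd p (pscal s (pscal b o))) (pscal b o)) (pscal b o).
pose F s := (1 - s) * dot (g (padd p (pscal s (pscal b o)))) (pscal b o)
   + psi (padd p (pscal s (pscal b o))).
have hE s : h s = b ^+ 2 * dot (hessv psi (padd p (pscal (s * b) o)) o) o.
  rewrite /h psE dot_scal /dot /hessv /=.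
  by move: (hessE _ _ _ _) (hessE _ _ _ _) (hessE _ _ _ _) (hessE _ _ _ _) => *; ring.
transitivity (\int[mu]_(s in `[0, 1]) ((1 - s) * h s)).
  by apply: eq_Rintegral => s _; rewrite hE.
have hc : continuous (fun s : R => (1 - s) * h s).
  move=> s; apply: cvgM; last exact: continuous_hess_line.
  by apply: cvgB; [exact: cvg_cst|exact: cvg_id].
have FD (s : R) : is_derive s 1 F ((1 - s) * h s).
  have D1 := is_derive_line sm p (pscal b o) s.
  have D2 := is_derive_grad_line sm p (pscal b o) (pscal b o) s.
  have D3 : is_derive s 1 (fun s : R => 1 - s) (-1) by apply: is_derive_eq; ring.
  have := is_deriveD (is_deriveM D3 D2) D1; rewrite -/(h s).
  move=> D4; apply: (is_derive_eq D4); rewrite /GRing.scale/= -/g.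
  by move: (h s) (dot (g _) _) => x y; ring.
rewrite (Rint_FTC2 ltr01 hc FD).
rewrite /F /taylor_rem pscal0 pscal1 padd0 subrr mul0r add0r subr0 mul1r dot_scal; ring.
Qed.

Variables (alpha c : R) (varpi : nat) (a : R).
Hypotheses (alpha_gt0 : 0 < alpha) (c_gt0 : 0 < c) (a_gt0 : 0 < a).
Notation U := (Uf alpha varpi).
Notation v := (vf c varpi).
Notation phi := (phi_a psi alpha c varpi a).

Lemma continuous_sinM : continuous (fun tau : R => sin (varpi%:R * tau)).
Proof.
move=> t; apply: (@continuous_comp _ _ _ (fun t => varpi%:R * t) sin); last exact: continuous_sin.
by apply: cvgM; [exact: cvg_cst|exact: cvg_id].
Qed.

Lemma U_le tau : `|U tau| <= alpha.
Proof. by rewrite normrM (gtr0_norm alpha_gt0) ler_piMr ?sin_max// ltW. Qed.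

Lemma v_le tau : `|v tau| <= c.
Proof. by rewrite normrM (gtr0_norm c_gt0) ler_piMr ?sin_max// ltW. Qed.

Definition integrand p o tau := v tau / a ^+ 2 * taylor_rem p o (a * U tau).

Lemma continuous_integrand p o : continuous (integrand p o).
Proof.
have Uc : continuous (fun tau => a * U tau).
  move=> t; apply: cvgM; first exact: cvg_cst.
  by apply: cvgM; [exact: cvg_cst|exact: continuous_sinM].
move=> t; apply: cvgM.
  apply: cvgM; last exact: cvg_cst.
  by apply: cvgM; [exact: cvg_cst|exact: continuous_sinM].
apply: cvgB; last by apply: cvgM; [exact: Uc|exact: cvg_cst].
apply: cvgB; last exact: cvg_cst.
apply: (@continuous_comp _ _ _ (fun tau => padd p (pscal (a * U tau) o)) psi);
  last exact: continuous_psi.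
exact: (@continuous_comp _ _ _ (fun tau => a * U tau) (fun b => padd p (pscal b o))
  t (Uc t) (@continuous_line p o _)).
Qed.

(** Evaluating the inner integral in closed form removes the second derivatives; what remains is
    continuous in [tau], hence integrable. The division by [a ^+ 2] in [integrand] explains the
    shape [M * a ^+ 2] of the bounds that follow. *)
Lemma phiE p o : phi (p, o) = (2 * pi)^-1 * \int[mu]_(tau in `[0, 2 * pi]) integrand p o tau.
Proof.
rewrite /phi_a /=; congr (_ * _); apply: eq_Rintegral => tau _.
rewrite /integrand -taylor_remE -RintegralZl//.
  apply: eq_Rintegral => s _; rewrite (_ : s * (a * U tau) = a * s * U tau); last ring.
  move: (dot _ _) => d; field; exact: lt0r_neq0.
apply: continuous_integrable => s; apply: cvgM.
  by apply: cvgB; [exact: cvg_cst|exact: cvg_id].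
apply: cvgM; first exact: cvg_cst.
exact: continuous_hess_lineM.
Qed.

Lemma pi2_gt0 : 0 < 2 * pi :> R. Proof. by rewrite mulr_gt0// pi_gt0. Qed.

Lemma mean_le (f : R -> R) (M : R) : continuous f -> (forall tau, `|f tau| <= M) ->
  `|(2 * pi)^-1 * \int[mu]_(tau in `[0, 2 * pi]) f tau| <= M.
Proof.
move=> fc fM; rewrite normrM gtr0_norm ?invr_gt0 ?pi2_gt0//.
rewrite mulrC ler_pdivrMr ?pi2_gt0// -[X in _ <= _ * X]subr0.
by apply: normr_Rint_le => //; [exact/ltW/pi2_gt0|exact: continuous_integrable].
Qed.

Lemma phiB_le p o q o' M : (forall tau, `|taylor_rem p o (a * U tau) - taylor_rem q o' (a * U tau)| <= M * a ^+ 2) ->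
  `|phi (p, o) - phi (q, o')| <= c * M.
Proof.
move=> HM; rewrite !phiE -mulrBr -RintegralB//; try exact/continuous_integrable/continuous_integrand.
apply: mean_le.
  by move=> t; apply: cvgB; exact: continuous_integrand.
move=> tau; rewrite -mulrBr normrM normrM normfV -mulrA ler_pM//; first exact: v_le.
rewrite (ger0_norm (sqr_ge0 a)) mulrC ler_pdivrMr ?exprn_gt0//.
Qed.

Lemma phi_le p o M : (forall tau, `|taylor_rem p o (a * U tau)| <= M * a ^+ 2) ->
  `|phi (p, o)| <= c * M.
Proof.
move=> HM; rewrite phiE; apply: mean_le; first exact: continuous_integrand.
move=> tau; rewrite normrM normrM normfV -mulrA ler_pM//; first exact: v_le.
by rewrite (ger0_norm (sqr_ge0 a)) mulrC ler_pdivrMr ?exprn_gt0.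
Qed.

Lemma taylor_rem_le p o b K : S1 o ->
  (forall w, nrm w <= `|b| -> forall i j, `|hessE psi i j (padd p w)| <= K) ->
  `|taylor_rem p o b| <= 2 * K * b ^+ 2.
Proof.
move=> o1 HK; pose d := pscal b o.
have nd : nrm d = `|b| by rewrite nrm_scal o1 mulr1.
have [t] := mvt_between 0 1 (is_derive_line sm p d).
have [s] := mvt_between 0 t (is_derive_grad_line sm p d d).
rewrite pscal0 pscal1 padd0 !subr0 mulr1 normr1 => st E2 t1 E1.
rewrite /taylor_rem -/d E1 -dot_scal -/d E2 normrM.
have b0 : 0 <= b ^+ 2 by exact: sqr_ge0.
have K0 : 0 <= K.
  apply: le_trans (HK (0, 0) _ true true); last by rewrite nrm0.
  exact: normr_ge0.
have H : `|dot (hessv psi (padd p (pscal s d)) d) d| <= 2 * K * b ^+ 2.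
  have -> : b ^+ 2 = nrm d * nrm d by rewrite nd -expr2 real_normK ?num_real.
  apply: dot_hessv_le => i j; apply: HK.
  by rewrite nrm_scal nd ler_piMl// (le_trans st).
by rewrite (le_trans (ler_pM _ _ H t1))// mulr1.
Qed.

Lemma phi_le_hess p o K : S1 o ->
  (forall w, nrm w <= a * alpha -> forall i j, `|hessE psi i j (padd p w)| <= K) ->
  `|phi (p, o)| <= c * (2 * alpha ^+ 2 * K).
Proof.
move=> o1 HK; apply: phi_le => tau.
have K0 : 0 <= K.
  apply: le_trans (HK (0, 0) _ true true); first exact: normr_ge0.
  by rewrite nrm0 mulr_ge0 ?ltW.
have aU : `|a * U tau| <= a * alpha by rewrite normrM (gtr0_norm a_gt0) ler_wpM2l ?U_le ?ltW.
apply: (le_trans (taylor_rem_le o1 (fun w wb => HK w (le_trans wb aU)))).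
have : (a * U tau) ^+ 2 <= (a * alpha) ^+ 2.
  by rewrite -real_normK ?num_real// ler_sqr ?nnegrE// mulr_ge0 ?ltW.
move=> H; have := ler_wpM2l K0 H; rewrite exprMn [(a * alpha) ^+ 2]exprMn; lra.
Qed.

Variables (c1 : R) (c1_gt0 : 0 < c1).
Hypothesis hessb : forall i j p, `|hessE psi i j p| <= c1.

(** Third derivatives have no global bound, so the difference of remainders is estimated by Hessians
    along the segment from [q] to [p]. This loses a factor [1 / a], which the prefactor [a] in the
    field compensates. *)
Lemma phi_lip_p p q o : S1 o ->
  `|phi (p, o) - phi (q, o)| <= c * (4 * c1 * alpha / a * nrm (psub p q)).
Proof.
move=> o1; apply: phiB_le => tau; set b := a * U tau; set d := psub p q.
have aU : `|b| <= a * alpha by rewrite normrM (gtr0_norm a_gt0) ler_wpM2l ?U_le ?ltW.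
have D (t : R) : is_derive t 1 (fun t => taylor_rem (padd q (pscal t d)) o b)
   (dot (g (padd (padd q (pscal t d)) (pscal b o))) d - dot (g (padd q (pscal t d))) d
    - b * dot (hessv psi (padd q (pscal t d)) o) d).
  have D1 := is_derive_line sm (padd q (pscal b o)) d t.
  have D2 := is_derive_line sm q d t.
  have D3 := is_derive_grad_line sm q d o t.
  have D4 := is_deriveB (is_deriveB D1 D2) (is_deriveZ b D3).
  have sw (s : R) : padd (padd q (pscal b o)) (pscal s d) = padd (padd q (pscal s d)) (pscal b o).
    by rewrite /padd /=; congr pair; ring.
  rewrite sw in D4.
  rewrite (_ : (fun _ => _) = (fun t : R => psi (padd (padd q (pscal b o)) (pscal t d))
     - psi (padd q (pscal t d)) - b *: dot (g (padd q (pscal t d))) o)) ; first exact: D4.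
  by apply/funext => s; rewrite sw.
have [t _] := mvt_between 0 1 D.
rewrite pscal0 pscal1 padd0 padd_psub subr0 mulr1 => ->.
have H1 := grad_lip sm hessb (padd q (pscal t d)) (pscal b o) d.
have H2 : `|dot (hessv psi (padd q (pscal t d)) o) d| <= 2 * c1 * (nrm o * nrm d).
  by apply: dot_hessv_le => i j; exact: hessb.
rewrite nrm_scal o1 mulr1 in H1; rewrite o1 mul1r in H2.
rewrite (le_trans (ler_normB _ _))// normrM.
have -> : 4 * c1 * alpha / a * nrm d * a ^+ 2 = 2 * c1 * (nrm d * (a * alpha)) + (a * alpha) * (2 * c1 * nrm d).
  by field; exact: lt0r_neq0.
apply: lerD; last by rewrite ler_pM.
apply: le_trans H1 _; rewrite ler_wpM2l ?mulr_ge0 ?(ltW c1_gt0)//.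
by rewrite ler_wpM2l ?nrm_ge0.
Qed.

Lemma phi_lip_o p o o' : S1 o -> S1 o' ->
  `|phi (p, o) - phi (p, o')| <= c * (6 * c1 * alpha ^+ 2 * nrm (psub o o')).
Proof.
move=> o1 o1'; apply: phiB_le => tau; set b := a * U tau; set d := psub o o'.
have aU : `|b| <= a * alpha by rewrite normrM (gtr0_norm a_gt0) ler_wpM2l ?U_le ?ltW.
have d2 : nrm d <= 2.
  have -> : d = padd o (pscal (-1) o') by rewrite /d /psub /padd /pscal /= !mulN1r.
  by rewrite (le_trans (nrmD _ _))// nrm_scal o1 o1' normrN1 mulr1; lra.
have [t t1] := mvt_between 0 1 (is_derive_line sm (padd p (pscal b o')) (pscal b d)).
rewrite pscal0 pscal1 padd0 !subr0 mulr1 normr1 in t1 *.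
have -> : padd (padd p (pscal b o')) (pscal b d) = padd p (pscal b o).
  by rewrite /padd /d /=; congr pair; ring.
have -> : padd (padd p (pscal b o')) (pscal t (pscal b d)) =
   padd p (pscal b (padd o' (pscal t d))).
  by rewrite /padd /=; congr pair; ring.
move=> E; have -> : taylor_rem p o b - taylor_rem p o' b =
   dot (g (padd p (pscal b (padd o' (pscal t d))))) (pscal b d) - dot (g p) (pscal b d).
  rewrite /taylor_rem -E dot_scal /d /psub /dot /=; move: (psi _) (psi _) (psi _) => *; ring.
apply: (le_trans (grad_lip sm hessb _ _ _)).
rewrite !nrm_scal.
(* [o'] is a unit vector and [d] has length at most 2. This 3, with the 2 of [grad_lip], gives the
   constant 6. *)
have n3 : nrm (padd o' (pscal t d)) <= 3.
  rewrite (le_trans (nrmD _ _))// o1' nrm_scal.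
  by have : `|t| * nrm d <= 1 * 2 by [rewrite ler_pM// nrm_ge0]; lra.
have -> : 6 * c1 * alpha ^+ 2 * nrm d * a ^+ 2 = 2 * c1 * ((a * alpha * nrm d) * (a * alpha * 3)).
  by field.
rewrite ler_wpM2l ?mulr_ge0 ?(ltW c1_gt0)//.
by rewrite !ler_pM ?mulr_ge0 ?nrm_ge0.
Qed.

End Remainder.

(** * The remainder near a given point *)

Section LocalRemainder.
Context {R : realType}.
Notation mu := (@lebesgue_measure R).
Variables (psi : @pt R -> R) (sm : smooth2 psi).
Implicit Types (p q u v w o : @pt R) (t b tau : R).
Let g := grad psi.

Lemma C1_lip_near (G Gx Gy : R -> R -> R) (q : @pt R) : C1 G Gx Gy ->
  exists L d : R, [/\ 0 < L, 0 < d & forall p p' : @pt R, nrm (psub p q) <= d -> nrm (psub p' q) <= d ->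
    `|G p.1 p.2 - G p'.1 p'.2| <= L * nrm (psub p p')].
Proof.
move=> GC; have [_ _ cx cy] := GC.
have [d1 d10 H1] := cont2_eps (cx q) ltr01; have [d2 d20 H2] := cont2_eps (cy q) ltr01.
pose M1 := `|Gx q.1 q.2| + 1; pose M2 := `|Gy q.1 q.2| + 1.
have M10 : 0 < M1 by rewrite ltr_wpDl. have M20 : 0 < M2 by rewrite ltr_wpDl.
pose d := Num.min d1 d2; have d0 : 0 < d by rewrite lt_min d10.
exists (M1 + M2), (d / 4); split; [exact: addr_gt0|exact: divr_gt0|].
move=> p p' pd pd'; pose e := psub p p'.
have ed : nrm e <= d / 2.
  have -> : e = padd (psub p q) (pscal (-1) (psub p' q)).
    by rewrite /e /psub /padd /pscal /=; congr pair; ring.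
  by rewrite (le_trans (nrmD _ _))// nrm_scal normrN1 mul1r; lra.
have [t] := mvt_between 0 1 (C1_line GC p'.1 p'.2 e.1 e.2).
rewrite !subr0 normr1 mulr1 !mul0r !addr0 !mul1r /e /= !subrKC -/e => t1 ->.
pose z := padd p' (pscal t e).
have zd : nrm (psub z q) < d.
  have -> : psub z q = padd (psub p' q) (pscal t e).
    by rewrite /z /psub /padd /pscal /=; congr pair; ring.
  rewrite (le_lt_trans (nrmD _ _))// nrm_scal.
  have : `|t| * nrm e <= 1 * (d / 2) by rewrite ler_pM// nrm_ge0.
  by lra.
have z1 : `|z.1 - q.1| < d by apply: le_lt_trans zd; exact: (nrm1_le (psub z q)).
have z2 : `|z.2 - q.2| < d by apply: le_lt_trans zd; exact: (nrm2_le (psub z q)).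
move: z1 z2; rewrite !lt_min => /andP[z11 z12] /andP[z21 z22].
have {}H1 := ltW (H1 _ _ z11 z21); have {}H2 := ltW (H2 _ _ z12 z22).
have G1 : `|Gx z.1 z.2| <= M1.
  rewrite -[Gx _ _](subrK (Gx q.1 q.2)) (le_trans (ler_normD _ _))// addrC lerD2l.
  exact: H1.
have G2 : `|Gy z.1 z.2| <= M2.
  rewrite -[Gy _ _](subrK (Gy q.1 q.2)) (le_trans (ler_normD _ _))// addrC lerD2l.
  exact: H2.
rewrite (le_trans (ler_normD _ _))// !normrM mulrDl lerD// ler_pM//.
  exact: (nrm1_le e).
exact: (nrm2_le e).
Qed.

Lemma hess_lip_near q : exists L d : R, [/\ 0 < L, 0 < d & forall i j p p',
  nrm (psub p q) <= d -> nrm (psub p' q) <= d ->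
  `|hessE psi i j p - hessE psi i j p'| <= L * nrm (psub p p')].
Proof.
have H i j := C1_lip_near q (smooth2_C1 [:: i; j] sm).
have [L1 [d1 [L10 d10 H1]]] := H true true.
have [L2 [d2 [L20 d20 H2]]] := H true false.
have [L3 [d3 [L30 d30 H3]]] := H false true.
have [L4 [d4 [L40 d40 H4]]] := H false false.
exists (Num.max (Num.max L1 L2) (Num.max L3 L4)), (Num.min (Num.min d1 d2) (Num.min d3 d4)).
split; first by rewrite !lt_max L10.
  by rewrite !lt_min d10 d20 d30.
move=> i j p p'; rewrite !le_min => /andP[/andP[a1 a2] /andP[a3 a4]] /andP[/andP[b1 b2] /andP[b3 b4]].
case: i; case: j;
  [apply: le_trans (H1 p p' a1 b1) _|apply: le_trans (H2 p p' a2 b2) _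
  |apply: le_trans (H3 p p' a3 b3) _|apply: le_trans (H4 p p' a4 b4) _];
  by rewrite ler_wpM2r ?nrm_ge0// !le_max lexx ?orbT.
Qed.

Lemma hqB_le p q v K : (forall i j, `|hessE psi i j p - hessE psi i j q| <= K) ->
  `|hq psi p v - hq psi q v| <= 2 * K * nrm v ^+ 2.
Proof.
move=> HK; rewrite !hqE.
move: (HK false false) (HK false true) (HK true false) (HK true true) => {HK}.
move: (hessE _ _ _ p) (hessE _ _ _ p) (hessE _ _ _ p) (hessE _ _ _ p) => k l m n.
move: (hessE _ _ _ q) (hessE _ _ _ q) (hessE _ _ _ q) (hessE _ _ _ q) => k' l' m' n'.
move=> Hk Hl Hm Hn.
have M (x y z : R) : `|x| <= K -> `|x * y * z| <= K * ((y ^+ 2 + z ^+ 2) / 2).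
  by move=> xK; rewrite -mulrA normrM ler_pM// normrM_le_sumsq.
have /ler_normlP[A1 B1] := M _ v.1 v.1 Hk; have /ler_normlP[A2 B2] := M _ v.1 v.2 Hl.
have /ler_normlP[A3 B3] := M _ v.1 v.2 Hm; have /ler_normlP[A4 B4] := M _ v.2 v.2 Hn.
by rewrite ler_norml nrm_sumsq; apply/andP; split; lra.
Qed.

(** Two mean values are applied to the difference of [psi] along parallel segments, so that only
    Hessians at matching points are compared. *)
Lemma taylor_remB_le p q o b K : S1 o ->
  (forall t, `|t| <= 1 -> forall i j, `|hessE psi i j (padd p (pscal t (pscal b o))) -
     hessE psi i j (padd q (pscal t (pscal b o)))| <= K) ->
  `|taylor_rem psi p o b - taylor_rem psi q o b| <= 2 * K * b ^+ 2.
Proof.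
move=> o1 HK; pose d := pscal b o.
have nd : nrm d = `|b| by rewrite nrm_scal o1 mulr1.
pose k t := psi (padd p (pscal t d)) - psi (padd q (pscal t d)).
pose k1 t := dot (g (padd p (pscal t d))) d - dot (g (padd q (pscal t d))) d.
have kd (t : R) : is_derive t 1 k (k1 t).
  exact: is_deriveB (is_derive_line sm p d t) (is_derive_line sm q d t).
have k1d (t : R) : is_derive t 1 k1 (hq psi (padd p (pscal t d)) d - hq psi (padd q (pscal t d)) d).
  exact: is_deriveB (is_derive_grad_line sm p d d t) (is_derive_grad_line sm q d d t).
have [t] := mvt_between 0 1 kd.
have [s] := mvt_between 0 t k1d.
rewrite !subr0 mulr1 normr1 => st E2 t1 E1.
have -> : taylor_rem psi p o b - taylor_rem psi q o b = k 1 - k 0 - k1 0.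
  rewrite /taylor_rem /k /k1 pscal0 pscal1 !padd0 -!dot_scal -/d; ring.
rewrite E1 E2 normrM.
have H : `|hq psi (padd p (pscal s d)) d - hq psi (padd q (pscal s d)) d| <= 2 * K * b ^+ 2.
  have -> : b ^+ 2 = nrm d ^+ 2 by rewrite nd real_normK ?num_real.
  by apply: hqB_le => i j; apply: HK; exact: le_trans st t1.
by rewrite (le_trans (ler_pM _ _ H t1))// mulr1.
Qed.

Variables (alpha c : R) (varpi : nat).
Hypotheses (alpha_gt0 : 0 < alpha) (c_gt0 : 0 < c).

(** Unlike in [phi_lip_p] the constant is uniform in [a]: near [q] the Hessian is itself Lipschitz,
    so the factor [a ^+ 2] of the remainder survives. Half of the radius serves [p], half the
    displacement by [a * U tau]. *)
Lemma phi_lip_near q : exists C d : R, [/\ 0 < C, 0 < d & forall a p o, 0 < a -> a * alpha <= d ->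
  S1 o -> nrm (psub p q) <= d ->
  `|phi_a psi alpha c varpi a (p, o) - phi_a psi alpha c varpi a (q, o)| <= C * nrm (psub p q)].
Proof.
have [L [d [L0 d0 H]]] := hess_lip_near q.
exists (c * (2 * L * alpha ^+ 2)), (d / 2); split.
- by rewrite !mulr_gt0// exprn_gt0.
- exact: divr_gt0.
move=> a p o a0 ad o1 pd; rewrite -mulrA.
apply: phiB_le => // tau; set b := a * _.
have b2 : b ^+ 2 <= (a * alpha) ^+ 2.
  rewrite -real_normK ?num_real// ler_sqr ?nnegrE ?mulr_ge0 ?(ltW a0) ?(ltW alpha_gt0)//.
  by rewrite normrM (gtr0_norm a0) ler_wpM2l ?U_le// ltW.
have ba : `|b| <= a * alpha by rewrite normrM (gtr0_norm a0) ler_wpM2l ?U_le// ltW.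
apply: le_trans (@taylor_remB_le p q o b (L * nrm (psub p q)) o1 _) _.
  move=> t t1 i j.
  have tb : nrm (pscal t (pscal b o)) <= d / 2.
    rewrite !nrm_scal o1 mulr1 (le_trans _ ad)// (le_trans _ ba)// ler_piMl//.
  have E : psub (padd p (pscal t (pscal b o))) (padd q (pscal t (pscal b o))) = psub p q.
    by rewrite /psub /padd /=; congr pair; ring.
  rewrite -[X in _ <= L * nrm X]E; apply: H.
    rewrite (_ : psub _ _ = padd (psub p q) (pscal t (pscal b o))); last first.
      by rewrite /psub /padd /=; congr pair; ring.
    by rewrite (le_trans (nrmD _ _))//; lra.
  rewrite (_ : psub _ _ = pscal t (pscal b o)); first lra.
  by rewrite /psub /padd /pscal /=; congr pair; ring.
have u0 : 0 <= L * nrm (psub p q) by rewrite mulr_ge0 ?nrm_ge0 ?ltW.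
have := ler_wpM2l u0 b2; rewrite exprMn; lra.
Qed.

(* By symmetry of [psi] at [q] the integrand changes sign under tau -> 2 pi - tau. *)
Lemma phi_center q (r : R) a o : 0 < a -> S1 o -> g q = (0, 0) ->
  (forall v, nrm v <= r -> psi (padd q v) = psi (psub q v)) -> a * alpha <= r ->
  phi_a psi alpha c varpi a (q, o) = 0.
Proof.
move=> a0 o1 gq sym ar; rewrite phiE//.
pose f tau := integrand psi alpha c varpi a q o tau.
have fc : continuous f by exact: continuous_integrand.
have frev tau : f (2 * pi - tau) = - f tau.
  (* Integrality of [varpi] makes the phase shift [varpi * 2 pi] a multiple of the period. *)
  have S : sin (varpi%:R * (2 * pi - tau)) = - sin (varpi%:R * tau).
    rewrite mulrBr -sinN; have := periodicn (@sinD2pi R) varpi (- (varpi%:R * tau)).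
    move=> <-; congr sin; rewrite addrC -mulr_natl; ring.
  have Uo : Uf alpha varpi (2 * pi - tau) = - Uf alpha varpi tau by rewrite /Uf S mulrN.
  have vo : vf c varpi (2 * pi - tau) = - vf c varpi tau by rewrite /vf S mulrN.
  rewrite /f /integrand Uo vo !mulNr; congr (- (_ * _)).
  have G0 : dot (g q) o = 0 by rewrite gq /dot /= !mul0r addr0.
  rewrite /taylor_rem -/g !G0 !mulr0 !subr0; congr (_ - _).
  rewrite mulrN; set b := a * _.
  have -> : padd q (pscal (- b) o) = psub q (pscal b o) by rewrite /padd /psub /pscal /= !mulNr.
  apply/esym/sym; rewrite nrm_scal o1 mulr1 (le_trans _ ar)//.
  by rewrite normrM (gtr0_norm a0) ler_wpM2l ?U_le// ltW.
have E : \int[mu]_(tau in `[0, 2 * pi]) f tau = - \int[mu]_(tau in `[0, 2 * pi]) f tau.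
  rewrite -[LHS]Rint_rev//; last exact/ltW/pi2_gt0.
  under eq_Rintegral do rewrite frev.
  rewrite -mulN1r -RintegralZl//; last exact: continuous_integrable.
  by apply: eq_Rintegral => x _; rewrite mulN1r.
have -> : \int[mu]_(tau in `[0, 2 * pi]) integrand psi alpha c varpi a q o tau = 0 by move: E; rewrite /f; lra.
by rewrite mulr0.
Qed.

End LocalRemainder.

Section SmallRemainder.
Context {R : realType}.
Variables (psi : @pt R -> R) (ps : @pt R) (alpha c c1 : R) (varpi : nat).
Hypotheses (sm : smooth2 psi) (alpha_gt0 : 0 < alpha) (c_gt0 : 0 < c) (c1_gt0 : 0 < c1).
Hypothesis hessb : forall i j p, `|hessE psi i j p| <= c1.
Hypotheses (psmax : cond1 psi ps) (negdef : cond2 psi ps) (symm : cond3 psi ps).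
Hypothesis gradn0 : cond5 psi ps.
Notation phi a := (phi_a psi alpha c varpi a).

(** Three zones. Close to [ps] the remainder vanishes at the centre and is Lipschitz uniformly in
    [a], while the gradient grows linearly ([B1]). In between, the gradient is bounded below and the
    Hessian above ([B2]). Beyond [r] the Hessian is bounded by the gradient ([B3]). *)
Lemma phi_le_grad (K r s : R) : 0 < K -> 0 < s ->
  (forall p w, r <= nrm (psub p ps) -> nrm w <= s ->
     forall i j, `|hessE psi i j (padd p w)| <= K * nrm (grad psi p)) ->
  exists C a0 : R, [/\ 0 < C, 0 < a0 & forall a p o, 0 < a -> a < a0 -> S1 o ->
    `|phi a (p, o)| <= C * nrm (grad psi p)].
Proof.
move=> K0 s0 far.
have [C [d [C0 d0 near]]] := phi_lip_near sm varpi alpha_gt0 c_gt0 ps.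
have [r1 [r10 sym]] := symm.
pose rr := Num.max d r.
have drr : d <= rr by rewrite le_max lexx.
have rrr : r <= rr by rewrite le_max lexx orbT.
have [k k0 ball] := ball_bounds sm c1_gt0 hessb psmax negdef gradn0 rr.
pose B1 := C / k; pose B2 := c * (2 * alpha ^+ 2 * c1) / (k * d).
pose B3 := c * (2 * alpha ^+ 2 * K).
have B10 : 0 < B1 by rewrite divr_gt0.
have B20 : 0 < B2 by rewrite divr_gt0 ?mulr_gt0// exprn_gt0.
have B30 : 0 < B3 by rewrite !mulr_gt0// exprn_gt0.
(* Excursions of length [a * alpha] must fit the Lipschitz ball, the symmetry radius and the radius
   [s] of the far bound. *)
pose b := Num.min d (Num.min r1 s).
exists (B1 + B2 + B3), (b / alpha); split; first by rewrite !addr_gt0.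
  by rewrite divr_gt0// !lt_min d0 r10.
move=> a p o a0; rewrite ltr_pdivlMr// => /ltW; rewrite !le_min => /andP[ad /andP[ar1 as_]] o1.
set gp := nrm _; have gp0 : 0 <= gp by exact: nrm_ge0.
have P1 : 0 <= B1 * gp by apply: mulr_ge0 => //; exact: ltW.
have P2 : 0 <= B2 * gp by apply: mulr_ge0 => //; exact: ltW.
have P3 : 0 <= B3 * gp by apply: mulr_ge0 => //; exact: ltW.
suff : `|phi a (p, o)| <= B1 * gp \/ `|phi a (p, o)| <= B2 * gp \/ `|phi a (p, o)| <= B3 * gp.
  move: P1 P2 P3; rewrite (mulrDl (B1 + B2)) (mulrDl B1) => P1 P2 P3 [|[]]; lra.
have [ud|du] := leP (nrm (psub p ps)) d.
  left; have := near a p o a0 ad o1 ud.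
  rewrite (@phi_center _ psi sm alpha c varpi alpha_gt0 ps r1)// ?subr0; last first.
    exact: (grad_ps sm c1_gt0 hessb psmax).
  move=> /le_trans; apply; rewrite /B1 mulrAC ler_pdivlMr// -mulrA ler_wpM2l ?(ltW C0)//.
  by rewrite [_ * k]mulrC; have [] := ball p (le_trans ud drr).
right; have [ur|/ltW ru] := leP (nrm (psub p ps)) r.
  left; have [G _] := ball p (le_trans ur rrr).
  apply: le_trans (phi_le_hess sm varpi alpha_gt0 c_gt0 a0 o1 (fun w _ i j => hessb i j _)) _.
  rewrite /B2 [leRHS]mulrAC ler_pdivlMr ?mulr_gt0// ler_wpM2l//.
    by rewrite !mulr_ge0 ?sqr_ge0 ?ltW.
  by apply: le_trans G; rewrite ler_wpM2l// ltW.
right; apply: le_trans (phi_le_hess sm varpi alpha_gt0 c_gt0 a0 o1 _) _.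
  move=> w wa i j; apply: far => //; exact: le_trans wa as_.
by rewrite /B3 -/gp le_eqVlt; apply/orP; left; apply/eqP; ring.
Qed.

End SmallRemainder.

(** * Existence and uniqueness of solutions *)

Section Primitive.
Context {R : realType}.
Notation mu := (@lebesgue_measure R).
Implicit Types (f g : R -> R) (a b t s : R).

Lemma ae_imply (P Q : R -> Prop) : {ae mu, forall x, P x} -> (forall x, P x -> Q x) ->
  {ae mu, forall x, Q x}.
Proof. by move=> H PQ; apply: filterS PQ H; exact: (ae_filter_ringOfSetsType mu). Qed.

Definition loc_bounded f := measurable_fun setT f /\
  forall b : R, exists2 M : R, 0 <= M & {ae mu, forall x, 0 <= x <= b -> `|f x| <= M}.

Lemma loc_bounded_continuous f : continuous f -> loc_bounded f.
Proof.
move=> fc; split; first by apply: subspace_continuous_measurable_fun => //; exact: continuous_subspaceT.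
move=> b; have [b0|b0] := leP 0 b; last first.
  exists 0 => //; apply: aeW => x /andP[x0 xb].
  by have := lt_le_trans b0 x0; rewrite ltNge xb.
have [t _ H] := @EVT_max R (fun x => `|f x|) 0 b b0 (continuous_subspaceT (fun x => cvg_norm (fc x))).
by exists `|f t| => //; apply: aeW => x xb; apply: H; rewrite in_itv.
Qed.

Lemma loc_boundedD f g : loc_bounded f -> loc_bounded g -> loc_bounded (fun x => f x + g x).
Proof.
move=> [mf bf] [mg bg]; split; first exact: measurable_funD.
move=> b; have [M M0 HM] := bf b; have [N N0 HN] := bg b.
exists (M + N); first exact: addr_ge0.
apply: filterS2 HM HN; first exact: (ae_filter_ringOfSetsType mu).
move=> x Hf Hg xb.
by rewrite (le_trans (ler_normD _ _))// lerD ?Hf ?Hg.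
Qed.

Lemma loc_boundedM f g : loc_bounded f -> loc_bounded g -> loc_bounded (fun x => f x * g x).
Proof.
move=> [mf bf] [mg bg]; split; first exact: measurable_funM.
move=> b; have [M M0 HM] := bf b; have [N N0 HN] := bg b.
exists (M * N); first exact: mulr_ge0.
apply: filterS2 HM HN; first exact: (ae_filter_ringOfSetsType mu).
move=> x Hf Hg xb.
by rewrite normrM ler_pM ?Hf ?Hg.
Qed.

Lemma loc_bounded_integrable f b : loc_bounded f -> mu.-integrable `[0, b] (EFin \o f).
Proof.
move=> [mf bf]; apply/integrableP.
have mf' : measurable_fun `[0, b] (EFin \o f).
  by apply/measurable_EFinP; exact: measurable_funTS.
split => //; have [M M0 HM] := bf b.
have H : (\int[mu]_(x in `[0%R, b]) M%:E < +oo)%E.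
  rewrite integral_cst//= lebesgue_measure_itv/=; case: ifP => _; last by rewrite mule0 ltry.
  by rewrite -EFinD -EFinM ltry.
apply: le_lt_trans H.
apply: ae_ge0_le_integral => //.
exact: measurableT_comp.

Qed.

(** For [t <= 0] the value is 0, so primitives extend constantly to negative times and continuity
    can be stated on the whole line. *)
Definition prim f t : R := \int[mu]_(x in `[0, t]) f x.

Lemma prim_le0 f t : t <= 0 -> prim f t = 0.
Proof.
rewrite le_eqVlt => /predU1P[->|t0]; rewrite /prim; first by rewrite set_itv1 Rintegral_set1.
by rewrite set_itv_ge ?Rintegral_set0// bnd_simp -ltNge.
Qed.

Lemma prim_lip f b M : loc_bounded f -> 0 <= M ->
  {ae mu, forall x, 0 <= x <= b -> `|f x| <= M} ->
  forall s t, s <= t -> t <= b -> `|prim f t - prim f s| <= M * (t - s).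
Proof.
move=> fb M0 HM s t st tb; have [s0|s0] := leP 0 s.
  have it := loc_bounded_integrable t fb.
  rewrite /prim (Rint_split s0 st it) addrC addKr.
  apply: normr_Rint_ae_le => //.
    by apply: integrableS it => //; apply: subset_itvr; rewrite bnd_simp.
  apply: ae_imply HM _ => x Hx /andP[sx xt]; apply: Hx.
  by rewrite (le_trans s0 sx) (le_trans xt tb).
rewrite (prim_le0 _ (ltW s0)) subr0; have [t0|/ltW t0] := leP 0 t; last first.
  by rewrite prim_le0// normr0 mulr_ge0// subr_ge0.
apply: (le_trans (_ : _ <= M * (t - 0))).
  apply: normr_Rint_ae_le => //; first exact: loc_bounded_integrable.
  by apply: ae_imply HM _ => x Hx /andP[sx xt]; apply: Hx; rewrite sx (le_trans xt tb).
by rewrite ler_wpM2l// lerB// ltW.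
Qed.

Lemma continuous_prim f : loc_bounded f -> continuous (prim f).
Proof.
move=> fb t; apply/cvgrPdist_le => e e0.
have [M M0 HM] := fb.2 (t + 1).
have M1 : 0 < M + 1 by rewrite ltr_wpDl.
near=> s.
have st : `|t - s| <= e / (M + 1).
  by near: s; apply: cvgr_dist_le; [exact: cvg_id|exact: divr_gt0].
have s1 : s <= t + 1.
  have : `|t - s| <= 1 by near: s; apply: cvgr_dist_le; [exact: cvg_id|].
  by rewrite ler_norml => /andP[]; lra.
apply: (le_trans (_ : _ <= M * `|t - s|)).
  have [ts|/ltW ts] := leP t s.
    by rewrite distrC (distrC t) (ger0_norm (_ : 0 <= s - t)) ?subr_ge0//; exact: (prim_lip fb M0 HM).
  rewrite (ger0_norm (_ : 0 <= t - s)) ?subr_ge0//; apply: (prim_lip fb M0 HM) => //.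
  by rewrite lerDl.
rewrite (le_trans (ler_pM _ _ (_ : M <= M + 1) st))// ?lerDl//.
by rewrite mulrCA divff ?mulr1// gt_eqF.
Unshelve. all: by end_near. Qed.

Lemma prim_add f s t : loc_bounded f -> 0 <= s -> s <= t ->
  prim f t = prim f s + \int[mu]_(x in `[s, t]) f x.
Proof. by move=> fb s0 st; rewrite /prim (Rint_split s0 st)//; exact: loc_bounded_integrable. Qed.

Lemma geometric_limit (u : nat -> R) (C : R) : 0 <= C ->
  (forall n, `|u n.+1 - u n| <= C * (1 / 2) ^+ n) ->
  forall n, `|u n - lim (u @ \oo)| <= 2 * C * (1 / 2) ^+ n.
Proof.
move=> C0 H.
have p0 n : 0 <= (1 / 2 : R) ^+ n by rewrite exprn_ge0.
have tele n k : `|u (n + k)%N - u n| <= 2 * C * (1 / 2) ^+ n * (1 - (1 / 2) ^+ k).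
  elim: k => [|k IH]; first by rewrite addn0 subrr normr0 expr0 subrr mulr0.
  rewrite addnS -(subrKA (u (n + k)%N)) (le_trans (ler_normD _ _))//.
  have := H (n + k)%N; rewrite exprD [(1 / 2) ^+ k.+1]exprS.
  by have := mulr_ge0 C0 (mulr_ge0 (p0 n) (p0 k)); lra.
have bnd n m : (n <= m)%N -> `|u m - u n| <= 2 * C * (1 / 2) ^+ n.
  move=> nm; have := tele n (m - n)%N; rewrite subnKC// => /le_trans; apply.
  by rewrite ler_piMr ?mulr_ge0// gerBl.
have small : forall e, 0 < e -> exists n, 2 * C * (1 / 2) ^+ n < e.
  move=> e e0; have e1 : 0 < e / (2 * C + 1) by rewrite divr_gt0// ltr_wpDl// mulr_ge0.
  have : (fun n => (1 / 2 : R) ^+ n) @ \oo --> (0 : R).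
    by apply: cvg_expr; rewrite ger0_norm ?ltr_pdivrMr//; lra.
  move=> /cvgrPdist_lt/(_ _ e1)[n _ /(_ n (leqnn n))] /=.
  rewrite sub0r normrN ger0_norm// ltr_pdivlMr ?ltr_wpDl ?mulr_ge0// => Hn.
  by exists n; apply: le_lt_trans Hn; rewrite mulrC ler_wpM2l// lerDl.
have uc : cvg (u @ \oo).
  apply/cauchy_cvgP/cauchy_exP => e e0; have [n Hn] := small e e0.
  exists (u n); exists n => // m /= nm; rewrite /ball/= distrC.
  exact: le_lt_trans (bnd n m nm) Hn.
move=> n; apply/ler_addgt0Pr => e e0.
move/cvgrPdist_le: uc => /(_ e e0)[m _ Hm].
have := Hm (maxn n m) (leq_maxr _ _); have := bnd n (maxn n m) (leq_maxl _ _).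
move=> A B; rewrite -(subrKA (u (maxn n m))) (le_trans (ler_normD _ _))//.
by rewrite distrC lerD// distrC.
Qed.

End Primitive.

Section Gronwall.
Context {R : realType}.
Notation mu := (@lebesgue_measure R).
Implicit Types (f : R -> R) (s t : R).

Lemma within_cont_on (a b : R) (z : R -> R) : {within `[a, b], continuous z} -> cont_on a b z.
Proof.
move=> /subspace_continuousP zc s sab e e0.
have sI : `[a, b]%classic s by rewrite /= in_itv.
have /cvgrPdist_lt/(_ e e0) := zc s sI.
rewrite /prop_near1 /within /= => /nbhs_ballP[d /= d0 H].
exists d => // t tab ts; rewrite distrC; apply: H; last by rewrite /= in_itv.
by rewrite /ball/= distrC.
Qed.

Lemma prim_cont_on f (T : R) : 0 <= T -> mu.-integrable `[0, T] (EFin \o f) ->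
  cont_on 0 T (prim f).
Proof. by move=> T0 fi; apply: within_cont_on; exact: parameterized_integral_continuous. Qed.

(** [k1] and [k2] are merely integrable, so the sum of absolute values is fed to [dini_exp], with
    rate [2 * L] (one [L] per coordinate) and initial value 0. *)
Lemma gronwall_pair (D1 D2 k1 k2 : R -> R) (L T : R) : 0 <= L ->
  mu.-integrable `[0, T] (EFin \o k1) -> mu.-integrable `[0, T] (EFin \o k2) ->
  (forall s, 0 <= s <= T -> D1 s = prim k1 s /\ D2 s = prim k2 s) ->
  (forall s, 0 <= s <= T -> `|k1 s| <= L * (`|D1 s| + `|D2 s|) /\ `|k2 s| <= L * (`|D1 s| + `|D2 s|)) ->
  0 <= T -> D1 T = 0 /\ D2 T = 0.
Proof.
move=> L0 ik1 ik2 DE kD T0.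
pose N s := `|D1 s| + `|D2 s|.
have Nc : cont_on 0 T N.
  move=> s sT e e0; have e2 : 0 < e / 2 by rewrite divr_gt0.
  have [d1 d10 H1] := prim_cont_on T0 ik1 sT e2.
  have [d2 d20 H2] := prim_cont_on T0 ik2 sT e2.
  exists (Num.min d1 d2) => [|t tT]; first by rewrite lt_min d10.
  rewrite lt_min => /andP[t1 t2]; have {}H1 := H1 t tT t1; have {}H2 := H2 t tT t2.
  have [E1 E2] := DE s sT; have [E3 E4] := DE t tT.
  rewrite /N E1 E2 E3 E4.
  have G1 := le_lt_trans (ler_dist_dist (prim k1 t) (prim k1 s)) H1.
  have G2 := le_lt_trans (ler_dist_dist (prim k2 t) (prim k2 s)) H2.
  move: G1 G2; rewrite !ltr_norml => /andP[? ?] /andP[? ?]; apply/andP; split; lra.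
suff : N T <= N 0 * expR (2 * L * (T - 0)).
  have N0 : N 0 = 0.
    rewrite /N; have [-> ->] : D1 0 = prim k1 0 /\ D2 0 = prim k2 0 by apply: DE; rewrite lexx.
    by rewrite !prim_le0// normr0 addr0.
  rewrite N0 mul0r /N => H.
  have := normr_ge0 (D1 T); have := normr_ge0 (D2 T) => a1 a2.
  by split; apply/eqP; rewrite -normr_eq0; apply/eqP; lra.
apply: dini_exp => // s /andP[s0 sT] e e0.
pose e' := e / (2 * L + 1).
have L1 : 0 < 2 * L + 1 by rewrite ltr_wpDl// mulr_ge0.
have e'0 : 0 < e' by rewrite divr_gt0.
have e'e : 2 * L * e' <= e by rewrite /e' mulrCA ler_piMr ?(ltW e0)// ler_pdivrMr// mul1r lerDl.
have sT' : 0 <= s <= T by rewrite s0 ltW.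
have [d d0 H] := Nc s sT' e' e'0.
exists (Num.min d (T - s)) => [|h]; first by rewrite lt_min d0 subr_gt0.
rewrite lt_min => /andP[h0 /andP[hd hT]].
have shT : 0 <= s + h <= T by apply/andP; split; lra.
have /andP[_ shT2] := shT.
have inc D k : (forall s, 0 <= s <= T -> D s = prim k s) -> mu.-integrable `[0, T] (EFin \o k) ->
    (forall s, 0 <= s <= T -> `|k s| <= L * N s) ->
    `|D (s + h)| <= `|D s| + L * (N s + e') * h.
  move=> DE' ik kN; rewrite (DE' (s + h) shT) /prim.
  have ssh : s <= s + h by rewrite lerDl ltW.
  have ish : mu.-integrable `[0, (s + h)] (EFin \o k).
    by apply: integrableS ik => //; apply: subset_itvl; rewrite bnd_simp; case/andP: shT.
  rewrite (Rint_split s0 ssh ish) -/(prim k s) -(DE' s sT').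
  rewrite (le_trans (ler_normD _ _))// lerD2l.
  have -> : L * (N s + e') * h = L * (N s + e') * (s + h - s) by rewrite (addrC s) addrK.
  apply: normr_Rint_le => //.
    by apply: integrableS ish => //; apply: subset_itvr; rewrite bnd_simp.
  move=> x /andP[sx xh]; have xT : 0 <= x <= T by apply/andP; split; lra.
  apply: le_trans (kN x xT) _; rewrite ler_wpM2l// -lerBlDl ltW//.
  have := H x xT; rewrite ger0_norm ?subr_ge0// => /(_ _)/ltr_normlW; apply; lra.
have I1 := inc D1 k1 (fun s sT => (DE s sT).1) ik1 (fun s sT => (kD s sT).1).
have I2 := inc D2 k2 (fun s sT => (DE s sT).2) ik2 (fun s sT => (kD s sT).2).
have : 2 * L * e' * h <= e * h by rewrite ler_wpM2r// ltW.
move: I1 I2; rewrite /N; lra.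
Qed.

End Gronwall.

(** * A fixed point for the scalar speed *)

Section Picard.
Context {R : realType}.
Notation mu := (@lebesgue_measure R).
Variables (F : R -> R -> R -> R) (L : R) (k1 k2 w : R -> R) (x0 y0 : R).
Hypotheses (L_gt0 : 0 < L) (k1c : continuous k1) (k2c : continuous k2) (wb : loc_bounded w).
Hypotheses (k1_le : forall t, `|k1 t| <= 1) (k2_le : forall t, `|k2 t| <= 1).
Hypothesis F_lip : forall x y x' y' t, `|F x y t - F x' y' t| <= L * (`|x - x'| + `|y - y'|).
Hypothesis F_cont : forall x y : R -> R, continuous x -> continuous y ->
  continuous (fun t => F (x t) (y t) t).
Implicit Types (s t b K : R) (sg tau k : R -> R) (n : nat).

(* The unknown of the fixed point is the scalar speed [sg] along the moving direction
   [(k1, k2)]: it is continuous even when the input [w] is only measurable. *)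
Let I k sg t := prim (fun s => (sg s + w s) * k s) t.
Let Pic sg t := F (x0 + I k1 sg t) (y0 + I k2 sg t) t.
(** Growth rate of an exponentially weighted norm. Each of the two integrals gains [1 / l], so a
    Picard step contracts by [L * (2 / l) = 1 / 2] without any restriction to short times. *)
Let l := 4 * L.
Let l_gt0 : 0 < l. Proof. by rewrite mulr_gt0. Qed.

Lemma loc_bounded_speed k sg : continuous k -> continuous sg ->
  loc_bounded (fun s => (sg s + w s) * k s).
Proof.
move=> kc sc; apply: loc_boundedM; last exact: loc_bounded_continuous.
by apply: loc_boundedD => //; exact: loc_bounded_continuous.
Qed.

Let I_cont k sg : continuous k -> continuous sg -> continuous (I k sg).
Proof. by move=> kc sc; apply: continuous_prim; exact: loc_bounded_speed. Qed.

Let Pic_cont sg : continuous sg -> continuous (Pic sg).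
Proof.
by move=> sc; apply: F_cont => t; apply: cvgD; (try exact: cvg_cst); exact: I_cont.
Qed.

Let close b K sg tau := forall t, t <= b -> `|sg t - tau t| <= K * expR (l * `|t|).

Let I_close k b K sg tau : continuous k -> (forall t, `|k t| <= 1) ->
  continuous sg -> continuous tau -> 0 <= K ->
  close b K sg tau -> forall t, t <= b -> `|I k sg t - I k tau t| <= K / l * expR (l * `|t|).
Proof.
move=> kc k1' sc tc K0 H t tb.
have [t0|t0] := leP t 0.
  by rewrite /I !prim_le0// subrr normr0 !mulr_ge0 ?expR_ge0// invr_ge0 ltW.
rewrite /I /prim -RintegralB//; try exact/loc_bounded_integrable/loc_bounded_speed.
rewrite (_ : (fun _ => _) = (fun s => (sg s - tau s) * k s)); last first.
  by apply/funext => s; ring.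
have dc : continuous (fun s => (sg s - tau s) * k s).
  by move=> s; apply: cvgM; [apply: cvgB; [exact: sc|exact: tc]|exact: kc].
have Ed (s : R) : is_derive s 1 (fun s => K / l * expR (l * s)) (K * expR (l * s)).
  have H1 : is_derive s 1 (fun t => l * t) l by apply: is_derive_eq; rewrite /GRing.scale/= mulr1.
  have H2 := is_derive1_comp (is_derive_expR (l * s)) H1.
  have H3 := is_deriveZ (K / l) H2.
  apply: (is_derive_eq H3); rewrite /GRing.scale/=.
  by move: (expR _) => E; field; rewrite gt_eqF.
have Ec : continuous (fun s => K * expR (l * s)).
  move=> s; apply: cvgM; first exact: cvg_cst.
  apply: (@continuous_comp _ _ _ (fun s => l * s) expR); last exact: continuous_expR.
  by apply: cvgM; [exact: cvg_cst|exact: cvg_id].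
apply: le_trans (le_normr_Rintegral _ (continuous_integrable _ _ dc)) _ => //.
apply: (le_trans (_ : _ <= \int[mu]_(s in `[0, t]) (K * expR (l * s)))).
  apply: le_Rintegral => //.
  - exact: (integrable_abse (continuous_integrable _ _ dc)).
  - exact: continuous_integrable.
  - move=> s; rewrite /= in_itv /= => /andP[s0 st]; rewrite normrM.
    have := H s (le_trans st tb); rewrite (ger0_norm s0) => Hs.
    by rewrite -[leRHS]mulr1 ler_pM.
rewrite (Rint_FTC2 t0 Ec Ed) (gtr0_norm t0) gerBl mulr0 mulr_ge0 ?expR_ge0//.
by rewrite divr_ge0// ltW.
Qed.

Let Pic_close b K sg tau : continuous sg -> continuous tau -> 0 <= K ->
  close b K sg tau -> close b (K / 2) (Pic sg) (Pic tau).
Proof.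
move=> sc tc K0 H t tb; apply: le_trans (F_lip _ _ _ _ _) _.
have S (z x y : R) : z + x - (z + y) = x - y by ring.
rewrite !S.
have H1 := I_close k1c k1_le sc tc K0 H tb.
have H2 := I_close k2c k2_le sc tc K0 H tb.
have -> : K / 2 = L * (K / l + K / l) by rewrite /l; field; rewrite gt_eqF.
by rewrite -mulrA ler_wpM2l ?(ltW L_gt0)// mulrDl lerD.
Qed.

Let it n := iter n Pic (F x0 y0).

Let it_cont n : continuous (it n).
Proof.
elim: n => [|n IH]; last exact: Pic_cont.
by apply: (@F_cont (cst x0) (cst y0)); exact: cst_continuous.
Qed.

Let it_close b : 0 <= b -> exists2 K, 0 <= K &
  forall n, close b (K * (1 / 2) ^+ n) (it n.+1) (it n).
Proof.
move=> b0; have dc : continuous (fun t => `|it 1 t - it 0 t|).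
  by move=> t; apply: cvg_norm; apply: cvgB; exact: it_cont.
have [t _ Ht] := EVT_max b0 (continuous_subspaceT dc).
exists `|it 1 t - it 0 t| => //; elim => [|n IH].
  (* At nonpositive times the integrals vanish and the first two iterates coincide; on [[0, b]] the
     maximal distance suffices, as the weight is at least 1. *)
  rewrite expr0 mulr1 => s sb; have [s0|/ltW s0] := leP s 0.
    rewrite {1}/it /= {1}/Pic /I !prim_le0// !addr0 subrr normr0 mulr_ge0 ?expR_ge0//.
  apply: (le_trans (Ht s _)); first by rewrite in_itv /= s0.
  by rewrite ler_peMr// -expR0 ler_expR mulr_ge0// ltW.
have := Pic_close (@it_cont n.+1) (@it_cont n) _ IH; rewrite mulr_ge0 ?exprn_ge0// => /(_ isT).
by rewrite exprSr mul1r mulrA.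
Qed.

Let sol t := lim (it ^~ t @ \oo).

Let it_sol b : 0 <= b -> exists2 K, 0 <= K &
  forall n, close b (K * (1 / 2) ^+ n) (it n) sol.
Proof.
move=> b0; have [K K0 H] := it_close b0; exists (2 * K); first by rewrite mulr_ge0.
move=> n t tb.
have := @geometric_limit R (it ^~ t) (K * expR (l * `|t|)) _ _ n.
rewrite mulr_ge0 ?expR_ge0// => /(_ isT) H'.
have -> : 2 * K * (1 / 2) ^+ n * expR (l * `|t|) = 2 * (K * expR (l * `|t|)) * (1 / 2) ^+ n by ring.
by apply: H' => m; rewrite mulrAC; exact: H.
Qed.

Let small K e : 0 < e -> exists n, K * (1 / 2) ^+ n < e.
Proof.
move=> e0; have : (fun n => K * (1 / 2 : R) ^+ n) @ \oo --> K * (0 : R).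
  apply: cvgM; first exact: cvg_cst.
  by apply: cvg_expr; rewrite ger0_norm ?ltr_pdivrMr//; lra.
rewrite mulr0 => /cvgrPdist_lt/(_ _ e0)[n _ /(_ n (leqnn n))] /=.
by rewrite sub0r normrN => /ltr_normlW Hn; exists n.
Qed.

Let sol_cont : continuous sol.
Proof.
move=> t; apply/cvgrPdist_le => e e0.
have b0 : 0 <= `|t| + 1 by rewrite addr_ge0.
have [K K0 H] := it_sol b0.
pose E := expR (l * (`|t| + 1)).
have e3 : 0 < e / 3 by rewrite divr_gt0.
have [n Hn] := small (K * E) e3.
have near_le s : `|s| <= `|t| + 1 -> `|it n s - sol s| <= e / 3.
  move=> st; apply: (le_trans (H n s _)); first exact: le_trans (ler_norm _) st.
  apply: le_trans (ltW Hn); rewrite mulrAC ler_wpM2r ?exprn_ge0// ler_wpM2l//.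
  by rewrite ler_expR ler_wpM2l// ltW.
near=> s.
have s1 : `|s| <= `|t| + 1.
  rewrite -[s](subrK t) (le_trans (ler_normD _ _))// addrC lerD2l distrC.
  by near: s; apply: cvgr_dist_le; [exact: cvg_id|].
have ts : `|it n t - it n s| <= e / 3.
  by near: s; apply: cvgr_dist_le => //; exact: it_cont.
have t1 : `|t| <= `|t| + 1 by rewrite lerDl.
have A := near_le s s1; have B := near_le t t1.
rewrite distrC in B.
rewrite (_ : sol t - sol s = (sol t - it n t) + (it n t - it n s) + (it n s - sol s)); last ring.
rewrite (le_trans (ler_normD _ _))// (le_trans (lerD (ler_normD _ _) (lexx _)))//; lra.
Unshelve. all: by end_near. Qed.

Let sol_fix t : sol t = Pic sol t.
Proof.
apply/eqP; rewrite -subr_eq0 -normr_eq0 eq_le normr_ge0 andbT.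
apply/ler_addgt0Pr => e e0; rewrite add0r.
have [K K0 H] := it_sol (normr_ge0 t).
have [n Hn] := small (K * expR (l * `|t|)) e0.
have tt := ler_norm t.
have A := H n.+1 t tt.
have Kn : 0 <= K * (1 / 2) ^+ n by rewrite mulr_ge0// exprn_ge0// divr_ge0.
have B := Pic_close (@it_cont n) sol_cont Kn (H n) tt.
rewrite -[Pic (it n) t]/(it n.+1 t) in B; rewrite distrC in A.
rewrite (_ : sol t - _ = (sol t - it n.+1 t) + (it n.+1 t - Pic sol t)); last ring.
rewrite (le_trans (ler_normD _ _))//.
apply: le_trans (lerD A B) _; rewrite exprS; apply: le_trans (ltW Hn).
by rewrite le_eqVlt; apply/orP; left; apply/eqP; field.
Qed.

Lemma picard : exists2 sg : R -> R, continuous sg & forall t,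
  sg t = F (x0 + prim (fun s => (sg s + w s) * k1 s) t)
           (y0 + prim (fun s => (sg s + w s) * k2 s) t) t.
Proof. by exists sol => // t; exact: sol_fix. Qed.

End Picard.

(** * The rotating orientation and the regularity of the speed *)

Section Solutions.
Context {R : realType}.
Notation mu := (@lebesgue_measure R).
Variables (psi : @pt R -> R) (Om alpha c c1 : R) (varpi : nat) (a : R).
Hypotheses (sm : smooth2 psi) (alpha_gt0 : 0 < alpha) (c_gt0 : 0 < c) (c1_gt0 : 0 < c1).
Hypothesis hessb : forall i j p, `|hessE psi i j p| <= c1.
Hypotheses (a_gt0 : 0 < a) (Om_gt0 : 0 < Om).
Implicit Types (o p q : @pt R) (s t : R).

Definition speed (x : @st R) : R :=
  alpha * c / 2 * dot (grad psi x.1) x.2 + a * phi_a psi alpha c varpi a x.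

Definition rot o t : @pt R :=
  (o.1 * cos (Om * t) - o.2 * sin (Om * t), o.2 * cos (Om * t) + o.1 * sin (Om * t)).

Lemma rot0 o : rot o 0 = o.
Proof. by rewrite /rot mulr0 cos0 sin0 !mulr1 !mulr0 subr0 addr0 -surjective_pairing. Qed.

Lemma rot_S1 o t : S1 o -> S1 (rot o t).
Proof.
move=> o1; rewrite /S1 /= -o1 /nrm; congr Num.sqrt; rewrite /dot /=.
have := cos2Dsin2 (Om * t); move: (cos _) (sin _) => C S CS.
transitivity ((o.1 * o.1 + o.2 * o.2) * (C ^+ 2 + S ^+ 2)); first ring.
by rewrite CS mulr1.
Qed.

Lemma is_derive_cosM t : is_derive t 1 (fun t => cos (Om * t)) (- Om * sin (Om * t)).
Proof.
have H1 : is_derive t 1 (fun t => Om * t) Om by apply: is_derive_eq; rewrite /GRing.scale/= mulr1.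
have H2 := is_derive1_comp (is_derive_cos (Om * t)) H1.
by apply: (is_derive_eq H2); ring.
Qed.

Lemma is_derive_sinM t : is_derive t 1 (fun t => sin (Om * t)) (Om * cos (Om * t)).
Proof.
have H1 : is_derive t 1 (fun t => Om * t) Om by apply: is_derive_eq; rewrite /GRing.scale/= mulr1.
have H2 := is_derive1_comp (is_derive_sin (Om * t)) H1.
by apply: (is_derive_eq H2); ring.
Qed.

Lemma is_derive_rot o t : is_derive t 1 (fun t => (rot o t).1) (Om * - (rot o t).2) /\
  is_derive t 1 (fun t => (rot o t).2) (Om * (rot o t).1).
Proof.
have C := is_derive_cosM t; have S := is_derive_sinM t.
split.
  have H := is_deriveB (is_deriveZ o.1 C) (is_deriveZ o.2 S).
  by apply: (is_derive_eq H); rewrite /rot /= /GRing.scale/=; ring.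
have H := is_deriveD (is_deriveZ o.2 C) (is_deriveZ o.1 S).
by apply: (is_derive_eq H); rewrite /rot /= /GRing.scale/=; ring.
Qed.

Lemma continuous_rot o : continuous (fun t => (rot o t).1) /\ continuous (fun t => (rot o t).2).
Proof.
split => t; apply: differentiable_continuous; apply/derivable1_diffP.
  by have [[H1 _] _] := is_derive_rot o t; exact: H1.
by have [_ [H2 _]] := is_derive_rot o t; exact: H2.
Qed.

Lemma rot_prim o t : 0 <= t -> (rot o t).1 = o.1 + prim (fun s => Om * - (rot o s).2) t /\
  (rot o t).2 = o.2 + prim (fun s => Om * (rot o s).1) t.
Proof.
rewrite le_eqVlt => /predU1P[<-|t0]; first by rewrite !prim_le0// rot0 !addr0.
have [c1' c2'] := continuous_rot o.
split; rewrite /prim.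
  rewrite (Rint_FTC2 t0 _ (fun s => (is_derive_rot o s).1)) ?rot0 ?subrKC//.
  by move=> s; apply: cvgM; [exact: cvg_cst|apply: cvgN; exact: c2'].
rewrite (Rint_FTC2 t0 _ (fun s => (is_derive_rot o s).2)) ?rot0 ?subrKC//.
by move=> s; apply: cvgM; [exact: cvg_cst|exact: c1'].
Qed.

(** The factor [a] in front of [phi] cancels the [1 / a] of [phi_lip_p]. The constant is valid on
    the whole plane, which excludes blow-up in finite time. *)
Lemma speed_lip o p q : S1 o -> `|speed (p, o) - speed (q, o)| <=
  (alpha * c / 2 * (2 * c1) + c * (4 * c1 * alpha)) * nrm (psub p q).
Proof.
move=> o1; have H1 := phi_lip_p sm varpi alpha_gt0 c_gt0 a_gt0 c1_gt0 hessb p q o1.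
have H2 := grad_lip sm hessb q (psub p q) o.
rewrite padd_psub o1 mul1r in H2.
rewrite /speed /=.
have S (u v A B C D : R) : u * A + v * B - (u * C + v * D) = u * (A - C) + v * (B - D) by ring.
have : 0 < alpha * c / 2 by rewrite divr_gt0// mulr_gt0.
move: (alpha * c / 2) => k k0; rewrite S.
rewrite (le_trans (ler_normD _ _))// !normrM (gtr0_norm a_gt0) (gtr0_norm k0).
rewrite mulrDl lerD//; first by rewrite -mulrA ler_wpM2l// ltW.
have -> : c * (4 * c1 * alpha) * nrm (psub p q) = a * (c * (4 * c1 * alpha / a * nrm (psub p q))).
  by field; rewrite gt_eqF.
by rewrite ler_wpM2l// ltW.
Qed.

Lemma phi_continuous (x y : R -> R) (r : R -> @pt R) : continuous x -> continuous y ->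
  continuous (fun t => (r t).1) -> continuous (fun t => (r t).2) -> (forall t, S1 (r t)) ->
  continuous (fun t => phi_a psi alpha c varpi a ((x t, y t), r t)).
Proof.
move=> xc yc r1c r2c rS t; apply/cvgrPdist_le => e e0.
pose K1 := c * (4 * c1 * alpha / a); pose K2 := c * (6 * c1 * alpha ^+ 2).
have K10 : 0 < K1 by rewrite mulr_gt0// divr_gt0// !mulr_gt0.
have K20 : 0 < K2 by rewrite !mulr_gt0// exprn_gt0.
pose K := 2 * (K1 + K2).
have K0 : 0 < K by rewrite mulr_gt0// addr_gt0.
have eK : 0 < e / K by rewrite divr_gt0.
near=> s.
have Hx : `|x t - x s| <= e / K by near: s; apply: cvgr_dist_le => //; exact: xc.
have Hy : `|y t - y s| <= e / K by near: s; apply: cvgr_dist_le => //; exact: yc.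
have H1 : `|(r t).1 - (r s).1| <= e / K by near: s; apply: cvgr_dist_le => //; exact: r1c.
have H2 : `|(r t).2 - (r s).2| <= e / K by near: s; apply: cvgr_dist_le => //; exact: r2c.
have A := phi_lip_p sm varpi alpha_gt0 c_gt0 a_gt0 c1_gt0 hessb (x t, y t) (x s, y s) (rS t).
have B := phi_lip_o sm varpi alpha_gt0 c_gt0 a_gt0 c1_gt0 hessb (x s, y s) (rS t) (rS s).
have nA := nrm_le_add (psub (x t, y t) (x s, y s)).
have nB := nrm_le_add (psub (r t) (r s)).
rewrite /= in nA nB.
have {}nA : nrm (psub (x t, y t) (x s, y s)) <= 2 * (e / K) by lra.
have {}nB : nrm (psub (r t) (r s)) <= 2 * (e / K) by lra.
rewrite mulrA -/K1 in A; rewrite mulrA -/K2 in B.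
have {}A := le_trans A (ler_wpM2l (ltW K10) nA).
have {}B := le_trans B (ler_wpM2l (ltW K20) nB).
rewrite -(subrKA (phi_a psi alpha c varpi a ((x s, y s), r t))) (le_trans (ler_normD _ _))//.
apply: le_trans (lerD A B) _.
have E X : K1 * (2 * X) + K2 * (2 * X) = K * X by rewrite /K; ring.
by rewrite E mulrCA divff ?mulr1// gt_eqF.
Unshelve. all: by end_near. Qed.

Lemma speed_continuous (x y : R -> R) (r : R -> @pt R) : continuous x -> continuous y ->
  continuous (fun t => (r t).1) -> continuous (fun t => (r t).2) -> (forall t, S1 (r t)) ->
  continuous (fun t => speed ((x t, y t), r t)).
Proof.
move=> xc yc r1c r2c rS t; apply: cvgD.
  apply: cvgM; first exact: cvg_cst.
  have G i : continuous (fun t => pd i (curry2 psi) (x t) (y t)).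
    move=> s; apply: (@continuous_comp _ _ _ (fun t => (x t, y t))
      (fun p : @pt R => pd i (curry2 psi) p.1 p.2)); last exact: (continuous_pd sm).
    exact: (cvg_pair (xc s) (yc s)).
  by apply: cvgD; apply: cvgM; (try exact: G); [exact: r1c|exact: r2c].
by apply: cvgM; [exact: cvg_cst|exact: phi_continuous].
Qed.

Notation fld := (field psi Om alpha c varpi a).

(** The orientation obeys a linear equation that involves neither position nor input, so Gronwall
    identifies it with the rotation. What remains is a planar equation along a known moving
    direction. *)
Lemma sol_orientation (w : R -> R) (T : \bar R) x : is_sol fld w T x ->
  forall t, 0 <= t -> (t%:E < T)%E -> (x t).2 = rot (x 0).2 t.
Proof.
move=> [_ sol] t t0 tT; set o := (x 0).2.
have [rc1 rc2] := continuous_rot o.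
have [_ _ [i1 _] [i2 _]] := sol t t0 tT.
pose g1 s := Om * - (x s).2.2; pose g2 s := Om * (x s).2.1.
pose h1 s := Om * - (rot o s).2; pose h2 s := Om * (rot o s).1.
have ih1 : mu.-integrable `[0, t] (EFin \o h1).
  by apply: continuous_integrable => s; apply: cvgM; [exact: cvg_cst|apply: cvgN; exact: rc2].
have ih2 : mu.-integrable `[0, t] (EFin \o h2).
  by apply: continuous_integrable => s; apply: cvgM; [exact: cvg_cst|exact: rc1].
have sub s : s <= t -> `[0, s]%classic `<=` `[0, t]%classic.
  by move=> st; apply: subset_itvl; rewrite bnd_simp.
have [E1 E2] : (x t).2.1 - (rot o t).1 = 0 /\ (x t).2.2 - (rot o t).2 = 0.
  apply: (@gronwall_pair _ (fun s => (x s).2.1 - (rot o s).1) (fun s => (x s).2.2 - (rot o s).2)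
    (fun s => g1 s - h1 s) (fun s => g2 s - h2 s) Om t (ltW Om_gt0)) => //.
  - exact: (@integrableB _ _ _ mu _ _ _ _ i1 ih1).
  - exact: (@integrableB _ _ _ mu _ _ _ _ i2 ih2).
  - move=> s /andP[s0 st].
    have sT : (s%:E < T)%E by apply: le_lt_trans tT; rewrite lee_fin.
    have [_ _ [j1 e1] [j2 e2]] := sol s s0 sT.
    have [r1 r2] := rot_prim o s0.
    have jh1 : mu.-integrable `[0, s] (EFin \o h1) by apply: integrableS ih1 => //; exact: sub.
    have jh2 : mu.-integrable `[0, s] (EFin \o h2) by apply: integrableS ih2 => //; exact: sub.
    rewrite e1 e2 r1 r2 /prim !RintegralB//.
    by split; rewrite opprD addrACA subrr add0r.
  - move=> s _; rewrite /g1 /h1 /g2 /h2.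
    have -> : Om * - (x s).2.2 - Om * - (rot o s).2 = - (Om * ((x s).2.2 - (rot o s).2)) by ring.
    rewrite normrN -mulrBr !normrM (gtr0_norm Om_gt0).
    by split; rewrite ler_wpM2l ?(ltW Om_gt0)// ?lerDl ?lerDr.
by rewrite [LHS]surjective_pairing [RHS]surjective_pairing; congr pair; apply/eqP; rewrite -subr_eq0 ?E1 ?E2.
Qed.

End Solutions.

(** * Maximal solutions are global Picard trajectories *)

Section MaximalSolutions.
Context {R : realType}.
Notation mu := (@lebesgue_measure R).
Variables (psi : @pt R -> R) (Om alpha c c1 : R) (varpi : nat) (a : R).
Hypotheses (sm : smooth2 psi) (alpha_gt0 : 0 < alpha) (c_gt0 : 0 < c) (c1_gt0 : 0 < c1).
Hypothesis hessb : forall i j p, `|hessE psi i j p| <= c1.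
Hypotheses (a_gt0 : 0 < a) (Om_gt0 : 0 < Om).
Implicit Types (o p q : @pt R) (s t : R).
Notation fld := (field psi Om alpha c varpi a).
Notation speed := (speed psi alpha c varpi a).
Notation rot := (rot Om).
Variable w : R -> R.

Lemma Linf_loc_bounded : Linf_loc w -> loc_bounded w.
Proof.
move=> [mw bw]; split => // b; have [M HM] := bw b; exists (Num.max M 0).
  by rewrite le_max lexx orbT.
apply: (@ae_imply _ _ _ HM) => x Hx /andP[x0 xb]; rewrite le_max Hx// /= in_itv /= xb andbT.
by rewrite (le_trans _ x0)// oppr_le0 (le_trans x0).
Qed.

Definition traj (x0 o : @pt R) (sg : R -> R) t : @st R :=
  ((x0.1 + prim (fun s => (sg s + w s) * (rot o s).1) t,
    x0.2 + prim (fun s => (sg s + w s) * (rot o s).2) t), rot o t).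

Hypothesis wb : loc_bounded w.

Lemma traj0 x0 o sg : traj x0 o sg 0 = (x0, o).
Proof. by rewrite /traj !prim_le0// !addr0 rot0 -surjective_pairing. Qed.

Lemma traj_exists x0 o : S1 o -> exists2 sg : R -> R, continuous sg &
  forall t, sg t = speed (traj x0 o sg t).
Proof.
move=> o1; have [r1c r2c] := continuous_rot Om o.
pose K := alpha * c / 2 * (2 * c1) + c * (4 * c1 * alpha).
have K0 : 0 < K by rewrite addr_gt0// ?mulr_gt0// ?divr_gt0// !mulr_gt0.
apply: (@picard _ (fun x y t => speed ((x, y), rot o t)) K
  (fun t => (rot o t).1) (fun t => (rot o t).2) w x0.1 x0.2) => //.
- by move=> t; have [] := S1_le (rot_S1 Om t o1).
- by move=> t; have [] := S1_le (rot_S1 Om t o1).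
- move=> x y x' y' t.
  apply: le_trans (speed_lip varpi sm alpha_gt0 c_gt0 c1_gt0 hessb a_gt0 _ _ (rot_S1 Om t o1)) _.
  by rewrite ler_wpM2l ?(ltW K0)//; exact: (nrm_le_add (psub (x, y) (x', y'))).
- move=> x y xc yc; have rS t : S1 (rot o t) by exact: rot_S1.
  exact: (speed_continuous sm alpha_gt0 c_gt0 c1_gt0 hessb a_gt0 xc yc r1c r2c rS).
Qed.

Lemma loc_bounded_rot sg o : continuous sg ->
  loc_bounded (fun s => (sg s + w s) * (rot o s).1) /\
  loc_bounded (fun s => (sg s + w s) * (rot o s).2).
Proof.
move=> sc; have [r1c r2c] := continuous_rot Om o.
by split; apply: loc_bounded_speed.
Qed.

Lemma traj_sol x0 o sg : S1 o -> continuous sg -> (forall t, sg t = speed (traj x0 o sg t)) ->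
  is_sol fld w +oo%E (traj x0 o sg).
Proof.
move=> o1 sc sE; split; first by rewrite traj0.
have [r1c r2c] := continuous_rot Om o.
have [lb1 lb2] := loc_bounded_rot o sc.
move=> t t0 _.
have f1 : (fun s => (fld (traj x0 o sg s) (w s)).1.1) = (fun s => (sg s + w s) * (rot o s).1).
  by apply/funext => s; rewrite [in RHS]sE.
have f2 : (fun s => (fld (traj x0 o sg s) (w s)).1.2) = (fun s => (sg s + w s) * (rot o s).2).
  by apply/funext => s; rewrite [in RHS]sE.
have [e1 e2] := rot_prim Om o t0.
split; split; rewrite ?f1 ?f2.
- exact: loc_bounded_integrable.
- by rewrite traj0.
- exact: loc_bounded_integrable.
- by rewrite traj0.
- by apply: continuous_integrable => s; apply: cvgM; [exact: cvg_cst|apply: cvgN; exact: r2c].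
- by rewrite traj0 /=.
- by apply: continuous_integrable => s; apply: cvgM; [exact: cvg_cst|exact: r1c].
- by rewrite traj0 /=.
Qed.

Lemma traj_unique (T : \bar R) x sg : is_sol fld w T x -> continuous sg ->
  (forall t, sg t = speed (traj (x 0).1 (x 0).2 sg t)) ->
  forall t, 0 <= t -> (t%:E < T)%E -> x t = traj (x 0).1 (x 0).2 sg t.
Proof.
move=> xsol sc sE t t0 tT.
have xo := sol_orientation Om_gt0 xsol.
have [xX sol] := xsol.
set x0 := (x 0).1; set o := (x 0).2; set y := traj x0 o sg.
have [i1 _] := let: And4 h _ _ _ := sol t t0 tT in h.
have [i2 _] := let: And4 _ h _ _ := sol t t0 tT in h.
have [lb1 lb2] := loc_bounded_rot o sc.
have ib1 := loc_bounded_integrable t lb1; have ib2 := loc_bounded_integrable t lb2.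
have sub s : s <= t -> `[0, s]%classic `<=` `[0, t]%classic.
  by move=> st; apply: subset_itvl; rewrite bnd_simp.
pose K := alpha * c / 2 * (2 * c1) + c * (4 * c1 * alpha).
have K0 : 0 < K by rewrite addr_gt0// ?mulr_gt0// ?divr_gt0// !mulr_gt0.
have ltT s : s <= t -> (s%:E < T)%E.
  by move=> st; apply: le_lt_trans tT; rewrite lee_fin.
have [E1 E2] : (x t).1.1 - (y t).1.1 = 0 /\ (x t).1.2 - (y t).1.2 = 0.
  apply: (@gronwall_pair _ (fun s => (x s).1.1 - (y s).1.1) (fun s => (x s).1.2 - (y s).1.2)
    (fun s => (fld (x s) (w s)).1.1 - (sg s + w s) * (rot o s).1)
    (fun s => (fld (x s) (w s)).1.2 - (sg s + w s) * (rot o s).2) K t (ltW K0)) => //.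
  - exact: (@integrableB _ _ _ mu _ _ _ _ i1 ib1).
  - exact: (@integrableB _ _ _ mu _ _ _ _ i2 ib2).
  - move=> s /andP[s0 st].
    have [[j1 e1] [j2 e2] _ _] := sol s s0 (ltT s st).
    have jb1 := loc_bounded_integrable s lb1; have jb2 := loc_bounded_integrable s lb2.
    rewrite e1 e2 /prim !RintegralB//.
    by split; rewrite /y /traj /= opprD addrACA subrr add0r.
  - move=> s /andP[s0 st].
    have rS := rot_S1 Om s xX; have [n1 n2] := S1_le rS.
    have H := speed_lip varpi sm alpha_gt0 c_gt0 c1_gt0 hessb a_gt0 (x s).1 (y s).1 rS.
    have {}H : `|speed ((x s).1, rot o s) - speed ((y s).1, rot o s)| <=
        K * (`|(x s).1.1 - (y s).1.1| + `|(x s).1.2 - (y s).1.2|).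
      apply: le_trans H _; rewrite ler_wpM2l ?(ltW K0)//.
      exact: (nrm_le_add (psub (x s).1 (y s).1)).
    have xs : x s = ((x s).1, rot o s).
      by rewrite [LHS]surjective_pairing; congr pair; apply: xo => //; exact: ltT.
    have fx : fld (x s) (w s) = (pscal (speed ((x s).1, rot o s) + w s) (rot o s), pscal Om (perp (rot o s))).
      by rewrite {1}xs.
    have ys : sg s = speed ((y s).1, rot o s) by rewrite sE.
    move: (speed ((x s).1, rot o s)) (speed ((y s).1, rot o s)) H fx ys => A B H fx ys.
    (* The input enters additively along the same direction and drops out of the difference, leaving
       the Lipschitz speed. *)
    have S (C D : R) : (A + C) * D - (B + C) * D = (A - B) * D by ring.
    rewrite fx ys /= !S !normrM.
    by split; apply: le_trans H; rewrite ler_piMr.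
rewrite [LHS]surjective_pairing xo// /y /traj; congr pair.
by rewrite [LHS]surjective_pairing; congr pair; apply/eqP; rewrite -subr_eq0 ?E1 ?E2.
Qed.

(** The Picard trajectory is global and, by uniqueness, agrees with [x] on [[0, T)]. A finite [T]
    would make it a proper extension, against maximality. *)
Lemma maximal_traj (T : \bar R) x : maximal_sol fld w T x -> T = +oo%E /\
  exists sg : R -> R, [/\ continuous sg, (forall t, sg t = speed (traj (x 0).1 (x 0).2 sg t)) &
   forall t, 0 <= t -> x t = traj (x 0).1 (x 0).2 sg t].
Proof.
move=> [T0 [xsol Tmax]]; have [xX _] := xsol.
have [sg sc sE] := traj_exists (x 0).1 xX.
have xE := traj_unique xsol sc sE.
have TE : T = +oo%E.
  apply/eqP; rewrite -leye_eq leNgt; apply/negP => Ty.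
  apply: (Tmax _ _ Ty (traj_sol xX sc sE)) => t t0 tT.
  exact/esym/xE.
split => //; exists sg; split => // t t0.
by apply: xE => //; rewrite TE ltry.
Qed.

End MaximalSolutions.

(** * The Lyapunov function *)

Section Lyapunov.
Context {R : realType}.
Notation mu := (@lebesgue_measure R).
Implicit Types (s t h : R).

Lemma expn_derive (D : R -> R) (f : R -> R) t l : is_derive t 1 f l ->
  expn D (fun h => f (t + h)) (f t) l 0.
Proof.
move=> fd e e0; have [d d0 H] := is_derive_eps fd e0; exists d => // h /andP[h0 hd].
by have := H h; rewrite gtr0_norm// => /(_ hd); rewrite mul0r subr0.
Qed.

Section PrimExpansion.
Variables (w : R -> R) (t m h0 : R).
Hypotheses (wb : loc_bounded w) (t_ge0 : 0 <= t) (m_ge0 : 0 <= m) (h0_gt0 : 0 < h0).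
Hypothesis w_le : {ae mu, forall x, 0 <= x <= t + h0 -> `|w x| <= m}.

Definition input_increment h := \int[mu]_(x in `[t, t + h]) w x.

Lemma integrable_increment f h : loc_bounded f ->
  mu.-integrable `[t, t + h] (EFin \o f).
Proof.
move=> fb; have fi := loc_bounded_integrable (t + h) fb; apply: integrableS fi => //.
by apply: subset_itvr; rewrite bnd_simp.
Qed.

Lemma input_increment_le h : 0 < h < h0 -> `|input_increment h| <= m * h.
Proof.
move=> /andP[h1 h2]; rewrite -[X in _ <= _ * X](addKr t) (addrC (- t)).
apply: normr_Rint_ae_le; first by rewrite lerDl ltW.
  exact: integrable_increment.
apply: (ae_imply w_le) => x Hx /andP[tx xt]; apply: Hx.
by rewrite (le_trans t_ge0 tx) (le_trans xt)// lerD2l ltW.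
Qed.

(** Only the continuous factors are frozen at time [t]; [w] stays under the integral and contributes
    through [input_increment]. The error is the oscillation of [sg * k] plus [w] times the
    oscillation of [k]. *)
Lemma expn_prim (x0 : R) (sg k : R -> R) : continuous sg -> continuous k ->
  expn input_increment (fun h => x0 + prim (fun s => (sg s + w s) * k s) (t + h))
    (x0 + prim (fun s => (sg s + w s) * k s) t) (sg t * k t) (k t).
Proof.
move=> sc kc e e0.
have lb := loc_bounded_speed wb kc sc.
pose e1 := e / (2 * (m + 1)).
have m1 : 0 < m + 1 by rewrite ltr_wpDl.
have e10 : 0 < e1 by rewrite divr_gt0 ?mulr_gt0.
have e1m : m * e1 <= e / 2.
  have -> : e / 2 = (m + 1) * e1 by rewrite /e1; field; rewrite gt_eqF.
  by rewrite ler_wpM2r ?(ltW e10)// lerDl.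
have e2 : 0 < e / 2 by rewrite divr_gt0.
have skc : continuous (fun s => sg s * k s) by move=> s; apply: cvgM; [exact: sc|exact: kc].
have tI : t <= t <= t + 1 by rewrite lexx lerDl ler01.
have [d1 d10 H1] := cont_on_continuous skc tI e2.
have [d2 d20 H2] := cont_on_continuous kc tI e10.
exists (Num.min (Num.min d1 d2) (Num.min h0 1)) => [|h].
  by rewrite !lt_min d10 d20 h0_gt0 ltr01.
rewrite !lt_min => /andP[h1 /andP[/andP[hd1 hd2] /andP[hh0 hh1]]].
have th : t <= t + h by rewrite lerDl ltW.
have lw : loc_bounded (fun s => w s * k t + sg t * k t).
  apply: loc_boundedD; last exact/loc_bounded_continuous/cst_continuous.
  by apply: loc_boundedM => //; exact/loc_bounded_continuous/cst_continuous.
have lw1 : loc_bounded (fun s => w s * k t).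
  by apply: loc_boundedM => //; exact/loc_bounded_continuous/cst_continuous.
have -> : x0 + prim (fun s => (sg s + w s) * k s) (t + h) -
    (x0 + prim (fun s => (sg s + w s) * k s) t) - sg t * k t * h - k t * input_increment h =
    \int[mu]_(s in `[t, t + h]) ((sg s + w s) * k s - (w s * k t + sg t * k t)).
  rewrite RintegralB//; try exact: integrable_increment.
  rewrite RintegralD//; try exact: integrable_increment; last first.
    exact/integrable_increment/loc_bounded_continuous/cst_continuous.
  rewrite RintegralZr//; last exact: integrable_increment.
  rewrite (prim_add lb t_ge0 th) Rintegral_cst//= lebesgue_measure_itv/= lte_fin ltrDl h1 /=.
  by rewrite /input_increment (addrC t h) addrK; ring.
have -> : e * h = e * (t + h - t) by rewrite (addrC t) addrK.
apply: normr_Rint_ae_le => //.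
  exact: (@integrableB _ _ _ mu _ _ _ _ (integrable_increment h lb) (integrable_increment h lw)).
apply: (ae_imply w_le) => x Hx /andP[tx xt].
have xI : t <= x <= t + 1 by rewrite tx (le_trans xt)// lerD2l ltW.
have xt' : `|x - t| <= h by rewrite ger0_norm ?subr_ge0// lerBlDl.
have {}H1 := H1 x xI (le_lt_trans xt' hd1); have {}H2 := H2 x xI (le_lt_trans xt' hd2).
have {}Hx : `|w x| <= m by apply: Hx; rewrite (le_trans t_ge0 tx) (le_trans xt)// lerD2l ltW.
have -> : (sg x + w x) * k x - (w x * k t + sg t * k t) =
  (sg x * k x - sg t * k t) + w x * (k x - k t) by ring.
rewrite (le_trans (ler_normD _ _))// normrM.
have := ler_pM (normr_ge0 _) (normr_ge0 _) Hx (ltW H2); lra.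
Qed.

End PrimExpansion.

(** [f] is the speed, [G] the slope of [psi] along [o], [r] that of [quad], [B] the coefficient of
    the input. Budget in units of [eps * n ^+ 2]: the correction gives [- 1/2]; the cross term
    [k * G * r] costs [1/8] plus a multiple of [G ^+ 2], absorbed by [- k * G ^+ 2] through the
    first smallness condition; the averaged remainder costs [2 * th <= eps / 8]. This leaves
    [- 1/4]. *)
Lemma lyapunov_decrease (k eps C1 th m n G f r B g2 : R) :
  0 < k -> 0 < eps -> 0 <= C1 -> 0 <= th -> 0 <= m -> 0 <= n ->
  eps * (1 + 2 * C1 ^+ 2 * k ^+ 2) <= k -> eps * C1 <= 1 -> 16 * th <= eps ->
  `|G| <= n -> `|f - k * G| <= th * n -> `|r| <= C1 * n -> g2 = n ^+ 2 ->
  B = - G + eps * r ->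
  - (f * G) + eps * (G ^+ 2 - g2 / 2 + f * r) + `|B| * m <= - (eps / 4) * n ^+ 2 + 2 * m * n.
Proof.
move=> k0 e0 C0 th0 m0 n0 ek eC the Gn fG rC -> ->.
set e := f - k * G in fG.
have fE : f = k * G + e by rewrite /e; ring.
have H1 : - (e * G) <= th * n * n.
  by rewrite (le_trans (ler_norm _))// normrN normrM ler_pM.
have H2 : e * r <= th * n * (C1 * n).
  by rewrite (le_trans (ler_norm _))// normrM ler_pM.
have H3 : k * G * r <= n ^+ 2 / 8 + 2 * (C1 ^+ 2 * k ^+ 2) * G ^+ 2.
  have A : k * G * r <= k * `|G| * (C1 * n).
    by rewrite (le_trans (ler_norm _))// !normrM (gtr0_norm k0) ler_pM// mulr_ge0// ltW.
  apply: le_trans A _; rewrite -[G ^+ 2]real_normK ?num_real//.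
  have := sqr_ge0 (n - 4 * (C1 * k * `|G|)); lra.
have H4 : `|- G + eps * r| <= 2 * n.
  rewrite (le_trans (ler_normD _ _))// normrN normrM (gtr0_norm e0).
  have : eps * `|r| <= eps * (C1 * n) by rewrite ler_wpM2l// ltW.
  have := ler_wpM2r n0 eC; lra.
have H5 := ler_wpM2r m0 H4.
have H6 := ler_wpM2l (ltW e0) H2; have H7 := ler_wpM2l (ltW e0) H3.
have tn : 0 <= th * n ^+ 2 by rewrite mulr_ge0// sqr_ge0.
have H8 := ler_wpM2r tn eC.
have H9 := ler_wpM2r (sqr_ge0 n) the.
have H10 := ler_wpM2r (sqr_ge0 G) ek.
rewrite fE; lra.
Qed.

End Lyapunov.

(** * The corrected Lyapunov function and its decrease *)

Section LyapunovFunction.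
Context {R : realType}.
Notation mu := (@lebesgue_measure R).
Implicit Types (p o : @pt R) (s t h : R).

(** The form [<M(o) g, g>]: in the angle chart [2 * o.1 * o.2] is [sin 2 theta] and
    [o.1 ^+ 2 - o.2 ^+ 2] is [cos 2 theta]. The factors [- 1] follow the shape that sums and
    multiples of expansions produce. *)
Definition quad (Om : R) (g o : @pt R) : R :=
  (4 * Om)^-1 * (2 * (o.1 * o.2) * (g.1 * g.1 + - 1 * (g.2 * g.2)) +
     - 2 * ((o.1 * o.1 + - 1 * (o.2 * o.2)) * (g.1 * g.2))).

(** This is [2 <M(o) g, b>], the derivative of [quad] when the gradient variable moves in direction
    [b]. *)
Definition quad_slope (Om : R) (g o b : @pt R) : R :=
  (4 * Om)^-1 * (2 * (o.1 * o.2) * (2 * (g.1 * b.1 - g.2 * b.2))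
     - 2 * (o.1 ^+ 2 - o.2 ^+ 2) * (b.1 * g.2 + g.1 * b.2)).

Lemma S1_coef_le o : S1 o -> `|2 * (o.1 * o.2)| <= 1 /\ `|o.1 ^+ 2 - o.2 ^+ 2| <= 1.
Proof.
move=> /S1E E; have := sqr_ge0 (o.1 - o.2); have := sqr_ge0 (o.1 + o.2).
have := sqr_ge0 o.1; have := sqr_ge0 o.2; rewrite sqrrB sqrrD => *.
by split; rewrite ler_norml; apply/andP; split; lra.
Qed.

Lemma quad_le Om (g o : @pt R) : 0 < Om -> S1 o -> `|quad Om g o| <= nrm g ^+ 2 / (2 * Om).
Proof.
move=> Om0 o1; have [S C] := S1_coef_le o1.
have -> : quad Om g o = (4 * Om)^-1 * (2 * (o.1 * o.2) * (g.1 ^+ 2 - g.2 ^+ 2) -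
  2 * ((o.1 ^+ 2 - o.2 ^+ 2) * (g.1 * g.2))) by rewrite /quad; ring.
have -> : nrm g ^+ 2 / (2 * Om) = (4 * Om)^-1 * (2 * nrm g ^+ 2) by field; rewrite gt_eqF.
rewrite normrM gtr0_norm ?invr_gt0 ?mulr_gt0// ler_wpM2l ?invr_ge0 ?mulr_ge0 ?(ltW Om0)//.
have H1 : `|g.1 ^+ 2 - g.2 ^+ 2| <= nrm g ^+ 2.
  rewrite nrm_sumsq ler_norml; have := sqr_ge0 g.1; have := sqr_ge0 g.2 => *.
  by apply/andP; split; lra.
have H2 : `|g.1 * g.2| <= nrm g ^+ 2 / 2 by rewrite nrm_sumsq normrM_le_sumsq.
have P1 := ler_pM (normr_ge0 _) (normr_ge0 _) S H1; have P2 := ler_pM (normr_ge0 _) (normr_ge0 _) C H2.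
rewrite -normrM in P1; rewrite -normrM in P2.
rewrite (le_trans (ler_normB _ _))// (normrM 2 (_ * (g.1 * g.2))) (ger0_norm (_ : 0 <= 2))//; lra.
Qed.

Lemma quad_slope_le Om (g o b : @pt R) (K : R) : 0 < Om -> S1 o -> `|b.1| <= K -> `|b.2| <= K ->
  `|quad_slope Om g o b| <= 2 * K / Om * nrm g.
Proof.
move=> Om0 o1 b1 b2; have [S C] := S1_coef_le o1.
have n1 := nrm1_le g; have n2 := nrm2_le g.
have -> : 2 * K / Om * nrm g = (4 * Om)^-1 * (8 * K * nrm g) by field; rewrite gt_eqF.
rewrite normrM gtr0_norm ?invr_gt0 ?mulr_gt0// ler_wpM2l ?invr_ge0 ?mulr_ge0 ?(ltW Om0)//.
have M (x y : R) : `|x| <= nrm g -> `|y| <= K -> `|x * y| <= nrm g * K.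
  by move=> xn yK; rewrite normrM ler_pM.
have A : `|2 * (g.1 * b.1 - g.2 * b.2)| <= 4 * (nrm g * K).
  rewrite normrM ger0_norm// -[4]/(2 * 2)%:R natrM -mulrA ler_wpM2l//.
  by rewrite (le_trans (ler_normB _ _))//; have := M _ _ n1 b1; have := M _ _ n2 b2; lra.
have B : `|b.1 * g.2 + g.1 * b.2| <= 2 * (nrm g * K).
  rewrite (le_trans (ler_normD _ _))// (mulrC b.1).
  by have := M _ _ n2 b1; have := M _ _ n1 b2; lra.
rewrite (le_trans (ler_normB _ _))// normrM [X in _ + X]normrM.
have C2 : `|2 * (o.1 ^+ 2 - o.2 ^+ 2)| <= 2 by rewrite normrM ger0_norm// -[leRHS]mulr1 ler_wpM2l.
have := ler_pM (normr_ge0 _) (normr_ge0 _) S A; have := ler_pM (normr_ge0 _) (normr_ge0 _) C2 B.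
lra.
Qed.

Section QuadExpansion.
Variables (D : R -> R) (m h0 : R).
Hypotheses (h0_gt0 : 0 < h0) (m_ge0 : 0 <= m) (D_le : forall h, 0 < h < h0 -> `|D h| <= m * h).

(** Rotation of [o] alone produces [dot g o ^+ 2 - dot g g / 2]; motion of the gradient produces the
    slope term, driven alike by the speed [f] and by the input. *)
Lemma expn_quad (Om f : R) (gy oy : R -> @pt R) (g o b : @pt R) : 0 < Om -> S1 o ->
  expn D (fun h => (gy h).1) g.1 (f * b.1) b.1 -> expn D (fun h => (gy h).2) g.2 (f * b.2) b.2 ->
  expn D (fun h => (oy h).1) o.1 (Om * - o.2) 0 -> expn D (fun h => (oy h).2) o.2 (Om * o.1) 0 ->
  expn D (fun h => quad Om (gy h) (oy h)) (quad Om g o)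
    (dot g o ^+ 2 - dot g g / 2 + f * quad_slope Om g o b) (quad_slope Om g o b).
Proof.
move=> Om0 /S1E E G1 G2 O1 O2.
have EM := expnM h0_gt0 m_ge0 D_le; have EZ := expnZ h0_gt0 m_ge0 D_le.
have gg := expnD (EM _ _ _ _ _ _ _ _ G1 G1) (EZ (-1) _ _ _ _ (EM _ _ _ _ _ _ _ _ G2 G2)).
have oo := expnD (EM _ _ _ _ _ _ _ _ O1 O1) (EZ (-1) _ _ _ _ (EM _ _ _ _ _ _ _ _ O2 O2)).
have H := EZ (4 * Om)^-1 _ _ _ _ (expnD
  (EM _ _ _ _ _ _ _ _ (EZ 2 _ _ _ _ (EM _ _ _ _ _ _ _ _ O1 O2)) gg)
  (EZ (-2) _ _ _ _ (EM _ _ _ _ _ _ _ _ oo (EM _ _ _ _ _ _ _ _ G1 G2)))).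
apply: expn_eq H _ _; last by rewrite /quad_slope; ring.
(* Inserting [|o|^2 = 1] makes the claim homogeneous in [o], hence a polynomial identity that no
   longer refers to the circle. *)
have -> : dot g g / 2 = dot g g / 2 * (o.1 ^+ 2 + o.2 ^+ 2) by rewrite E mulr1.
rewrite /quad_slope /dot; move: g o b {G1 G2 O1 O2 gg oo E}.
by move=> [g1 g2] [ o1 o2] [b1 b2] /=; field; rewrite gt_eqF.
Qed.

End QuadExpansion.

Variables (psi : @pt R -> R) (ps : @pt R) (Om alpha c c1 : R) (varpi : nat) (a eps : R).
Hypotheses (sm : smooth2 psi) (alpha_gt0 : 0 < alpha) (c_gt0 : 0 < c) (c1_gt0 : 0 < c1).
Hypothesis hessb : forall i j p, `|hessE psi i j p| <= c1.
Hypotheses (a_gt0 : 0 < a) (Om_gt0 : 0 < Om) (eps_gt0 : 0 < eps).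
Notation speed := (speed psi alpha c varpi a).

Definition lyap (x : @st R) : R := psi ps - psi x.1 + eps * quad Om (grad psi x.1) x.2.

Variables (w : R -> R) (wb : loc_bounded w) (x0 o : @pt R) (sg : R -> R).
Hypotheses (o1 : S1 o) (sgc : continuous sg).
Notation y := (traj Om w x0 o sg).
Hypothesis sgE : forall t, sg t = speed (y t).

Lemma continuous_traj : [/\ continuous (fun t => (y t).1.1), continuous (fun t => (y t).1.2),
  continuous (fun t => (y t).2.1) & continuous (fun t => (y t).2.2)].
Proof.
have [r1c r2c] := continuous_rot Om o; have [lb1 lb2] := loc_bounded_rot Om wb o sgc.
by split => // t; apply: cvgD; (try exact: cvg_cst); exact: continuous_prim.
Qed.

Lemma continuous_lyap : continuous (fun t => lyap (y t)).
Proof.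
have [x1c x2c r1c r2c] := continuous_traj.
have pc : forall t, (fun t => (y t).1) @ t --> (y t).1 by move=> t; exact: (cvg_pair (x1c t) (x2c t)).
have G i : continuous (fun t => pd i (curry2 psi) (y t).1.1 (y t).1.2).
  move=> s; apply: (@continuous_comp _ _ _ (fun t => (y t).1)
    (fun p : @pt R => pd i (curry2 psi) p.1 p.2)); last exact: (continuous_pd sm).
  exact: pc.
have M (u v : R -> R) : continuous u -> continuous v -> continuous (fun t => u t * v t).
  by move=> uc vc t; apply: cvgM; [exact: uc|exact: vc].
have A (u v : R -> R) : continuous u -> continuous v -> continuous (fun t => u t + v t).
  by move=> uc vc t; apply: cvgD; [exact: uc|exact: vc].
have K (k : R) : continuous (fun _ : R => k) by move=> t; exact: cvg_cst.
have P : continuous (fun t => psi (y t).1).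
  by move=> t; apply: (@continuous_comp _ _ _ (fun t => (y t).1) psi); [exact: pc|exact: continuous_psi].
apply: (A); first by move=> t; apply: cvgB; [exact: cvg_cst|exact: P].
apply: (M _ _ (K _)); apply: (M _ _ (K _)); apply: (A).
  apply: (M); first by apply: (M _ _ (K _)); apply: (M); [exact: r1c|exact: r2c].
  by apply: (A); [apply: (M); exact: (G false)|apply: (M _ _ (K _)); apply: (M); exact: (G true)].
apply: (M _ _ (K _)); apply: (M); last by apply: (M); [exact: (G false)|exact: (G true)].
by apply: (A); [apply: (M); exact: r1c|apply: (M _ _ (K _)); apply: (M); exact: r2c].
Qed.

Variables (m th : R).
Let C1 := 4 * c1 / Om.
Let k := alpha * c / 2.
Hypotheses (m_ge0 : 0 <= m) (th_ge0 : 0 <= th).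
Hypotheses (eps_k : eps * (1 + 2 * C1 ^+ 2 * k ^+ 2) <= k) (eps_C1 : eps * C1 <= 1).
Hypothesis th_eps : 16 * th <= eps.
Hypothesis phi_small : forall p o, S1 o ->
  a * `|phi_a psi alpha c varpi a (p, o)| <= th * nrm (grad psi p).

Lemma lyap_dini t h0 : 0 <= t -> 0 < h0 ->
  {ae mu, forall x, 0 <= x <= t + h0 -> `|w x| <= m} -> forall e, 0 < e ->
  exists2 d, 0 < d & forall h, 0 < h < d -> lyap (y (t + h)) <=
    lyap (y t) + h * (- (eps / 4) * nrm (grad psi (y t).1) ^+ 2
                      + 2 * m * nrm (grad psi (y t).1) + e).
Proof.
move=> t0 h00 wm e e0.
have [r1c r2c] := continuous_rot Om o.
set D := input_increment w t.
have D_le : forall h, 0 < h < h0 -> `|D h| <= m * h by move=> h; exact: (input_increment_le wb t0 wm).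
have EX := expn_prim wb t0 m_ge0 h00 wm x0.1 sgc r1c.
have EY := expn_prim wb t0 m_ge0 h00 wm x0.2 sgc r2c.
rewrite -/D in EX EY.
pose p := (y t).1; pose q := rot Om o t.
have qS : S1 q by exact: rot_S1.
have [Dr1 Dr2] := is_derive_rot Om o t.
have O1 := @expn_derive _ D _ _ _ Dr1; have O2 := @expn_derive _ D _ _ _ Dr2.
pose g := grad psi p.
(* Change of the gradient per unit displacement along [q]; since [hessE i j] is [pd i] of [pd j],
   the transpose of [hessv] appears. *)
pose b : @pt R := (hessE psi false false p * q.1 + hessE psi true false p * q.2,
  hessE psi false true p * q.1 + hessE psi true true p * q.2).
pose f := sg t.
have EG j := expn_C1 h00 m_ge0 D_le (pd_C1 sm j) EX EY.
have G1 : expn D (fun h => (grad psi (y (t + h)).1).1) g.1 (f * b.1) b.1.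
  apply: expn_eq (EG false) _ _; last by [].
  change (hessE psi false false p * (f * q.1) + hessE psi true false p * (f * q.2) =
    f * (hessE psi false false p * q.1 + hessE psi true false p * q.2)).
  by move: (hessE _ _ _ _) (hessE _ _ _ _) => A B; ring.
have G2 : expn D (fun h => (grad psi (y (t + h)).1).2) g.2 (f * b.2) b.2.
  apply: expn_eq (EG true) _ _; last by [].
  change (hessE psi false true p * (f * q.1) + hessE psi true true p * (f * q.2) =
    f * (hessE psi false true p * q.1 + hessE psi true true p * q.2)).
  by move: (hessE _ _ _ _) (hessE _ _ _ _) => A B; ring.
have EP : expn D (fun h => psi (y (t + h)).1) (psi p) (f * dot g q) (dot g q).
  apply: expn_eq (expn_C1 h00 m_ge0 D_le (psi_C1 sm) EX EY) _ _; last by [].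
  change (g.1 * (f * q.1) + g.2 * (f * q.2) = f * (g.1 * q.1 + g.2 * q.2)).
  by move: g.1 g.2 => A B; ring.
have EQ := expn_quad h00 m_ge0 D_le (gy := fun h => grad psi (y (t + h)).1)
  (oy := fun h => rot Om o (t + h)) Om_gt0 qS G1 G2 O1 O2.
set r := quad_slope Om g q b in EQ.
have EW : expn D (fun h => lyap (y (t + h))) (lyap (y t))
   (- (f * dot g q) + eps * (dot g q ^+ 2 - dot g g / 2 + f * r)) (- dot g q + eps * r).
  have ZP := expnZ h00 m_ge0 D_le (-1) EP; have ZQ := expnZ h00 m_ge0 D_le eps EQ.
  have H := expnD (expn_cst D (psi ps)) (expnD ZP ZQ).
  rewrite (_ : (fun h => lyap (y (t + h))) = (fun h => psi ps + (-1 * psi (y (t + h)).1 +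
    eps * quad Om (grad psi (y (t + h)).1) (rot Om o (t + h))))); last first.
    by apply/funext => h; rewrite /lyap mulN1r addrA.
  rewrite (_ : lyap (y t) = psi ps + (-1 * psi p + eps * quad Om g q)); last first.
    by rewrite /lyap mulN1r addrA.
  by apply: expn_eq H _ _; rewrite add0r mulN1r.
have [d d0 H] := expn_dini h00 D_le EW e0.
exists d => // h hd; apply: le_trans (H h hd) _.
have h1 : 0 <= h by case/andP: hd => /ltW.
rewrite lerD2l ler_wpM2l// lerD2r -/p -/g.
have b_le i j x y : `|x| <= 1 -> `|y| <= 1 -> `|hessE psi false i p * x + hessE psi true j p * y| <= 2 * c1.
  move=> x1 y1; rewrite (le_trans (ler_normD _ _))// !normrM.
  have := ler_pM (normr_ge0 _) (normr_ge0 _) (hessb false i p) x1.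
  have := ler_pM (normr_ge0 _) (normr_ge0 _) (hessb true j p) y1; lra.
have [q1 q2] := S1_le qS.
have rC : `|r| <= C1 * nrm g.
  have -> : C1 = 2 * (2 * c1) / Om by rewrite /C1; ring.
  by apply: quad_slope_le => //; exact: b_le.
have k0 : 0 < k by rewrite divr_gt0// mulr_gt0.
have C10 : 0 <= C1 by rewrite divr_ge0 ?(ltW Om_gt0)// mulr_ge0// ltW.
apply: (lyapunov_decrease k0 eps_gt0 C10 th_ge0 m_ge0 (nrm_ge0 g) eps_k eps_C1 th_eps _ _ rC) => //.
- by have := normr_dot g q; rewrite qS mulr1.
- rewrite /f sgE /speed -/p -/g -/q -/k addrC addKr normrM (gtr0_norm a_gt0).
  exact: phi_small.
- by rewrite sqr_nrm.
Qed.

End LyapunovFunction.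

Section DecayAlgebra.
Context {R : realType}.

Lemma decay_slope (eps c1 kk N U Z : R) : 0 < eps -> 0 < c1 -> 0 <= kk * U -> kk * U <= N ->
  Z <= 3 * c1 * U ^+ 2 -> - (eps / 8) * N ^+ 2 <= - (eps / (24 * c1) * kk ^+ 2) * Z.
Proof.
move=> e0 c0 kU0 kUN ZU; rewrite !mulNr lerN2.
have B2 : (kk * U) ^+ 2 <= N ^+ 2 by rewrite ler_sqr// nnegrE// (le_trans kU0).
have l0 : 0 <= eps / (24 * c1) * kk ^+ 2.
  by rewrite mulr_ge0 ?sqr_ge0// divr_ge0 ?(ltW e0)// mulr_ge0// ltW.
apply: le_trans (ler_wpM2l l0 ZU) _.
have -> : eps / (24 * c1) * kk ^+ 2 * (3 * c1 * U ^+ 2) = eps / 8 * (kk * U) ^+ 2.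
  by field; rewrite gt_eqF.
by rewrite ler_wpM2l// divr_ge0// ltW.
Qed.

(** Instead of the square root of [6 * c1 / kk] the factor [(1 + 6 * c1) / kk] is used, which
    dominates it because [kk <= 1]. As [Z] is quadratic in the distance, [ex] carries half of its
    decay rate. *)
Lemma decay_bound (c1 kk U0 U V Z ex : R) : 0 < c1 -> 0 < kk -> kk <= 1 -> 0 <= U0 -> 0 <= U -> 0 < ex ->
  kk * U ^+ 2 <= V -> V / 2 <= Z * ex ^+ 2 -> Z <= 3 * c1 * U0 ^+ 2 ->
  U <= U0 * ((1 + 6 * c1) / kk) * ex.
Proof.
move=> c0 k0 k1 U00 U0' ex0 B B2 B3.
have B4 : Z * ex ^+ 2 <= 3 * c1 * U0 ^+ 2 * ex ^+ 2 by rewrite ler_wpM2r// sqr_ge0.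
have K : kk * U ^+ 2 <= 6 * c1 * U0 ^+ 2 * ex ^+ 2 by lra.
have c60 : 0 <= 6 * c1 by rewrite mulr_ge0 ?ltW.
rewrite -ler_sqr ?nnegrE//; last first.
  by rewrite mulr_ge0 ?(ltW ex0)// mulr_ge0// divr_ge0 ?(ltW k0)// addr_ge0.
rewrite -(ler_pM2l k0); apply: le_trans K _.
have -> : kk * (U0 * ((1 + 6 * c1) / kk) * ex) ^+ 2 = (1 + 6 * c1) ^+ 2 / kk * (U0 * ex) ^+ 2.
  by field; rewrite gt_eqF.
have -> : 6 * c1 * U0 ^+ 2 * ex ^+ 2 = 6 * c1 * (U0 * ex) ^+ 2 by ring.
rewrite ler_wpM2r ?sqr_ge0// ler_pdivlMr//.
by have := ler_wpM2l c60 k1; have := sqr_ge0 (6 * c1); lra.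
Qed.

End DecayAlgebra.

(** * Exponential decay on a sublevel set *)

Section Decay.
Context {R : realType}.
Notation mu := (@lebesgue_measure R).
Implicit Types (p : @pt R) (s t h : R).

Variables (psi : @pt R -> R) (ps : @pt R) (Om alpha c c1 : R) (varpi : nat) (a eps : R).
Hypotheses (sm : smooth2 psi) (alpha_gt0 : 0 < alpha) (c_gt0 : 0 < c) (c1_gt0 : 0 < c1).
Hypothesis hessb : forall i j p, `|hessE psi i j p| <= c1.
Hypotheses (a_gt0 : 0 < a) (Om_gt0 : 0 < Om) (eps_gt0 : 0 < eps).
Hypothesis psmax : cond1 psi ps.
Hypothesis eps_Om : 8 * c1 * eps <= Om.
Notation speed := (speed psi alpha c varpi a).
Notation lyap := (lyap psi ps Om eps).
Notation n p := (nrm (grad psi p)).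
Notation u p := (nrm (psub p ps)).
Notation V p := (psi ps - psi p).

(** The smallness [8 * c1 * eps <= Om] is made for this bound. As [n^2] is at most [8 * c1] times
    the height below the maximum or above the infimum, the correction stays below half of either
    height. *)
Lemma quad_small p o : S1 o -> `|eps * quad Om (grad psi p) o| <= n p ^+ 2 / (16 * c1).
Proof.
move=> o1; rewrite normrM (gtr0_norm eps_gt0).
apply: le_trans (ler_wpM2l (ltW eps_gt0) (quad_le _ Om_gt0 o1)) _.
rewrite mulrA ler_pdivrMr ?mulr_gt0// mulrAC ler_pdivlMr ?mulr_gt0//.
have := ler_wpM2l (sqr_ge0 (n p)) eps_Om; lra.
Qed.

Lemma quad_small_max p o : S1 o -> `|eps * quad Om (grad psi p) o| <= V p / 2.
Proof.
move=> o1; apply: le_trans (quad_small p o1) _.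
rewrite ler_pdivrMr ?mulr_gt0//.
have := grad_sq_le_max sm c1_gt0 hessb (psi_le psmax) p; lra.
Qed.

Lemma lyap_ge p o : S1 o -> V p / 2 <= lyap (p, o).
Proof. by move=> o1; have /ler_normlP[+ _] := quad_small_max p o1; rewrite /lyap /=; lra. Qed.

Lemma lyap_le p o : S1 o -> lyap (p, o) <= 3 / 2 * V p.
Proof. by move=> o1; have /ler_normlP[_ +] := quad_small_max p o1; rewrite /lyap /=; lra. Qed.

Lemma lyap_le_dist p o : S1 o -> lyap (p, o) <= 3 * c1 * u p ^+ 2.
Proof.
move=> o1; apply: le_trans (lyap_le p o1) _.
by have := V_le sm c1_gt0 hessb psmax p; lra.
Qed.

Variables (w : R -> R) (wb : loc_bounded w) (x0 o : @pt R) (sg : R -> R).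
Hypotheses (o1 : S1 o) (sgc : continuous sg).
Notation y := (traj Om w x0 o sg).
Hypothesis sgE : forall t, sg t = speed (y t).
Variables (m th : R).
Let C1 := 4 * c1 / Om.
Let k := alpha * c / 2.
Hypotheses (m_ge0 : 0 <= m) (th_ge0 : 0 <= th).
Hypotheses (eps_k : eps * (1 + 2 * C1 ^+ 2 * k ^+ 2) <= k) (eps_C1 : eps * C1 <= 1).
Hypothesis th_eps : 16 * th <= eps.
Hypothesis phi_small : forall p o, S1 o ->
  a * `|phi_a psi alpha c varpi a (p, o)| <= th * nrm (grad psi p).
Hypothesis w_le : forall T : R, {ae mu, forall x, 0 <= x <= T -> `|w x| <= m}.

(** [kk] is a growth constant for the sublevel set of the initial state, [cc] a level under which
    the input may outweigh the decay, and [gam] a radius containing that residual set. *)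
Variables (kk cc gam : R).
Hypotheses (kk_gt0 : 0 < kk) (kk_le1 : kk <= 1).
Hypothesis trap : forall p o', S1 o' -> lyap (p, o') <= lyap (x0, o) ->
  kk * u p <= n p /\ kk * u p ^+ 2 <= V p.
Hypothesis small_le : forall p o', S1 o' -> n p <= 16 * m / eps -> lyap (p, o') <= cc.
Hypothesis level_le : forall p o', S1 o' -> lyap (p, o') <= cc -> u p <= gam.

Let z t := lyap (y t).
Let zc : continuous z. Proof. exact: continuous_lyap. Qed.

Let yS t : S1 (y t).2. Proof. exact: rot_S1. Qed.
Let yE t : y t = ((y t).1, (y t).2). Proof. by rewrite -surjective_pairing. Qed.

(** Above [cc] the gradient exceeds [16 * m / eps], so the input term [2 * m * n] uses at most half
    of the decay [eps / 4 * n ^+ 2]. *)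
Let z_dini t : 0 <= t -> cc < z t -> forall e : R, 0 < e -> exists2 d : R, 0 < d &
  forall h, 0 < h < d -> z (t + h) <= z t + h * (- (eps / 8) * n (y t).1 ^+ 2 + e).
Proof.
move=> t0 zt e e0.
have [d d0 H] := lyap_dini ps sm alpha_gt0 c_gt0 c1_gt0 hessb a_gt0 Om_gt0 eps_gt0 wb o1
  sgc sgE m_ge0 th_ge0 eps_k eps_C1 th_eps phi_small t0 ltr01 (w_le (t + 1)) e0.
exists d => // h hd; apply: le_trans (H h hd) _.
have h0 : 0 <= h by case/andP: hd => /ltW.
rewrite lerD2l ler_wpM2l// lerD2r.
have nm : 16 * m / eps < n (y t).1.
  rewrite ltNge; apply/negP => nm; have := small_le (yS t) nm.
  by rewrite -yE leNgt; move: zt; rewrite /z => ->.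
move: nm; rewrite ltr_pdivrMr// => nm.
have := ler_wpM2r (nrm_ge0 (grad psi (y t).1)) (ltW nm); lra.
Qed.

Let lam := eps / (24 * c1) * kk ^+ 2.

Lemma decay t : 0 <= t ->
  u (y t).1 <= u x0 * ((1 + 6 * c1) / kk) * expR (- (eps / (48 * c1) * kk ^+ 2 * t)) \/
  u (y t).1 <= gam.
Proof.
move=> t0; have [zt|zt] := leP (z t) cc.
  by right; apply: level_le (yS t) _; rewrite -yE.
left.
have y0 : y 0 = (x0, o) by rewrite traj0.
have z0E : z 0 = lyap (x0, o) by rewrite /z y0.
have slope0 s : - (eps / 8) * n (y s).1 ^+ 2 <= 0.
  by rewrite mulNr oppr_le0 mulr_ge0 ?sqr_ge0// divr_ge0// ltW.
(* The level [cc] cannot be crossed upwards, so the decrease was active during all of [[0, t]]. *)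
have abv s : 0 <= s -> s <= t -> cc < z s by exact: (dini_stay_above zc z_dini slope0 zt).
have zle s : 0 <= s -> s <= t -> z s <= z 0.
  by move=> s0 _; exact: (dini_le_start zc z_dini slope0 (abv 0 (lexx 0) t0)).
have bnd s : 0 <= s -> s <= t -> kk * u (y s).1 <= n (y s).1 /\ kk * u (y s).1 ^+ 2 <= V (y s).1.
  by move=> s0 st; apply: trap (yS s) _; rewrite -yE -z0E; exact: zle.
have H : z t <= z 0 * expR (- lam * (t - 0)).
  apply: (dini_exp t0); first exact: cont_on_continuous.
  move=> s /andP[s0 st] e e0; have [d d0 H] := z_dini s0 (abv s s0 (ltW st)) e0.
  exists d => // h hd; apply: le_trans (H h hd) _.
  have h0 : 0 <= h by case/andP: hd => /ltW.
  rewrite lerD2l ler_wpM2l// lerD2r.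
  have [B1 _] := bnd s s0 (ltW st).
  have uk0 : 0 <= kk * u (y s).1 := mulr_ge0 (ltW kk_gt0) (nrm_ge0 _).
  apply: (decay_slope eps_gt0 c1_gt0 uk0 B1).
  by rewrite /z yE; exact: lyap_le_dist.
have exE : expR (- lam * (t - 0)) = expR (- (eps / (48 * c1) * kk ^+ 2 * t)) ^+ 2.
  by rewrite expr2 -expRD; congr expR; rewrite /lam; field; rewrite gt_eqF.
rewrite exE in H.
have [_ B] := bnd t t0 (lexx t).
apply: (decay_bound c1_gt0 kk_gt0 kk_le1 (nrm_ge0 _) (nrm_ge0 _) (expR_gt0 _) B _ _ (Z := z 0)).
  by apply: le_trans H; rewrite /z [in leRHS]yE; exact: lyap_ge.
by rewrite z0E; exact: lyap_le_dist.
Qed.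

End Decay.

(** * Comparison functions *)

Section Comparison.
Context {R : realType}.
Implicit Types (r s t : R).

Definition gain (kap : R -> R) := [/\ continuous kap, forall r, 0 < kap r &
  forall r s, r <= s -> kap s <= kap r].

(** Turns constants found separately for each radius into one continuous monotone function. Half of
    the supremum of the admissible constants is admissible by downward closure and monotone in [r];
    its jumps are then removed from below. *)
Lemma gain_exists (P : R -> R -> Prop) :
  (forall r r' k k', 0 <= r' -> r' <= r -> 0 < k' -> k' <= k -> P r k -> P r' k') ->
  (forall r, 0 <= r -> exists2 k, 0 < k & P r k) ->
  exists2 kap, gain kap & forall r, 0 <= r -> kap r <= 1 /\ P r (kap r).
Proof.
move=> anti ex.
pose A r := [set k | [/\ 0 < k, k <= 1 & P r k]].
have A_ub r : ubound (A r) 1 by move=> k [].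
have A_ne r : 0 <= r -> A r !=set0.
  move=> r0; have [k k0 Pk] := ex r r0; exists (Num.min k 1); split.
  - by rewrite lt_min k0 ltr01.
  - by rewrite ge_min lexx orbT.
  - by apply: anti Pk => //; rewrite ?lt_min ?k0 ?ltr01// ge_min lexx.
have supA r : 0 <= r -> has_sup (A r) by move=> r0; split; [exact: A_ne|exists 1].
pose h r := sup (A r) / 2.
have h0 r : 0 <= r -> 0 < h r.
  move=> r0; have [k Ak] := A_ne r r0; rewrite divr_gt0//.
  by apply: lt_le_trans (sup_upper_bound (supA r r0) Ak); case: Ak.
have hP r : 0 <= r -> P r (h r).
  move=> r0; have [k [k0 _ Pk] hk] := sup_adherent (h0 r r0) (supA r r0).
  apply: anti Pk; rewrite ?h0//; apply: ltW; apply: le_lt_trans hk.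
  by rewrite /h; lra.
have h1 r : 0 <= r -> h r <= 1.
  move=> r0; have : sup (A r) <= 1 by apply: ge_sup; [exact: A_ne|exact: A_ub].
  by have := h0 r r0; rewrite /h; lra.
have h_anti r s : 0 <= r -> r <= s -> h s <= h r.
  move=> r0 rs; have s0 := le_trans r0 rs; rewrite ler_pM2r//.
  apply: ge_sup; first exact: A_ne.
  move=> k [k0 k1 Pk]; apply: sup_upper_bound; first exact: supA.
  by split => //; apply: anti Pk.
(* inf-convolution of the monotone function [h], which is 1-Lipschitz *)
pose B r := [set h v + Num.max 0 (v - r) | v in [set v | 0 <= v]].
pose kap r := inf (B r).
(* Keeps the convolution positive: for [v] up to 1 beyond [Num.max r 0], [h] is bounded below, and
   further out the penalty is at least 1. *)
have B_ge r x : B r x -> Num.min (h (Num.max r 0 + 1)) 1 <= x.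
  move=> [v /= v0 <-]; have [vr|vr] := leP v (Num.max r 0 + 1).
    rewrite ge_min; apply/orP; left.
    apply: (le_trans (h_anti _ _ v0 vr)); rewrite lerDl le_max lexx//.
  rewrite ge_min; apply/orP; right.
  have : r <= Num.max r 0 by rewrite le_max lexx.
  have : v - r <= Num.max 0 (v - r) by rewrite le_max lexx orbT.
  have := h0 v v0; lra.
have B_inf r : has_inf (B r).
  split; first by exists (h 0 + Num.max 0 (0 - r)), 0 => //=.
  by exists (Num.min (h (Num.max r 0 + 1)) 1) => x; exact: B_ge.
have kap_le r v : 0 <= v -> kap r <= h v + Num.max 0 (v - r).
  by move=> v0; apply: ge_inf; [exact: (B_inf r).2|exists v].
have kap0 r : 0 < kap r.
  apply: (@lt_le_trans _ _ (Num.min (h (Num.max r 0 + 1)) 1)).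
    by rewrite lt_min ltr01 andbT h0// addr_ge0// le_max lexx orbT.
  by apply: lb_le_inf; [exact: (B_inf r).1|move=> x; exact: B_ge].
have kap_anti r s : r <= s -> kap s <= kap r.
  move=> rs; apply: lb_le_inf; first exact: (B_inf r).1.
  move=> _ [v /= v0 <-]; apply: le_trans (kap_le s v v0) _.
  by rewrite lerD2l ge_max le_max lexx /= le_max lerB ?orbT.
have kap_lip r s : r <= s -> kap r <= kap s + (s - r).
  move=> rs; rewrite -lerBlDr; apply: lb_le_inf; first exact: (B_inf s).1.
  move=> _ [v /= v0 <-]; rewrite lerBlDr; apply: le_trans (kap_le r v v0) _.
  rewrite -addrA lerD2l ge_max; apply/andP; split.
    by rewrite addr_ge0 ?subr_ge0// le_max lexx.
  have : v - s <= Num.max 0 (v - s) by rewrite le_max lexx orbT.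
  by lra.
exists kap.
  split => // t; apply/cvgrPdist_le => e e0; near=> s.
  have : `|t - s| <= e by near: s; apply: cvgr_dist_le; [exact: cvg_id|].
  have [ts|/ltW ts] := leP t s.
    have := kap_lip t s ts; have := kap_anti t s ts.
    rewrite distrC (ger0_norm (_ : 0 <= s - t)) ?subr_ge0// => A1 A2 A3.
    by rewrite ger0_norm ?subr_ge0//; lra.
  have := kap_lip s t ts; have := kap_anti s t ts.
  rewrite (ger0_norm (_ : 0 <= t - s)) ?subr_ge0// distrC => A1 A2 A3.
  by rewrite ger0_norm ?subr_ge0//; lra.
move=> r r0; have kh : kap r <= h r.
  by apply: le_trans (kap_le r r r0) _; rewrite subrr maxxx addr0.
split; first exact: le_trans kh (h1 r r0).
by apply: anti (hP r r0).
Unshelve. all: by end_near. Qed.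

Lemma gain_classK kap A : 0 < A -> gain kap -> continuous (fun r => r * (A / kap r)) /\
  classK (fun r => r * (A / kap r)).
Proof.
move=> A0 [kc k0 ka].
have c : continuous (fun r => r * (A / kap r)).
  move=> r; apply: cvgM; first exact: cvg_id.
  apply: cvgM; first exact: cvg_cst.
  by apply: cvgV; [rewrite gt_eqF|exact: kc].
split => //; split; [by rewrite mul0r|exact: continuous_subspaceT|].
move=> r s r0 rs; have s0 := le_lt_trans r0 rs.
apply: (@le_lt_trans _ _ (r * (A / kap s))).
  by rewrite ler_wpM2l// ler_pM2l// lef_pV2 ?posrE// ka// ltW.
by rewrite ltr_pM2r// divr_gt0.
Qed.

Lemma classK_comp (f g : R -> R) : continuous f -> continuous g -> classK f -> classK g ->
  classK (fun r => f (g r)).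
Proof.
move=> fc gc [f0 _ fi] [g0 _ gi]; split.
- by rewrite g0 f0.
- by apply: continuous_subspaceT => r; apply: (@continuous_comp _ _ _ g f); [exact: gc|exact: fc].
- move=> r s r0 rs; apply: fi; last exact: gi.
  move: r0; rewrite le_eqVlt => /predU1P[<-|r0]; first by rewrite g0.
  by rewrite -g0 ltW// gi.
Qed.

(** Increasing in [r] for two reasons: [r / kap r] grows, and the smaller rate [kap r ^+ 2] slows
    the exponential. Convergence in [t] is asked for each [r] separately, so rates may degenerate as
    [r] grows. *)
Lemma gain_classKL kap A B : 0 < A -> 0 < B -> gain kap ->
  classKL (fun r t => r * (A / kap r) * expR (- (B * kap r ^+ 2 * t))).
Proof.
move=> A0 B0 gk; have [kc k0 ka] := gk.
have [gc [_ _ gi]] := gain_classK A0 gk.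
have ge0 r : 0 <= r -> 0 <= r * (A / kap r).
  by move=> r0; rewrite mulr_ge0// divr_ge0// ltW.
split => [t t0|r r0].
  split; first by rewrite !mul0r.
    apply: continuous_subspaceT => r; apply: cvgM; first exact: gc.
    apply: (@continuous_comp _ _ _ (fun r => - (B * kap r ^+ 2 * t)) expR); last exact: continuous_expR.
    apply: cvgN; apply: cvgM; last exact: cvg_cst.
    apply: cvgM; first exact: cvg_cst.
    by rewrite expr2; apply: cvgM; exact: kc.
  move=> r s r0 rs.
  apply: (@lt_le_trans _ _ (s * (A / kap s) * expR (- (B * kap r ^+ 2 * t)))).
    by rewrite ltr_pM2r ?expR_gt0// gi.
  rewrite ler_wpM2l ?ge0 ?(le_trans r0 (ltW rs))// ler_expR lerN2.
  rewrite ler_wpM2r// ler_wpM2l ?(ltW B0)// ler_sqr ?nnegrE ?(ltW (k0 _))//.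
  exact: ka (ltW rs).
split.
  move=> t1 t2 t10 t12; rewrite ler_wpM2l ?ge0// ler_expR lerN2 ler_wpM2l//.
  by rewrite mulr_ge0 ?sqr_ge0// ltW.
have l0 : 0 < B * kap r ^+ 2 by rewrite mulr_gt0// exprn_gt0.
move: (B * kap r ^+ 2) (r * (A / kap r)) l0 (ge0 r r0) => l q l0 q0.
apply/cvgrPdist_le => e e0; near=> t.
have t0 : 0 < t by near: t; apply: nbhs_pinfty_gt; exact: num_real.
have te : q / (l * e) <= t by near: t; apply: nbhs_pinfty_ge; exact: num_real.
rewrite sub0r normrN ger0_norm ?mulr_ge0 ?expR_ge0//.
rewrite expRN ler_pdivrMr ?expR_gt0//.
have : l * t <= expR (l * t).
  by have := expR_ge1Dx (l * t); lra.
rewrite ler_pdivrMr ?mulr_gt0// in te.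
move=> H; apply: (le_trans te).
have -> : t * (l * e) = e * (l * t) by ring.
by rewrite ler_wpM2l ?(ltW e0).
Unshelve. all: by end_near. Qed.

Lemma classKinf_bound (chi : R -> R) : classKinf chi -> forall M : R,
  exists2 r, 0 <= r & forall v, 0 <= v -> chi v <= M -> v <= r.
Proof.
move=> [[_ _ ci] cu] M; have [r [r0 rM]] := cu (M + 1); exists r => // v v0 vM.
rewrite leNgt; apply/negP => rv; have := ci r v r0 rv; lra.
Qed.

Lemma classK_gt0 (chi : R -> R) r : classK chi -> 0 < r -> 0 < chi r.
Proof. by move=> [c0 _ ci] r0; rewrite -c0 ci. Qed.

Lemma classK_ge0 (chi : R -> R) r : classK chi -> 0 <= r -> 0 <= chi r.
Proof.
move=> cK; rewrite le_eqVlt => /predU1P[<-|r0]; first by case: cK => -> .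
exact/ltW/classK_gt0.
Qed.

End Comparison.

(** * Stability *)

Section Assembly.
Context {R : realType}.
Notation mu := (@lebesgue_measure R).
Implicit Types (p o : @pt R).

Lemma eps_exists (Om c1 C1 k : R) : 0 < Om -> 0 < c1 -> 0 <= C1 -> 0 < k ->
  exists2 eps, 0 < eps & [/\ 8 * c1 * eps <= Om,
    eps * (1 + 2 * C1 ^+ 2 * k ^+ 2) <= k & eps * C1 <= 1].
Proof.
move=> Om0 c0 C0 k0; pose d := 1 + 2 * C1 ^+ 2 * k ^+ 2.
have d0 : 0 < d by rewrite ltr_pwDl// mulr_ge0 ?sqr_ge0// mulr_ge0 ?sqr_ge0.
have C10 : 0 < C1 + 1 by rewrite ltr_wpDl.
exists (Num.min (Om / (8 * c1)) (Num.min (k / d) (1 / (C1 + 1)))).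
  by rewrite !lt_min !divr_gt0// mulr_gt0.
split.
- by rewrite mulrC -ler_pdivlMr ?mulr_gt0// ge_min lexx.
- by rewrite -ler_pdivlMr// ge_min; apply/orP; right; rewrite ge_min lexx.
- apply: (@le_trans _ _ (1 / (C1 + 1) * C1)); first by rewrite ler_wpM2r// !ge_min lexx !orbT.
  by rewrite mulrAC ler_pdivrMr// !mul1r lerDl.
Qed.

Variables (psi : @pt R -> R) (ps : @pt R) (Om alpha c c1 : R) (varpi : nat) (eps : R).
Hypotheses (sm : smooth2 psi) (alpha_gt0 : 0 < alpha) (c_gt0 : 0 < c) (c1_gt0 : 0 < c1).
Hypothesis hessb : forall i j p, `|hessE psi i j p| <= c1.
Hypotheses (Om_gt0 : 0 < Om) (eps_gt0 : 0 < eps).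
Hypotheses (psmax : cond1 psi ps) (negdef : cond2 psi ps) (symm : cond3 psi ps).
Hypothesis gradn0 : cond5 psi ps.
Notation lyap := (lyap psi ps Om eps).
Notation n p := (nrm (grad psi p)).
Notation u p := (nrm (psub p ps)).
Notation V p := (psi ps - psi p).
Let C1 := 4 * c1 / Om.
Let k := alpha * c / 2.
Hypotheses (eps_Om : 8 * c1 * eps <= Om)
  (eps_k : eps * (1 + 2 * C1 ^+ 2 * k ^+ 2) <= k) (eps_C1 : eps * C1 <= 1).

(** Formulated through [lyap], the quantity that decreases along trajectories, and uniform over
    initial states within [r0], so that one growth constant serves them all. *)
Definition traps := forall r0 : R, exists r : R, forall p0 o0 p o, S1 o0 -> S1 o ->
  u p0 <= r0 -> lyap (p, o) <= lyap (p0, o0) -> u p <= r.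

Hypothesis trapped : traps.
Variables (K r s : R).
Hypotheses (K_gt0 : 0 < K) (s_gt0 : 0 < s).
Hypothesis far : forall p w, r <= u p -> nrm w <= s ->
  forall i j, `|hessE psi i j (padd p w)| <= K * n p.

Lemma trap_gain : exists2 kap, gain kap & forall r, 0 <= r -> kap r <= 1 /\
  forall p0 o0 p o, S1 o0 -> S1 o -> u p0 <= r -> lyap (p, o) <= lyap (p0, o0) ->
    kap r * u p <= n p /\ kap r * u p ^+ 2 <= V p.
Proof.
apply: (@gain_exists _ (fun r k => forall p0 o0 p o, S1 o0 -> S1 o -> u p0 <= r ->
   lyap (p, o) <= lyap (p0, o0) -> k * u p <= n p /\ k * u p ^+ 2 <= V p)).
- move=> r1 r2 k1 k2 r20 r21 k20 k21 H p0 o0 p o h1 h2 h3 h4.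
  have [A B] := H p0 o0 p o h1 h2 (le_trans h3 r21) h4.
  by split; [apply: le_trans A|apply: le_trans B]; rewrite ler_wpM2r ?nrm_ge0 ?sqr_ge0.
- move=> r1 _; have [r2 H] := trapped r1.
  have [k1 k10 H1] := ball_bounds sm c1_gt0 hessb psmax negdef gradn0 r2.
  by exists k1 => // p0 o0 p o h1 h2 h3 h4; apply: H1; exact: H h1 h2 h3 h4.
Qed.

(** Common core of both stability statements. The KL function is fixed before input and solution;
    the input bound [m], the level [cc] and the radius [gam] stay open until the end. *)
Lemma field_stable : exists2 a0 : R, 0 < a0 & forall a, 0 < a -> a < a0 ->
  exists b, classKL b /\ forall (w : R -> R) (T : \bar R) x, loc_bounded w ->
    maximal_sol (field psi Om alpha c varpi a) w T x -> T = +oo%E /\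
    (forall t, 0 <= t -> inX (x t)) /\
    forall m cc gam : R, 0 <= m -> (forall T : R, {ae mu, forall x, 0 <= x <= T -> `|w x| <= m}) ->
      (forall p o, S1 o -> n p <= 16 * m / eps -> lyap (p, o) <= cc) ->
      (forall p o, S1 o -> lyap (p, o) <= cc -> u p <= gam) ->
      forall t, 0 <= t -> u (x t).1 <= b (u (x 0).1) t \/ u (x t).1 <= gam.
Proof.
have [C [a1 [C0 a10 small]]] :=
  phi_le_grad varpi sm alpha_gt0 c_gt0 c1_gt0 hessb psmax negdef symm gradn0 K_gt0 s_gt0 far.
pose th := eps / 16.
have th0 : 0 < th by rewrite divr_gt0.
(* [a <= th / C] brings [a * |phi|] down to [th * n] with [th = eps / 16], the tolerance of
   [lyapunov_decrease]. *)
exists (Num.min a1 (th / C)); first by rewrite lt_min a10 divr_gt0.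
move=> a a0; rewrite lt_min => /andP[aa1 ath].
have {}small p o : S1 o -> a * `|phi_a psi alpha c varpi a (p, o)| <= th * n p.
  move=> o1; apply: le_trans (ler_wpM2l (ltW a0) (small a p o a0 aa1 o1)) _.
  by rewrite mulrA ler_wpM2r ?nrm_ge0// -ler_pdivlMr// ltW.
have [kap gk Hk] := trap_gain.
have A0 : 0 < 1 + 6 * c1 by rewrite addr_gt0// mulr_gt0.
have B0 : 0 < eps / (48 * c1) by rewrite divr_gt0// mulr_gt0.
exists (fun r t => r * ((1 + 6 * c1) / kap r) * expR (- (eps / (48 * c1) * kap r ^+ 2 * t))).
split; first exact: gain_classKL.
move=> w T x wb xmax.
have [TE [sg [sgc sgE xE]]] := maximal_traj sm alpha_gt0 c_gt0 c1_gt0 hessb a0 Om_gt0 wb xmax.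
have x0S : S1 (x 0).2 by case: xmax => _ [[+ _] _].
split => //; split => [t t0|m cc gam m0 wm small_le level_le t t0].
  by rewrite /inX xE//; exact: rot_S1.
have u0 : 0 <= u (x 0).1 by exact: nrm_ge0.
have [k1 trap] := Hk _ u0.
have k0 : 0 < kap (u (x 0).1) by case: gk.
have {}trap p o' : S1 o' -> lyap (p, o') <= lyap ((x 0).1, (x 0).2) ->
   kap (u (x 0).1) * u p <= n p /\ kap (u (x 0).1) * u p ^+ 2 <= V p.
  by move=> h1 h2; exact: trap x0S h1 (lexx _) h2.
have th16 : 16 * th <= eps by rewrite /th mulrC divfK.
rewrite [x t]xE//.
exact: (decay sm alpha_gt0 c_gt0 c1_gt0 hessb a0 Om_gt0 eps_gt0 psmax eps_Om wb x0S sgc sgE m0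
  (ltW th0) eps_k eps_C1 th16 small wm k0 k1 trap small_le level_le t0).
Qed.

End Assembly.

Section Unicycle.
Context {R : realType}.
Notation mu := (@lebesgue_measure R).
Implicit Types (p o : @pt R).

Variables (Om alpha c : R) (varpi : nat) (psi : @pt R -> R) (ps : @pt R).
Hypotheses (Om_gt0 : 0 < Om) (alpha_gt0 : 0 < alpha) (c_gt0 : 0 < c) (sm : smooth2 psi).
Hypotheses (psmax : cond1 psi ps) (negdef : cond2 psi ps) (symm : cond3 psi ps).
Notation n p := (nrm (grad psi p)).
Notation u p := (nrm (psub p ps)).
Notation V p := (psi ps - psi p).

Section Traps.
Variables (c1 eps : R).
Hypotheses (c1_gt0 : 0 < c1) (eps_gt0 : 0 < eps) (eps_Om : 8 * c1 * eps <= Om).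
Hypothesis hessb : forall i j p, `|hessE psi i j p| <= c1.

(** [lyap] is at least [V / 2] at [p] and at most [3 * c1 * r0 ^+ 2] at [p0], which caps [V p]. *)
Lemma traps_coercive : (forall M : R, exists r : R, forall p, V p <= M -> u p <= r) ->
  traps psi ps Om eps.
Proof.
move=> co r0; have [r H] := co (6 * c1 * r0 ^+ 2); exists r => p0 o0 p o o01 o1 pr le; apply: H.
have A := lyap_ge sm c1_gt0 hessb Om_gt0 eps_gt0 psmax eps_Om p o1.
have B := lyap_le_dist sm c1_gt0 hessb Om_gt0 eps_gt0 psmax eps_Om p0 o01.
have C : u p0 ^+ 2 <= r0 ^+ 2 by rewrite ler_sqr ?nnegrE ?nrm_ge0// (le_trans (nrm_ge0 _) pr).
have := ler_wpM2l (ltW c1_gt0) C; lra.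
Qed.

(* The quadratic correction in [lyap] is at most half of [psi ps - psi p] and at most half of
   [psi p - inf psi], so a sublevel set of [lyap] stays at a positive distance from [inf psi],
   even when [inf psi] is finite. *)
Lemma traps_superlevel : cond5 psi ps -> cond6 psi ps -> traps psi ps Om eps.
Proof.
(* The maximum with 1 makes the ball nonempty, [r0] being arbitrary. *)
move=> gradn0 comp r0; pose r1 := Num.max r0 1.
have [q /set_mem /= qr qmin] : exists2 q, q \in [set p : @pt R | 0 <= u p <= r1] &
    forall p, p \in [set p : @pt R | 0 <= u p <= r1] -> psi q <= psi p.
  apply: compact_EVT_min; last by apply: continuous_subspaceT; exact: continuous_psi.
    by exists ps; rewrite /= psubpp nrm0 lexx le_max ler01 orbT.
  exact: compact_annulus.
have {}qmin p : u p <= r1 -> psi q <= psi p.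
  by move=> pr; apply: qmin; apply/mem_set; rewrite /= nrm_ge0.
(* If [psi] reached its infimum at [q], then [q] would be critical, hence [ps] by [gradn0], although
   [ps] is the strict maximum. *)
have q_inf : (inf_psi psi < (psi q)%:E)%E.
  rewrite ltNge; apply/negP => qi.
  have qle p : psi q <= psi p.
    by rewrite -lee_fin; apply: le_trans qi _; apply: ereal_inf_lbound; exists p.
  have gq : grad psi q = (0, 0).
    apply: nrm_eq0; apply/eqP; rewrite -sqrf_eq0 eq_le sqr_ge0 andbT.
    by have := grad_sq_le_min sm c1_gt0 hessb qle q; rewrite subrr mulr0.
  have qps : q = ps by have [//|/eqP/gradn0] := eqVneq q ps.
  pose e := padd ps (1, 0) : @pt R.
  have : e <> ps.
    by rewrite /e /padd => /(congr1 fst) /= /eqP; rewrite -subr_eq0 addrAC subrr add0r oner_eq0.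
  by move/psmax; rewrite ltNge -qps qle.
have qps : psi q <= psi ps by exact: psi_le.
have [y [yi yps Hy]] : exists y, [/\ (inf_psi psi < y%:E)%E, y < psi ps &
    forall p0 o0 p o, S1 o0 -> S1 o -> u p0 <= r0 ->
      lyap psi ps Om eps (p, o) <= lyap psi ps Om eps (p0, o0) -> y <= psi p].
  have r01 : r0 <= r1 by rewrite le_max lexx.
  have A p o := @lyap_ge _ psi ps Om c1 eps sm c1_gt0 hessb Om_gt0 eps_gt0 psmax eps_Om p o.
  have B p o := @lyap_le _ psi ps Om c1 eps sm c1_gt0 hessb Om_gt0 eps_gt0 psmax eps_Om p o.
  case Hl : (inf_psi psi) q_inf => [l| |] q_inf.
  - rewrite lte_fin in q_inf.
    have lle p : l <= psi p by rewrite -lee_fin -Hl; apply: ereal_inf_lbound; exists p.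
    (* With each correction at most half the height above [l], comparing [lyap] at [p] and [p0]
       yields [3 * psi p >= psi p0 + 2 * l]. *)
    exists ((psi q + 2 * l) / 3); split; [rewrite lte_fin; lra|lra|].
    move=> p0 o0 p o o01 o1 pr; rewrite /lyap /=.
    have small x z : S1 z -> `|eps * quad Om (grad psi x) z| <= (psi x - l) / 2.
      move=> z1; apply: le_trans (quad_small psi c1_gt0 Om_gt0 eps_gt0 eps_Om x z1) _.
      rewrite ler_pdivrMr ?mulr_gt0//.
      by have := grad_sq_le_min sm c1_gt0 hessb lle x; lra.
    have /ler_normlP[S1' _] := small p o o1; have /ler_normlP[_ S2'] := small p0 o0 o01.
    have := qmin p0 (le_trans pr r01).
    by move: S1' S2'; move: (eps * _) (eps * _) => e1 e2; lra.
  - by have := lt_le_trans q_inf (leey _); rewrite ltxx.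
  (* Here [V p <= 2 * lyap <= 3 * V p0 <= 3 * V q]; the extra [- 1] places the level strictly below
     the maximum. *)
  - exists (psi ps - 3 * V q - 1); split; [by rewrite ltNyr|lra|].
    move=> p0 o0 p o o01 o1 pr le.
    have := A p o o1; have := B p0 o0 o01; have := qmin p0 (le_trans pr r01).
    by move: le; move: (lyap _ _ _ _ _) (lyap _ _ _ _ _) => e1 e2; lra.
have yc := comp y yi yps.
have [p1 _ H1] : exists2 p1, p1 \in [set p : @pt R | y <= psi p] &
    forall p, p \in [set p : @pt R | y <= psi p] -> u p <= u p1.
  apply: compact_EVT_max => //; first by exists ps; rewrite /= ltW.
  by apply: continuous_subspaceT; exact: continuous_nrm_psub.
exists (u p1) => p0 o0 p o o01 o1 pr le; apply: H1; apply/mem_set.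
exact: Hy o01 o1 pr le.
Qed.

End Traps.

Lemma cond4_hessE : cond4 psi -> exists2 c1 : R, 0 < c1 & forall i j p, `|hessE psi i j p| <= c1.
Proof.
by move=> [c1 [c10 H]]; exists c1 => // i j p; apply: le_trans (hessE_le _ _ _ _) (H p).
Qed.

Let C1_ge0 c1 : 0 < c1 -> 0 <= 4 * c1 / Om.
Proof. by move=> c10; rewrite divr_ge0 ?(ltW Om_gt0)// mulr_ge0 ?ltW. Qed.

Let k_gt0 : 0 < alpha * c / 2. Proof. by rewrite divr_gt0// mulr_gt0. Qed.

(** Zero input permits [m = cc = gam = 0]: the residual set is [ps] alone, and there the KL bound
    holds because it is nonnegative. *)
Lemma unicycle_zeroGAS : cond4 psi -> cond5 psi ps -> cond6 psi ps -> cond7 psi ps ->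
  exists a0 : R, 0 < a0 /\ forall a : R, 0 < a -> a < a0 ->
    zeroGAS (field psi Om alpha c varpi a) ps.
Proof.
move=> /cond4_hessE[c1 c10 hessb] gradn0 comp [c2 [r2 [r3 [[c20 r20 r30] far]]]].
have [eps eps0 [eOm ek eC]] := eps_exists Om_gt0 c10 (C1_ge0 c10) k_gt0.
have trap := traps_superlevel c10 eps0 eOm hessb gradn0 comp.
have [a0 a00 H] := field_stable varpi sm alpha_gt0 c_gt0 c10 hessb Om_gt0 eps0 psmax negdef symm
  gradn0 eOm ek eC trap c20 r30 (fun p w hp hw i j => le_trans (hessE_le psi i j _) (far p w hp hw)).
exists a0; split => // a apos aa; have [b [bKL Hb]] := H a apos aa.
exists b; split => // T x xmax.
have w0 : loc_bounded (fun _ : R => 0 : R) by exact/loc_bounded_continuous/cst_continuous.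
have [TE [xX Hx]] := Hb _ _ _ w0 xmax; split => // t t0.
rewrite (distKE ps (xX t t0)) (distKE ps (xX 0 (lexx 0))).
have u0_of p : V p <= 0 -> u p <= 0.
  move=> Vp; have [->|/eqP/psmax pp] := eqVneq p ps; first by rewrite psubpp nrm0.
  by move: Vp pp; lra.
have gps := grad_ps sm c10 hessb psmax.
have w0le (S : R) : {ae mu, forall y, 0 <= y <= S -> `|(0 : R)| <= 0}.
  by apply: aeW => y _; rewrite normr0.
have small p o : S1 o -> n p <= 16 * 0 / eps -> lyap psi ps Om eps (p, o) <= 0.
  move=> o1; rewrite mulr0 mul0r => np.
  have gp : grad psi p = (0, 0) by apply: nrm_eq0; apply/eqP; rewrite eq_le np nrm_ge0.
  have -> : p = ps by have [//|/eqP/gradn0] := eqVneq p ps.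
  by have := lyap_le sm c10 hessb Om_gt0 eps0 psmax eOm ps o1; rewrite subrr mulr0.
have level p o : S1 o -> lyap psi ps Om eps (p, o) <= 0 -> u p <= 0.
  move=> o1 lp; apply: u0_of.
  by have := lyap_ge sm c10 hessb Om_gt0 eps0 psmax eOm p o1; lra.
have [//|le0] := Hx 0 0 0 (lexx 0) w0le small level t t0.
apply: le_trans le0 _.
by apply: classK_ge0 (bKL.1 t t0) _; exact: nrm_ge0.
Qed.

(** The gain is a composition: [rho] turns the input bound into a radius for the region where the
    gradient is too small to win, and [gam] turns that radius into one for a sublevel set of [lyap]
    containing the region. *)
Lemma unicycle_ISS (chi1 chi3 : R -> R) : cond4 psi -> classKinf chi1 -> classKinf chi3 ->
  (forall p, chi1 (u p) <= V p /\ chi3 (u p) <= n p) ->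
  exists a0 : R, 0 < a0 /\ forall a : R, 0 < a -> a < a0 ->
    ISS (field psi Om alpha c varpi a) ps.
Proof.
move=> /cond4_hessE[c1 c10 hessb] K1 K3 chiP.
have [K3' _] := K3.
have gradn0 : cond5 psi ps.
  move=> p pps gp; have := (chiP p).2; rewrite gp nrm0 leNgt classK_gt0//.
  exact: nrm_psub_gt0.
have coV (M : R) : exists r : R, forall p, V p <= M -> u p <= r.
  have [r _ H] := classKinf_bound K1 M; exists r => p Vp.
  by apply: H; [exact: nrm_ge0|exact: le_trans (chiP p).1 Vp].
have [eps eps0 [eOm ek eC]] := eps_exists Om_gt0 c10 (C1_ge0 c10) k_gt0.
have trap := traps_coercive c10 eps0 eOm hessb coV.
have x10 : 0 < chi3 1 by exact: classK_gt0.
(* Outside the unit ball the gradient is at least [chi3 1], so the constant Hessian bound is a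
   multiple of it. *)
have Kpos : 0 < c1 / chi3 1 by rewrite divr_gt0.
have far p w : 1 <= u p -> nrm w <= 1 ->
    forall i j, `|hessE psi i j (padd p w)| <= c1 / chi3 1 * n p.
  move=> up _ i j; apply: le_trans (hessb i j _) _.
  rewrite mulrAC ler_pdivlMr// ler_wpM2l ?(ltW c10)//; apply: le_trans (chiP p).2.
  have [_ _ ci] := K3'; move: up; rewrite le_eqVlt => /predU1P[<-//|up].
  by rewrite ltW// ci.
have [a0 a00 H] := field_stable varpi sm alpha_gt0 c_gt0 c10 hessb Om_gt0 eps0 psmax negdef symm
  gradn0 eOm ek eC trap Kpos ltr01 far.
exists a0; split => // a apos aa; have [b [bKL Hb]] := H a apos aa.
have bb r := ball_bounds sm c10 hessb psmax negdef gradn0 r.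
(* Quantifying over all [m' <= m] makes the property pass to smaller [m], as [gain_exists]
   requires. *)
have [kap1 g1 H1] : exists2 kap, gain kap & forall m, 0 <= m -> kap m <= 1 /\
    forall m' p, 0 <= m' -> m' <= m -> n p <= 16 * m' / eps -> kap m * u p <= m'.
  apply: (@gain_exists _ (fun m k => forall m' p, 0 <= m' -> m' <= m ->
     n p <= 16 * m' / eps -> k * u p <= m')).
    move=> m1 m2 k1 k2 m20 m21 k20 k21 P m' p m'0 m'm np.
    by apply: le_trans (P m' p m'0 (le_trans m'm m21) np); rewrite ler_wpM2r ?nrm_ge0.
  move=> m m0; have [r _ Hr] := classKinf_bound K3 (16 * m / eps).
  have [k k0 Hk] := bb r; exists (k * eps / 16); first by rewrite divr_gt0// mulr_gt0.
  move=> m' p m'0 m'm np.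
  have up : u p <= r.
    apply: Hr; first exact: nrm_ge0.
    apply: le_trans (chiP p).2 _; apply: le_trans np _.
    by rewrite ler_pM2r ?invr_gt0// ler_pM2l.
  have [kn _] := Hk p up.
  have := le_trans kn np; rewrite ler_pdivlMr//; lra.
have [kap2 g2 H2] : exists2 kap, gain kap & forall r, 0 <= r -> kap r <= 1 /\
    forall r' p o, S1 o -> 0 <= r' -> r' <= r ->
      lyap psi ps Om eps (p, o) <= 3 * c1 * r' ^+ 2 -> kap r * u p <= r'.
  apply: (@gain_exists _ (fun r k => forall r' p o, S1 o -> 0 <= r' -> r' <= r ->
      lyap psi ps Om eps (p, o) <= 3 * c1 * r' ^+ 2 -> k * u p <= r')).
    move=> m1 m2 k1 k2 m20 m21 k20 k21 P m' p o o1 m'0 m'm np.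
    by apply: le_trans (P m' p o o1 m'0 (le_trans m'm m21) np); rewrite ler_wpM2r ?nrm_ge0.
  move=> r r0; have [q Hq] := coV (6 * c1 * r ^+ 2).
  have [k k0 Hk] := bb q.
  have k10 : 0 < k / (6 * c1) by rewrite divr_gt0// mulr_gt0.
  (* The minimum with 1 gives [kk ^+ 2 <= kk], so a condition linear in [kk] controls a quadratic
     estimate. *)
  exists (Num.min 1 (k / (6 * c1))); first by rewrite lt_min ltr01.
  move=> r' p o o1 r'0 r'r lp; set kk := Num.min _ _.
  have kk0 : 0 < kk by rewrite lt_min ltr01.
  have kk1 : kk <= 1 by rewrite ge_min lexx.
  have kk2 : kk * (6 * c1) <= k by rewrite -ler_pdivlMr ?mulr_gt0// ge_min lexx orbT.
  have Vp : V p <= 6 * c1 * r' ^+ 2.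
    by have := lyap_ge sm c10 hessb Om_gt0 eps0 psmax eOm p o1; lra.
  have rr : r' ^+ 2 <= r ^+ 2 by rewrite ler_sqr ?nnegrE.
  have [_ B] : k * u p <= n p /\ k * u p ^+ 2 <= V p.
    apply/Hk/Hq/(le_trans Vp); rewrite ler_wpM2l// mulr_ge0 ?ltW//.
  rewrite -ler_sqr ?nnegrE ?mulr_ge0 ?nrm_ge0 ?(ltW kk0)// exprMn.
  have u2 : 0 <= u p ^+ 2 by exact: sqr_ge0.
  rewrite -(ler_pM2l (_ : 0 < 6 * c1)) ?mulr_gt0//.
  apply: le_trans Vp; apply: le_trans B; rewrite mulrA ler_wpM2r//.
  apply: le_trans kk2; rewrite mulrC expr2 -mulrA ler_wpM2l ?(ltW kk0)//.
  by rewrite ler_piMl// mulr_ge0 ?ltW.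
pose rho m := m * (1 / kap1 m); pose gam r := r * (1 / kap2 r).
have [rhoc rhoK] := gain_classK ltr01 g1; have [gamc gamK] := gain_classK ltr01 g2.
exists b, (fun m => gam (rho m)); split => //; split; first exact: classK_comp.
move=> w T x wl xmax; have wb := Linf_loc_bounded wl.
have [TE [xX Hx]] := Hb _ _ _ wb xmax; split => // t t0.
rewrite (distKE ps (xX t t0)) (distKE ps (xX 0 (lexx 0))).
case E : (esnorm w) => [m| |]; [|by rewrite addey// leey|by rewrite addey// leey].
have wm : {ae mu, forall s, `|w s| <= m}.
  have := @ess_sup_ge _ _ _ mu (fun t => (`|w t|)%:E); rewrite -/(esnorm w) E => h.
  by apply: (ae_imply h) => s; rewrite lee_fin.
(* An essential supremum of a nonnegative function is nonnegative only if the space has positive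
   measure. *)
have muT : (0 < mu [set: R])%E by rewrite -set_itvNyy lebesgue_measure_itv ltry.
have m0 : 0 <= m.
  by rewrite -lee_fin -E; apply: (ess_sup_gee muT); apply: aeW => s; rewrite lee_fin.
have rho0 : 0 <= rho m by rewrite mulr_ge0// divr_ge0// ltW//; case: g1.
have [_ P1] := H1 m m0; have [_ P2] := H2 _ rho0.
have k1 : 0 < kap1 m by case: g1.
have k2 : 0 < kap2 (rho m) by case: g2.
have b0 : 0 <= b (u (x 0).1) t by apply: classK_ge0 (bKL.1 t t0) _; exact: nrm_ge0.
have gr0 : 0 <= gam (rho m) by rewrite mulr_ge0// divr_ge0// ltW.
rewrite -EFinD lee_fin.
have wmS (S : R) : {ae mu, forall s, 0 <= s <= S -> `|w s| <= m}.
  by apply: (ae_imply wm) => s ws _.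
have small p o : S1 o -> n p <= 16 * m / eps -> lyap psi ps Om eps (p, o) <= 3 * c1 * rho m ^+ 2.
  move=> o1 np; apply: le_trans (lyap_le_dist sm c10 hessb Om_gt0 eps0 psmax eOm p o1) _.
  rewrite ler_wpM2l ?mulr_ge0 ?(ltW c10)// ler_sqr ?nnegrE ?nrm_ge0//.
  by rewrite /rho mul1r ler_pdivlMr// mulrC; exact: P1 m0 (lexx m) np.
have level p o : S1 o -> lyap psi ps Om eps (p, o) <= 3 * c1 * rho m ^+ 2 -> u p <= gam (rho m).
  move=> o1 lp; rewrite /gam mul1r ler_pdivlMr// mulrC.
  exact: P2 o1 rho0 (lexx _) lp.
have [h|h] := Hx m _ _ m0 wmS small level t t0; apply: le_trans h _.
  by rewrite lerDl.
by rewrite lerDr.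
Qed.

End Unicycle.

Theorem theorem3 (Om alpha c : Rdefinitions.R) (varpi : nat)
    (psi : @pt Rdefinitions.R -> Rdefinitions.R) (ps : @pt Rdefinitions.R) :
  0 < Om -> 0 < alpha -> 0 < c -> smooth2 psi ->
  (* (a) *)
  ((cond1 psi ps -> cond2 psi ps -> cond3 psi ps -> cond4 psi ->
    cond5 psi ps -> cond6 psi ps -> cond7 psi ps ->
    exists a0 : Rdefinitions.R, 0 < a0 /\
      forall a : Rdefinitions.R, 0 < a -> a < a0 ->
        zeroGAS (field psi Om alpha c varpi a) ps)
  /\
  (* (b) *)
   (cond1 psi ps -> cond2 psi ps -> cond3 psi ps -> cond4 psi ->
    (exists chi1 chi2 chi3 : Rdefinitions.R -> Rdefinitions.R,
       [/\ classKinf chi1, classKinf chi2, classKinf chi3 &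
       forall p : pt,
         [/\ - chi1 (nrm (psub p ps)) >= psi p - psi ps,
             psi p - psi ps >= - chi2 (nrm (psub p ps)) &
             nrm (grad psi p) >= chi3 (nrm (psub p ps))]]) ->
    exists a0 : Rdefinitions.R, 0 < a0 /\
      forall a : Rdefinitions.R, 0 < a -> a < a0 ->
        ISS (field psi Om alpha c varpi a) ps)).
Proof.
move=> Om0 alpha0 c0 sm; split=> [h1 h2 h3 h4 h5 h6 h7|h1 h2 h3 h4].
  exact: (unicycle_zeroGAS varpi Om0 alpha0 c0 sm h1 h2 h3 h4 h5 h6 h7).
move=> [chi1 [chi2 [chi3 [K1 _ K3 H]]]].
apply: (unicycle_ISS varpi Om0 alpha0 c0 sm h1 h2 h3 h4 K1 K3) => p.
have [H1 _ H3] := H p; split=> //.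
by rewrite -opprB lerNr.
Qed.
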